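(* Let $\alpha\in(0,1)$, $\sigma\ge0$, $u_0=0$, $f(0)\in\hat H^\sigma(\Omega)$ and $\int_0^t\|f_t(s)\|_{\hat H^\sigma(\Omega)}\,ds<\infty$, where $f_t=\partial_tf$. Let $u$ be the solution of the sub-diffusion problem, $\mathbf u(t)=\mathcal I_Nu(t)$, and let $\mathbf u_{h,p}(t)$ be the solution of the modified central finite difference scheme with mesh size $h=1/N$. Then there is a constant $C>0$, independent of $h$, $t$ and $f$, such that for $t\in(0,T]$ $$\|\mathbf u(t)-\mathbf u_{h,p}(t)\|_{l^\infty}\le Ch^{\min(\sigma+\frac32,\,2)}\,\ell_h^{\chi_0(\frac14-\frac\sigma2)}\Big(\|f(0)\|_{\hat H^\sigma(\Omega)}+\int_0^t\|f_t(s)\|_{\hat H^\sigma(\Omega)}\,ds\Big)$$ and $$\|\mathbf u(t)-\mathbf u_{h,p}(t)\|_{l^2}\le Ch^2\Big(\|f(0)\|_{\hat H^\sigma(\Omega)}+\int_0^t\|f_t(s)\|_{\hat H^\sigma(\Omega)}\,ds\Big).$$ Here $\ell_h=|\ln h|^{1/2}$, and $\chi_0(x)=1$ if $x=0$, $\chi_0(x)=0$ if $x\ne0$.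
   Context: Setting: $\Omega=(0,1)$, $T>0$, $A=-\Delta$ on $\Omega$ with homogeneous Dirichlet boundary condition, with eigenvalues $\lambda_k=k^2\pi^2$ and eigenfunctions $\phi_k(x)=\sqrt2\sin(k\pi x)$, $k\ge1$. For $s\ge0$, $\hat H^s(\Omega)=\{v\in L^2(\Omega):\|v\|_{\hat H^s(\Omega)}<\infty\}$ with $\|v\|_{\hat H^s(\Omega)}^2=\sum_{k\ge1}\lambda_k^s(v,\phi_k)^2$, where $(\cdot,\cdot)$ is the $L^2(\Omega)$ inner product. Sub-diffusion problem: ${}_0\partial_t^\alpha(u-u_0)+Au=f$ in $\Omega\times(0,T]$, $u=0$ on $\partial\Omega\times(0,T]$, $u(0)=u_0$, where ${}_0\partial_t^\alpha u=\frac1{\Gamma(1-\alpha)}\frac{\partial}{\partial t}\int_0^t(t-\xi)^{-\alpha}u(\xi)\,d\xi$ is the Riemann–Liouville derivative. For $u_0=0$ its solution is represented as $$u(x,t)=\frac1{2\pi\mathbf i}\int_{\Gamma_\theta}e^{zt}\sum_{i=1}^\infty(z^\alpha+\lambda_i)^{-1}\phi_i(x)(\phi_i,\tilde f(z))\,dz,$$ where $\tilde f$ is the Laplace transform of $f$ in time and $\Gamma_\theta=\{z\in\mathbb C:|\arg z|=\theta,\ |z|>0\}$, $\theta\in(\pi/2,\pi)$, oriented with increasing imaginary part. Discretization: $N\in\mathbb N^*$, $h=1/N$, $x_i=i/N$; for a function $v$, $\mathcal I_Nv=[v(x_1),\dots,v(x_{N-1})]^T$. $P_N$ is the $L^2$-projection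 $P_Nv=\sum_{k=1}^{N-1}(v,\phi_k)\phi_k$. $\mathbf A=[N^2w_{i,j}]_{i,j=1}^{N-1}$ with $w_{i,i}=2$, $w_{i,j}=-1$ if $|i-j|=1$, $w_{i,j}=0$ if $|i-j|>1$. The modified central finite difference scheme is ${}_0\partial_t^\alpha(\mathbf u_{h,p}-\mathbf u_p^0)+\mathbf A\mathbf u_{h,p}=\mathbf f_p$ with $\mathbf u_p^0=\mathcal I_N(P_Nu_0)$, $\mathbf f_p=\mathcal I_N(P_Nf)$ and unknown $\mathbf u_{h,p}(t)\in\mathbb R^{N-1}$; for $u_0=0$ its solution is $\mathbf u_{h,p}(t)=\frac1{2\pi\mathbf i}\int_{\Gamma_\theta}e^{zt}(z^\alpha+\mathbf A)^{-1}\tilde{\mathbf f}_p(z)\,dz$. Discrete norms: for $\mathbf v\in\mathbb R^M$, $\|\mathbf v\|_{l^2}^2=\frac1M\sum_{k=1}^Mv_k^2$, $\|\mathbf v\|_{l^\infty}=\max_{1\le k\le M}|v_k|$. *)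

(* Defs.v *)
From HB Require Import structures.
From mathcomp Require Import all_boot all_order all_algebra.
From mathcomp Require Import all_classical all_reals all_analysis.

Set Implicit Arguments.
Unset Strict Implicit.
Unset Printing Implicit Defensive.

Import Order.TTheory GRing.Theory Num.Theory.
Import numFieldNormedType.Exports.

Local Open Scope classical_set_scope.
Local Open Scope ring_scope.

(* Functions of time and space are curried, [u t x].  Only their values for
   x in [0, 1] and t in [0, T] matter. *)

Definition Omega (R : realType) : set R := `]0, 1[%classic.
Arguments Omega {R}.

Definition normL2 (R : realType) (v : R -> R) : \bar R :=
  sqrte (\int[lebesgue_measure]_(x in Omega) ((v x) ^+ 2)%:E)%E.

Definition inL2 (R : realType) (v : R -> R) : Prop :=
  measurable_fun Omega v /\ (normL2 v < +oo)%E.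

Definition inner (R : realType) (v w : R -> R) : R :=
  \int[lebesgue_measure]_(x in Omega) (v x * w x).

Definition lambda_ (R : realType) (k : nat) : R := k%:R ^+ 2 * pi ^+ 2.

Definition phi (R : realType) (k : nat) (x : R) : R :=
  Num.sqrt 2 * sin (k%:R * pi * x).

(* The value is meaningful for v in L^2 only: [inner] is 0 when the product is
   not integrable.  Membership is therefore a separate predicate. *)
Definition normH (R : realType) (s : R) (v : R -> R) : \bar R :=
  sqrte (\sum_(1 <= k <oo) (lambda_ R k `^ s * inner v (phi k) ^+ 2)%:E)%E.

Definition inH (R : realType) (s : R) (v : R -> R) : Prop :=
  inL2 v /\ (normH s v < +oo)%E.

Definition Gamma (R : realType) (a : R) : R :=
  \int[lebesgue_measure]_(t in `]0, +oo[) (t `^ (a - 1) * expR (- t)).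

Definition RL_integral (R : realType) (alpha : R) (v : R -> R) (t : R) : R :=
  (Gamma (1 - alpha))^-1 *
  \int[lebesgue_measure]_(xi in `]0, t[) ((t - xi) `^ (- alpha) * v xi).

(* At the end point T the time derivatives are taken from the left, through
   the restriction of the difference quotient to [0, T]. *)
Definition RL_deriv_at (R : realType) (T alpha : R) (v : R -> R) (t d : R) :
    Prop :=
  (RL_integral alpha v s - RL_integral alpha v t) / (s - t)
    @[s --> within `[0, T] t^'] --> d.

(* The same derivative for an L^2(0,1)-valued function of time: the difference
   quotient converges in L^2(0,1). *)
Definition RL_deriv_L2_at (R : realType) (T alpha : R) (v : R -> R -> R)
    (t : R) (d : R -> R) : Prop :=
  normL2 (fun x => (RL_integral alpha (v ^~ x) s
                    - RL_integral alpha (v ^~ x) t) / (s - t) - d x)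
    @[s --> within `[0, T] t^'] --> 0%E.

(* v is in H^2(0,1) with - v'' = w, i.e. v is an antiderivative of an absolutely
   continuous function p with p' = - w almost everywhere. *)
Definition neg_laplacian (R : realType) (v w : R -> R) : Prop :=
  inL2 w /\
  exists p : R -> R, forall x, 0 <= x <= 1 ->
    v x = v 0 + \int[lebesgue_measure]_(y in `[0, x]) p y /\
    p x = p 0 - \int[lebesgue_measure]_(y in `[0, x]) w y.

(* Strong L^2 solutions.  Each u(t), t > 0, is represented by its continuous
   version, so that its values at the grid points make sense; the initial value
   is attained in L^2(0,1). *)
Record subdiffusion_solution (R : realType) (T alpha : R) (u0 : R -> R)
    (f u : R -> R -> R) : Prop := SubdiffusionSolution {
  sol_continuous :
    {within `]0, T] `*` `[0, 1], continuous (fun p : R * R => u p.1 p.2)};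
  sol_boundary : forall t, 0 < t <= T -> u t 0 = 0 /\ u t 1 = 0;
  sol_initial : forall x, Omega x -> u 0 x = u0 x;
  sol_initial_L2 : normL2 (fun x => u t x - u0 x) @[t --> 0^'+] --> 0%E;
  sol_equation : forall t, 0 < t <= T ->
    exists d Au : R -> R,
      [/\ inL2 d,
          RL_deriv_L2_at T alpha (fun s x => u s x - u0 x) t d,
          neg_laplacian (u t) Au
        & {ae lebesgue_measure, forall x, Omega x -> d x + Au x = f t x}]
}.

(* f is absolutely continuous in time with values in H^sigma, with derivative
   ft: f(0) is in H^sigma, ft is Bochner integrable on (0, T) with values in
   H^sigma, and f(t) = f(0) + int_0^t ft(s) ds in L^2(0,1). *)
Record admissible_source (R : realType) (T sigma : R) (f ft : R -> R -> R) :
    Prop := AdmissibleSource {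
  src_initial : inH sigma (f 0);
  src_deriv_measurable :
    measurable_fun (`]0, T[ `*` Omega) (fun p : R * R => ft p.1 p.2);
  src_deriv_inH :
    {ae lebesgue_measure, forall s, `]0, T[%classic s -> inH sigma (ft s)};
  src_deriv_integrable : forall t, 0 < t <= T ->
    (\int[lebesgue_measure]_(s in `]0%R, t[) normH sigma (ft s) < +oo)%E;
  src_measurable : forall t, 0 < t <= T -> measurable_fun Omega (f t);
  src_deriv : forall t, 0 < t <= T ->
    {ae lebesgue_measure, forall x, Omega x ->
       f t x = f 0 x + \int[lebesgue_measure]_(s in `]0, t[) ft s x}
}.

(* The index i : 'I_N.-1 stands for the interior grid point x_{i+1}. *)
Definition gridvec (R : realType) (N : nat) (v : R -> R) : 'cV[R]_N.-1 :=
  \col_i v (i.+1%:R / N%:R).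

Definition projN (R : realType) (N : nat) (v : R -> R) (x : R) : R :=
  \sum_(1 <= k < N) inner v (phi k) * phi k x.

Definition fdmx (R : realType) (N : nat) : 'M[R]_N.-1 :=
  \matrix_(i, j) (N%:R ^+ 2 *
    (if i == j :> nat then 2
     else if (i.+1 == j) || (j.+1 == i) then -1 else 0)).

Record scheme_solution (R : realType) (T alpha : R) (N : nat) (u0 : R -> R)
    (f : R -> R -> R) (uh : R -> 'cV[R]_N.-1) : Prop := SchemeSolution {
  sch_continuous : forall i, {within `[0, T], continuous (fun t => uh t i 0)};
  sch_initial : uh 0 = gridvec N (projN N u0);
  sch_equation : forall t, 0 < t <= T ->
    exists2 d : 'cV[R]_N.-1,
      (forall i, RL_deriv_at T alpha
         (fun s => (uh s - gridvec N (projN N u0)) i 0) t (d i 0))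
      & d + fdmx R N *m uh t = gridvec N (projN N (f t))
}.

Definition norml2 (R : realType) (M : nat) (v : 'cV[R]_M) : R :=
  Num.sqrt (M%:R^-1 * \sum_(k < M) v k 0 ^+ 2).

Definition normlinf (R : realType) (M : nat) (v : 'cV[R]_M) : R :=
  \big[Num.max/0]_(k < M) `|v k 0|.

Definition ell (R : realType) (h : R) : R := Num.sqrt `|ln h|.

Definition chi0 (R : realType) (x : R) : R := if x == 0 then 1 else 0.

Definition source_size (R : realType) (sigma : R) (f ft : R -> R -> R) (t : R) :
    \bar R :=
  (normH sigma (f 0%R)
   + \int[lebesgue_measure]_(s in `]0%R, t[) normH sigma (ft s))%E.

(* Main.v *)
Require Import Defs.
From HB Require Import structures.
From mathcomp Require Import all_boot all_order all_algebra.
From mathcomp Require Import all_classical all_reals all_analysis.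
From mathcomp Require Import measurable_realfun.
From mathcomp Require Import ring lra zify.

Import Order.TTheory GRing.Theory Num.Theory.
Import numFieldNormedType.Exports.

Local Open Scope classical_set_scope.
Local Open Scope ring_scope.

Set Implicit Arguments.
Unset Strict Implicit.
Unset Printing Implicit Defensive.

(** Expand everything in the sine basis.  Let [u_k] and [f_k] be the coefficients
    of [u t] and [f t] on [phi k], and let [c_k] be the discrete sine coefficients
    of the grid vector [uh t].  Both families solve scalar fractional equations
    with the same source,

      D^alpha u_k + lambda_k u_k = f_k    and    D^alpha c_k + nu_k c_k = f_k,

    the second one for [k < N], where [nu_k = 4 N^2 sin^2 (k pi / 2 N)] is the
    eigenvalue of the difference matrix for the sampled [phi k]
    ([solution_coef_equation], [scheme_coef_equation]).  The sources agree because
    the projection removes the modes that the grid cannot resolve.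

    Such an equation obeys a maximum principle ([RL_max_principle]): if
    [|g| <= B], the solution of [D^alpha v + lam v = g], [v 0 = 0], satisfies
    [|v| <= B / lam] ([RL_decay_bound]).  Put [F_k = |f_k(0)| + int_0^t |f_k'|],
    which bounds [|f_k|] on (0, t].  Then [|u_k| <= F_k / lambda_k].  The
    difference [u_k - c_k] solves the second equation with the source
    [(nu_k - lambda_k) u_k], and since
    [|nu_k - lambda_k| <= lambda_k nu_k / N^2] ([eigen_gap]), it is at most
    [F_k / N^2].

    The solution is the sum of its sine series at every node ([sine_series_cvg]),
    so the error at the node [x_i] is a series in [phi k x_i] whose coefficient
    in mode [k] is at most [F_k / max(N, k)^2]: consistency error below [N],
    truncation error above.  The regularity of the source enters through
    [source_coef_pairing]: the sum of [a_k lambda_k^(sigma/2) F_k] is at most the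
    Euclidean norm of [a] times the size of the source.

    For the maximum norm, this and the Cauchy-Schwarz inequality leave the sum of
    [max(N, k)^-4 k^(-2 sigma)].  The part [k < N] of it is bounded, logarithmic or
    a power of [N] before the factor [N^-4], according to the position of [sigma]
    with respect to 1/2; hence the two rates and the logarithm at [sigma = 1/2]
    ([power_sum_bound]).

    For the l^2 norm, the truncated modes are grouped into blocks of [N]
    consecutive ones.  On the grid, [phi (l N + r)] is [phi r] up to signs that
    depend on the node only, so each block is controlled by the discrete Parseval
    identity, and block [l] carries the weight [(l N)^-2].  The weights are
    square summable with sum of order [N^-4], whatever [sigma] is
    ([grid_sqnorm_le]).

    The analysis behind these steps is the theory of the sine system on the unit
    interval: Fejer's theorem gives the pointwise convergence of sine series and
    the bound of the L^1 norm by the sine coefficients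
    ([L1_norm_le_sine_coef]).  The latter makes the time derivative of the source
    integrable in space and time, so that sine coefficients commute with
    integrals in time. *)

(** * Integrals of real functions *)

Local Notation mu := lebesgue_measure.
Local Notation plane R := (measurableTypeR R * measurableTypeR R)%type.

Lemma is_derive_continuous (R : realType) (f : R -> R) (x d : R) :
  is_derive x 1 f d -> {for x, continuous f}.
Proof. by move=> fd; apply/differentiable_continuous/derivable1_diffP; case: fd. Qed.

Lemma continuous_within_subset (R : realType) (A : set R) (f : R -> R) :
  (forall x, A x -> {for x, continuous f}) -> {within A, continuous f}.
Proof. by move=> h; apply: continuous_in_subspaceT => x /set_mem; exact: h. Qed.

Lemma within_integrable (R : realType) (a b : R) (f : R -> R) :
  {within `[a, b], continuous f} -> mu.-integrable `[a, b] (EFin \o f).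
Proof. by move=> cf; apply: continuous_compact_integrable cf; exact: segment_compact. Qed.

Lemma LRcontinuous_is_derive (R : realType) (a b : R) (F f : R -> R) : a < b ->
  {within `[a, b], continuous F} ->
  (forall x, a < x < b -> is_derive x 1 F (f x)) ->
  derivable_oo_LRcontinuous F a b /\ {in `]a, b[, derive1 F =1 f}.
Proof.
move=> ab /(continuous_within_itvP _ ab)[_ l r] Ff; split; last first.
  by move=> x; rewrite in_itv => /Ff[_]; rewrite derive1E.
by split=> // x; rewrite in_itv => /Ff[].
Qed.

Lemma Rintegral_FTC2 (R : realType) (a b : R) (F f : R -> R) : a <= b ->
  {within `[a, b], continuous f} -> {within `[a, b], continuous F} ->
  (forall x, a < x < b -> is_derive x 1 F (f x)) ->
  \int[mu]_(x in `[a, b]) f x = F b - F a.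
Proof.
rewrite le_eqVlt => /predU1P[<-|ab] cf cF Ff.
  by rewrite set_itv1 Rintegral_set1 subrr.
have [LF FE] := LRcontinuous_is_derive ab cF Ff.
by rewrite /Rintegral (continuous_FTC2 ab cf LF FE).
Qed.

Lemma Rintegral_parts (R : realType) (a b : R) (F G f g : R -> R) : a <= b ->
  {within `[a, b], continuous f} -> {within `[a, b], continuous F} ->
  {within `[a, b], continuous g} -> {within `[a, b], continuous G} ->
  (forall x, a < x < b -> is_derive x 1 F (f x)) ->
  (forall x, a < x < b -> is_derive x 1 G (g x)) ->
  \int[mu]_(x in `[a, b]) (F x * g x) =
    F b * G b - F a * G a - \int[mu]_(x in `[a, b]) (f x * G x).
Proof.
rewrite le_eqVlt => /predU1P[<-|ab] cf cF cg cG Ff Gg.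
  by rewrite set_itv1 !Rintegral_set1; ring.
have [LF FE] := LRcontinuous_is_derive ab cF Ff.
have [LG GE] := LRcontinuous_is_derive ab cG Gg.
by rewrite (Rintegration_by_parts ab cf LF FE cg LG GE).
Qed.

Lemma Rintegral_oo_cc (R : realType) (a b : R) (f : R -> R) :
  mu.-integrable `[a, b] (EFin \o f) ->
  \int[mu]_(x in `]a, b[) f x = \int[mu]_(x in `[a, b]) f x.
Proof.
move=> fi; rewrite Rintegral_itv_obnd_cbnd; last first.
  by apply: integrableS fi => //; exact: subset_itv_oo_cc.
rewrite Rintegral_itv_bndo_bndc //.
by apply: integrableS fi => //; exact: subset_itv_co_cc.
Qed.

Lemma Rintegral_oc_cc (R : realType) (a b : R) (f : R -> R) :
  mu.-integrable `[a, b] (EFin \o f) ->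
  \int[mu]_(x in `]a, b]) f x = \int[mu]_(x in `[a, b]) f x.
Proof.
move=> fi; rewrite Rintegral_itv_obnd_cbnd //.
by apply: integrableS fi => //; exact: subset_itv_oc_cc.
Qed.

Lemma Rintegral_shift (R : realType) (a b c : R) (g : R -> R) : a <= b ->
  {within `[a - c, b - c], continuous g} ->
  \int[mu]_(x in `[a, b]) g (x - c) = \int[mu]_(x in `[a - c, b - c]) g x.
Proof.
move=> ab cg; rewrite /Rintegral.
have D (x : R) : is_derive x 1 (fun y : R => y - c) 1.
  by apply: is_derive_eq; rewrite subr0.
have DE : derive1 (fun y : R => y - c) = cst 1.
  by apply/funext => x; rewrite derive1E; case: (D x).
rewrite (@integration_by_substitution_increasing R (fun x => x - c) g a b) //.
- by congr fine; apply: eq_integral => x _; rewrite DE /= mulr1.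
- by move=> x y _ _ xy; rewrite ltrD2r.
- by rewrite DE => x _; exact: cvg_cst.
- by rewrite DE; exact: is_cvg_cst.
- by rewrite DE; exact: is_cvg_cst.
- split; first by move=> x _; case: (D x).
  + by apply: cvg_at_right_filter; apply: is_derive_continuous (D a).
  + by apply: cvg_at_left_filter; apply: is_derive_continuous (D b).
Qed.

(** Differentiating an integral needs a base point strictly to the left of the
    points considered, hence the half line. *)
Lemma primitive_exists (R : realType) (v : R -> R) (a : R) : continuous v ->
  exists V : R -> R, forall x, a < x -> is_derive x 1 V (v x).
Proof.
move=> cv; exists (fun x => \int[mu]_(y in `[a, x]) v y) => x ax.
have xx : x < x + 1 by rewrite ltrDl.
have [d e] := @continuous_FTC1_closed R v a x (x + 1) xx (within_integrable
  (@continuous_subspaceT _ _ `[a, x + 1] v cv)) ax (cv x).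
by split; [exact: d|rewrite -derive1E; exact: e].
Qed.

Lemma integrable_scale (R : realType) (D : set (measurableTypeR R)) (c : R) (f : R -> R) :
  measurable D -> mu.-integrable D (EFin \o f) ->
  mu.-integrable D (EFin \o (fun x => c * f x)).
Proof.
by move=> mD fi; apply: (eq_integrable mD) (integrableZl mD c fi) => x _; rewrite /= EFinM.
Qed.

Lemma integrable_add (R : realType) (D : set (measurableTypeR R)) (f g : R -> R) :
  measurable D -> mu.-integrable D (EFin \o f) -> mu.-integrable D (EFin \o g) ->
  mu.-integrable D (EFin \o (fun x => f x + g x)).
Proof.
by move=> mD fi gi; apply: (eq_integrable mD) (integrableD mD fi gi) => x _; rewrite /= EFinD.
Qed.

Lemma integrable_sub (R : realType) (D : set (measurableTypeR R)) (f g : R -> R) :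
  measurable D -> mu.-integrable D (EFin \o f) -> mu.-integrable D (EFin \o g) ->
  mu.-integrable D (EFin \o (fun x => f x - g x)).
Proof.
by move=> mD fi gi; apply: (eq_integrable mD) (integrableB mD fi gi) => x _; rewrite /= EFinB.
Qed.

Lemma integrable_normr (R : realType) (D : set (measurableTypeR R)) (f : R -> R) :
  measurable D -> mu.-integrable D (EFin \o f) ->
  mu.-integrable D (EFin \o (fun x => `|f x|)).
Proof.
by move=> mD fi; apply: (eq_integrable mD) (integrable_abse fi).
Qed.

Lemma segment_bounded (R : realType) (a b : R) (f : R -> R) :
  {within `[a, b], continuous f} -> exists M, forall x, a <= x <= b -> `|f x| <= M.
Proof.
move=> cf; have [ab|ba] := leP a b; last by exists 0 => x /andP[ax xb]; lra.
have cn : {within `[a, b], continuous (fun x => `|f x|)}.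
  by move=> x; apply: continuous_comp; [exact: cf|exact: norm_continuous].
have [c _ cmax] := EVT_max ab cn.
by exists `|f c| => x xab; apply: cmax; rewrite in_itv.
Qed.

Lemma continuous_mul_fun (R : realType) (f g : R -> R) :
  continuous f -> continuous g -> continuous (fun x => f x * g x).
Proof. by move=> cf cg x; apply: cvgM; [exact: cf|exact: cg]. Qed.

Lemma continuous_add_fun (R : realType) (f g : R -> R) :
  continuous f -> continuous g -> continuous (fun x => f x + g x).
Proof. by move=> cf cg x; apply: cvgD; [exact: cf|exact: cg]. Qed.

Lemma continuous_sub_fun (R : realType) (f g : R -> R) :
  continuous f -> continuous g -> continuous (fun x => f x - g x).
Proof. by move=> cf cg x; apply: cvgB; [exact: cf|exact: cg]. Qed.

Lemma continuous_cst_fun (R : realType) (c : R) : continuous (fun _ : R => c).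
Proof. by move=> x; exact: cvg_cst. Qed.

Lemma continuous_cos_arg (R : realType) (f : R -> R) :
  continuous f -> continuous (fun x => cos (f x)).
Proof.
by move=> cf x; apply: (@continuous_comp _ _ _ f cos); [exact: cf|exact: continuous_cos].
Qed.

Lemma continuous_lin (R : realType) (c : R) : continuous (fun y : R => c * y).
Proof. by apply: continuous_mul_fun; [exact: continuous_cst_fun|move=> x; exact: cvg_id]. Qed.

Lemma is_derive_lin (R : realType) (c x : R) : is_derive x 1 (fun y : R => c * y) c.
Proof. by apply: is_derive_eq; rewrite /GRing.scale/=; ring. Qed.

(** * The weakly singular kernel *)

Lemma is_derive_reflected_powR (R : realType) (s d a x : R) : x < s + d ->
  is_derive x 1 (fun y : R => (s - y + d) `^ a) (- a * (s - x + d) `^ (a - 1)).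
Proof.
move=> xsd.
have h : 0 < s - x + d by lra.
have H1 : is_derive x 1 (fun y : R => s - y + d) (-1).
  by apply: is_derive_eq; ring.
have := @is_derive1_comp R (@powR R ^~ a) (fun y : R => s - y + d) x _ _
  (is_derive1_powR a h) H1.
by rewrite mulrN1 mulNr.
Qed.

Lemma continuous_reflected_powR (R : realType) (s d a x : R) : x < s + d ->
  {for x, continuous (fun y : R => (s - y + d) `^ a)}.
Proof. by move=> /(is_derive_reflected_powR a)/is_derive_continuous. Qed.

Lemma Rintegral_regular_kernel (R : realType) (s d alpha : R) :
  0 < s -> 0 < d -> alpha < 1 ->
  \int[mu]_(x in `]0, s[) (s - x + d) `^ (- alpha) =
  ((s + d) `^ (1 - alpha) - d `^ (1 - alpha)) / (1 - alpha).
Proof.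
move=> s0 d0 a1.
have a10 : 1 - alpha != 0 by rewrite gt_eqF// subr_gt0.
have c b : {within `[0, s], continuous (fun y : R => (s - y + d) `^ b)}.
  apply: continuous_within_subset => x; rewrite /= in_itv/= => /andP[_ xs].
  by apply: continuous_reflected_powR; lra.
rewrite Rintegral_oo_cc; last exact: within_integrable.
pose F y := - (1 - alpha)^-1 * (s - y + d) `^ (1 - alpha).
have FD x : x <= s -> is_derive x 1 F ((s - x + d) `^ (- alpha)).
  move=> xs; have xsd : x < s + d by lra.
  have D := is_derive_reflected_powR (1 - alpha) xsd.
  apply: is_derive_eq.
  rewrite /GRing.scale/=.
  have -> : 1 - alpha - 1 = - alpha by lra.
  by field.
transitivity (F s - F 0); last by rewrite /F subr0 subrr add0r; field.
apply: Rintegral_FTC2; [exact: ltW|exact: c| |].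
- apply: continuous_within_subset => x; rewrite /= in_itv/= => /andP[_ xs].
  exact: is_derive_continuous (FD x xs).
- by move=> x /andP[_ xs]; apply: FD; exact: ltW.
Qed.

Definition inv_succ (R : realType) (n : nat) : R := n.+1%:R^-1.

Lemma inv_succ_gt0 (R : realType) n : 0 < inv_succ R n.
Proof. by rewrite /inv_succ invr_gt0. Qed.

Lemma cvg_inv_succ (R : realType) : inv_succ R n @[n --> \oo] --> 0.
Proof. exact: cvg_harmonic. Qed.

Lemma measurable_weak_kernel (R : realType) (s alpha d : R) (A : set R) :
  measurable_fun A (fun x => (s - x + d) `^ (- alpha)).
Proof.
apply: measurable_funTS.
by apply: (measurableT_comp (measurable_powR _)); apply: measurable_funD => //; apply: measurable_funB.
Qed.

Lemma cvg_regular_kernel (R : realType) (s alpha x : R) : x < s ->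
  (s - x + inv_succ R n) `^ (- alpha) @[n --> \oo] --> (s - x) `^ (- alpha).
Proof.
move=> xs.
have h : 0 < s - x by lra.
have c := is_derive_continuous (is_derive1_powR (- alpha) h).
have l : s - x + inv_succ R n @[n --> \oo] --> s - x.
  rewrite -[X in _ --> X]addr0; apply: cvgD; [exact: cvg_cst|exact: cvg_inv_succ].
exact: (cvg_comp _ _ l c).
Qed.

(** The kernel is the increasing limit of its translates by [inv_succ R n], which
    are continuous up to the end point and are integrated exactly; monotone
    convergence transfers the bound. *)
Lemma weak_kernel_integral_le (R : realType) (s alpha : R) :
  0 < s -> 0 < alpha < 1 ->
  (\int[mu]_(x in `]0%R, s[) ((s - x) `^ (- alpha))%:E <=
    (s `^ (1 - alpha) / (1 - alpha))%:E)%E.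
Proof.
move=> s0 /andP[a0 a1].
pose g n x := ((s - x + inv_succ R n) `^ (- alpha))%:E.
have gi n : mu.-integrable `]0, s[ (g n).
  apply: (@integrableS _ _ _ mu `[0, s]) => //.
    exact: subset_itv_oo_cc.
  apply: (within_integrable (f := fun x => (s - x + inv_succ R n) `^ (- alpha))).
  apply: continuous_within_subset => x; rewrite /= in_itv/= => /andP[_ xs].
  by apply: continuous_reflected_powR; have := inv_succ_gt0 R n; lra.
have mg n : measurable_fun `]0, s[ (g n) by case/integrableP: (gi n).
have g0 n x : `]0, s[%classic x -> (0 <= g n x)%E.
  by move=> _; rewrite lee_fin powR_ge0.
have mono (e b1 b2 : R) : 0 <= e -> 0 < b1 -> b1 <= b2 -> b1 `^ e <= b2 `^ e.
  by move=> e0 b10 b12; rewrite ge0_ler_powR// nnegrE; lra.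
have ndg x : `]0, s[%classic x -> nondecreasing_seq (g ^~ x).
  rewrite /= in_itv/= => /andP[x0 xs] m n mn.
  rewrite lee_fin !powRN lef_pV2 ?posrE ?powR_gt0//.
  - apply: mono; [by lra|have := inv_succ_gt0 R n; lra|].
    by rewrite lerD2l /inv_succ lef_pV2 ?posrE// ler_nat.
  - by have := inv_succ_gt0 R m; lra.
  - by have := inv_succ_gt0 R n; lra.
have H := @cvg_monotone_convergence _ _ _ mu _ (measurable_itv `]0, s[) _ mg g0 ndg.
have <- : (\int[mu]_(x in `]0%R, s[) limn (g ^~ x) =
           \int[mu]_(x in `]0%R, s[) ((s - x) `^ (- alpha))%:E)%E.
  apply: eq_integral => x; rewrite inE /= in_itv/= => /andP[x0 xs].
  apply/cvg_lim => //; apply: cvg_EFin; first exact: nearW.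
  exact: cvg_regular_kernel.
have E n : (\int[mu]_(x in `]0%R, s[) g n x)%E =
    (((s + inv_succ R n) `^ (1 - alpha) - inv_succ R n `^ (1 - alpha)) / (1 - alpha))%:E.
  rewrite -Rintegral_regular_kernel//; last exact: inv_succ_gt0.
  rewrite /Rintegral fineK//; exact: integrable_fin_num (gi n).
have U : ((s + inv_succ R n) `^ (1 - alpha) / (1 - alpha))%:E @[n --> \oo]
    --> (s `^ (1 - alpha) / (1 - alpha))%:E.
  apply: cvg_EFin; first exact: nearW.
  apply: cvgMl; have := @cvg_regular_kernel R s (alpha - 1) 0 s0.
  by rewrite opprB subr0.
rewrite -(cvg_lim _ H)// -(cvg_lim _ U)//; apply: lee_lim.
- by apply/cvg_ex; eexists; exact: H.
- by apply/cvg_ex; eexists; exact: U.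
- apply: nearW => n; rewrite E lee_fin ler_pM2r ?invr_gt0 ?subr_gt0//.
  by rewrite lerBlDr lerDl powR_ge0.
Qed.

Lemma weak_kernel_integrable (R : realType) (s alpha : R) : 0 < alpha < 1 ->
  mu.-integrable `]0, s[ (fun x => ((s - x) `^ (- alpha))%:E).
Proof.
move=> a01; have [s0|s0] := leP s 0.
  by rewrite set_itv_ge ?bnd_simp -?leNgt//; exact: integrable_set0.
apply/integrableP; split.
  apply/measurable_EFinP; have := @measurable_weak_kernel R s alpha 0 `]0, s[.
  by apply: eq_measurable_fun => x _; rewrite addr0.
under eq_integral do rewrite gee0_abs ?lee_fin ?powR_ge0//.
exact: le_lt_trans (weak_kernel_integral_le s0 a01) (ltry _).
Qed.

(** The moving average of [v] over windows of length [eps] is largest at [t].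
    After a translation the difference of the two sides is the integral of the
    kernel against the derivative of
    [G x = (V x - V (x - eps)) - (V t - V (t - eps))].  This function is nonpositive
    and vanishes at [t], and the kernel is positive and increasing, so that
    integration by parts leaves two terms of the right sign.  The shift [d] of the
    kernel removes its singularity at [t]. *)
Lemma regular_kernel_shift_le (R : realType) (v V : R -> R) (alpha d eps t : R) :
  0 < alpha -> 0 < d -> 0 < eps -> 0 <= t -> continuous v ->
  (forall x, x <= 0 -> v x = 0) ->
  (forall x, - eps <= x -> is_derive x 1 V (v x)) ->
  (forall x, 0 <= x <= t -> V x - V (x - eps) <= V t - V (t - eps)) ->
  \int[mu]_(x in `]0, t - eps]) ((t - eps - x + d) `^ (- alpha) * v x) <=
  \int[mu]_(x in `]0, t]) ((t - x + d) `^ (- alpha) * v x).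
Proof.
move=> a0 d0 e0 t0 cv v0 VD Vmax.
have ck b r x : x <= r -> {for x, continuous (fun y : R => (r - y + d) `^ b)}.
  by move=> xr; apply: continuous_reflected_powR; lra.
have cve : continuous (fun x => v (x - eps)).
  move=> x; apply: (@continuous_comp _ _ _ (fun y : R => y - eps) v); last exact: cv.
  by apply: continuousB; [exact: cvg_id|exact: cvg_cst].
pose g x := (t - eps - x + d) `^ (- alpha) * v x.
have cg : {within `[0 - eps, t - eps], continuous g}.
  apply: continuous_within_subset => x; rewrite /= in_itv/= => /andP[_ xt].
  by apply: continuousM; [exact: ck|exact: cv].
have -> : \int[mu]_(x in `]0, t - eps]) ((t - eps - x + d) `^ (- alpha) * v x) =
    \int[mu]_(x in `[0, t]) ((t - x + d) `^ (- alpha) * v (x - eps)).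
  transitivity (\int[mu]_(x in `[0 - eps, t - eps]) g x).
    rewrite Rintegral_mkcond [RHS]Rintegral_mkcond; apply: eq_Rintegral => x _.
    rewrite !patchE !mem_setE !in_itv/=.
    case: (ltP 0 x) => x0 /=; first by case: (x <= t - eps); rewrite ?andbT ?andbF //; case: ltP => //; lra.
    by rewrite /g v0// mulr0 if_same.
  rewrite -(Rintegral_shift t0 cg); apply: eq_Rintegral => x _.
  by rewrite /g; congr (_ `^ _ * _); ring.
have c1 (w : R -> R) : continuous w ->
    {within `[0, t], continuous (fun x => (t - x + d) `^ (- alpha) * w x)}.
  move=> cw; apply: continuous_within_subset => x; rewrite /= in_itv/= => /andP[_ xt].
  by apply: continuousM; [exact: ck|exact: cw].
rewrite Rintegral_oc_cc; last exact/within_integrable/c1.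
rewrite -subr_ge0 -RintegralB //; [|exact/within_integrable/c1..].
pose F x := (t - x + d) `^ (- alpha).
pose f x := alpha * (t - x + d) `^ (- alpha - 1).
pose G x := (V x - V (x - eps)) - (V t - V (t - eps)).
have GD x : 0 <= x <= t -> is_derive x 1 G (v x - v (x - eps)).
  move=> /andP[x0 xt].
  have D1 : is_derive x 1 V (v x) by apply: VD; lra.
  have D2 : is_derive (x - eps) 1 V (v (x - eps)) by apply: VD; lra.
  have D3 : is_derive x 1 (fun y : R => y - eps) 1.
    by apply: is_derive_eq; rewrite subr0.
  have D4 := @is_derive1_comp R V (fun y => y - eps) x _ _ D2 D3.
  by apply: is_derive_eq; rewrite subr0 mulr1.
have FD x : x <= t -> is_derive x 1 F (f x).
  move=> xt; have xtd : x < t + d by lra.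
  by have := is_derive_reflected_powR (- alpha) xtd; rewrite opprK.
have -> : \int[mu]_(x in `[0, t])
    ((t - x + d) `^ (- alpha) * v x - (t - x + d) `^ (- alpha) * v (x - eps)) =
    \int[mu]_(x in `[0, t]) (F x * (v x - v (x - eps))).
  by apply: eq_Rintegral => x _; rewrite mulrBr.
have -> : \int[mu]_(x in `[0, t]) (F x * (v x - v (x - eps))) =
    F t * G t - F 0 * G 0 - \int[mu]_(x in `[0, t]) (f x * G x).
  apply: Rintegral_parts => //.
  - apply: continuous_within_subset => x; rewrite /= in_itv/= => /andP[_ xt].
    by apply: continuousM; [exact: cvg_cst|exact: ck].
  - apply: continuous_within_subset => x; rewrite /= in_itv/= => /andP[_ xt].
    exact: ck.
  - apply: continuous_within_subset => x _.
    by apply: continuousB; [exact: cv|exact: cve].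
  - apply: continuous_within_subset => x; rewrite /= in_itv/= => xt.
    exact: is_derive_continuous (GD x xt).
  - by move=> x /andP[_ /ltW]; exact: FD.
  - by move=> x /andP[x0 xt]; apply: GD; rewrite !ltW.
have G0 x : 0 <= x <= t -> G x <= 0 by move=> xt; rewrite /G subr_le0 Vmax.
have -> : F t * G t = 0 by rewrite /G subrr mulr0.
rewrite sub0r -mulrN; apply: addr_ge0.
  by rewrite mulr_ge0 ?powR_ge0// oppr_ge0 G0// lexx.
rewrite oppr_ge0 -oppr_ge0 -[X in 0 <= X]mulN1r -RintegralZl//; last first.
  apply: within_integrable; apply: continuous_within_subset => x.
  rewrite /= in_itv/= => xt; apply: continuousM; last exact: is_derive_continuous (GD x xt).
  by apply: continuousM; [exact: cvg_cst|apply: ck; lra].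
apply: Rintegral_ge0 => x; rewrite /= in_itv/= => xt.
rewrite mulN1r -mulrN mulr_ge0 ?oppr_ge0 ?G0// mulr_ge0 ?powR_ge0//; exact: ltW.
Qed.

Lemma fine_cvg_Rintegral (R : realType) (D : set R) (f : nat -> R -> R) (g : R -> R) :
  (\int[mu]_(x in D) (f n x)%:E @[n --> \oo] --> \int[mu]_(x in D) (g x)%:E)%E ->
  (\int[mu]_(x in D) (g x)%:E \is a fin_num)%E ->
  \int[mu]_(x in D) f n x @[n --> \oo] --> \int[mu]_(x in D) g x.
Proof. by move=> c fn; apply: fine_cvg; rewrite /Rintegral fineK. Qed.

Lemma weak_kernel_mul_integrable (R : realType) (s alpha M : R) (v : R -> R) :
  0 < alpha < 1 -> measurable_fun `]0, s[ v ->
  (forall x, `]0, s[%classic x -> `|v x| <= M) ->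
  mu.-integrable `]0, s[ (EFin \o (fun x => (s - x) `^ (- alpha) * v x)).
Proof.
move=> a01 mv vM.
have ki := weak_kernel_integrable s a01.
have kM := @integrableZl _ _ _ mu `]0, s[ (measurable_itv _) M _ ki.
apply: le_integrable kM => //.
  apply/measurable_EFinP; apply: measurable_funM => //.
  by apply/measurable_EFinP; case/integrableP: ki.
move=> x sx; rewrite -EFinM !abse_EFin lee_fin !normrM [X in _ <= X]mulrC.
rewrite ler_wpM2l//; apply: le_trans (vM x sx) (ler_norm _).
Qed.

Lemma cvg_regular_RLint (R : realType) (s alpha M : R) (v : R -> R) :
  0 < alpha < 1 -> measurable_fun `]0, s[ v ->
  (forall x, `]0, s[%classic x -> `|v x| <= M) ->
  \int[mu]_(x in `]0, s[) ((s - x + inv_succ R n) `^ (- alpha) * v x) @[n --> \oo]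
  --> \int[mu]_(x in `]0, s[) ((s - x) `^ (- alpha) * v x).
Proof.
move=> a01 mv vM; have ki := weak_kernel_integrable s a01.
have kM := @integrableZl _ _ _ mu `]0, s[ (measurable_itv _) M _ ki.
have vi := weak_kernel_mul_integrable a01 mv vM.
apply: fine_cvg_Rintegral; last exact: integrable_fin_num vi.
apply: (@dominated_cvg _ _ _ mu `]0, s[ (measurable_itv _)
  (fun n x => ((s - x + inv_succ R n) `^ (- alpha) * v x)%:E) _
  (fun x => M%:E * ((s - x) `^ (- alpha))%:E)%E) => //.
- move=> n; apply/measurable_EFinP; apply: measurable_funM => //.
  exact: measurable_weak_kernel.
- move=> x; rewrite /= in_itv/= => /andP[x0 xs].
  apply: cvg_EFin; first exact: nearW.
  by apply: cvgM; [exact: cvg_regular_kernel|exact: cvg_cst].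
- move=> n x sx; rewrite -EFinM abse_EFin lee_fin normrM mulrC.
  move: (sx); rewrite /= in_itv/= => /andP[x0 xs].
  have d0 := inv_succ_gt0 R n.
  apply: ler_pM => //; first exact: vM.
  rewrite ger0_norm ?powR_ge0// !powRN lef_pV2 ?posrE ?powR_gt0//; [|lra..].
  by case/andP: a01 => a0 a1; rewrite ge0_ler_powR ?nnegrE//; lra.
Qed.

(** * The Riemann-Liouville integral *)

Lemma heine (R : realType) (f : R -> R) (A : set R) (e : R) :
  compact A -> continuous f -> 0 < e ->
  exists2 d, 0 < d & forall x y, A x -> `|x - y| < d -> `|f x - f y| < e.
Proof.
move=> /compact_near_coveringP cA cf e0.
have H := cA R (0^'+ : set_system R) (fun d x => forall y, `|x - y| < d -> `|f x - f y| < e) _.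
have {H} /H : forall x, A x -> \forall x' \near x & d \near (0:R)^'+, forall y, `|x' - y| < d -> `|f x' - f y| < e.
  move=> x Ax; have /cvgrPdist_lt/(_ (e / 2))/(_ (divr_gt0 e0 (ltr0Sn _ 1))) := cf x.
  move=> /nbhs_ballP[r /= r0 rf].
  have r2 : 0 < r / 2 by rewrite divr_gt0.
  exists (ball x (r / 2), [set d | d < r / 2]).
    split=> /=; first exact: nbhsx_ballx.
    exact: nbhs_right_lt.
  move=> [x' d] /= [xx' dr] y x'y.
  rewrite (splitr e) (le_lt_trans (ler_distD (f x) _ _))// ltrD//.
    rewrite distrC; apply: rf; apply: le_ball xx'.
    by rewrite ler_pdivrMr// ler_pMr// ler1n.
  apply: rf; rewrite /ball/= (splitr r) (le_lt_trans (ler_distD x' _ _))// ltrD//.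
  exact: lt_trans dr.
move=> H.
have [d [/= d0 dA]] : exists d, 0 < d /\ A `<=` (fun x => forall y, `|x - y| < d -> `|f x - f y| < e).
  near (0:R)^'+ => d; exists d; split; first by near: d; exact: nbhs_right_gt.
  by near: d; exact: H.
by exists d => // x y Ax; exact: dA.
Unshelve. all: by end_near. Qed.

Lemma is_derive_of_quotient (R : realType) (f : R -> R) (x d : R) :
  (f s - f x) / (s - x) @[s --> x^'] --> d -> is_derive x 1 f d.
Proof.
move=> h.
have H : h^-1 *: (f (h *: (1:R) + x) - f x) @[h --> (0:R)^'] --> d.
  apply/cvgrPdist_lt => e e0; move/cvgrPdist_lt: h => /(_ e e0).
  rewrite !near_withinE => /nbhs_ballP[r /= r0 rP]; apply/nbhs_ballP; exists r => //= y.
  rewrite /ball/= sub0r normrN => yr y0.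
  have := rP (y *: 1 + x); rewrite /ball/= scaler1 opprD addrCA subrr addr0 normrN => /(_ yr).
  rewrite addrK mulrC; apply.
  by rewrite -subr_eq0 addrK.
split; first by apply/cvg_ex; exists d.
exact: (cvg_lim _ H).
Qed.

Lemma RL_integral_le0 (R : realType) (alpha : R) (v : R -> R) (s : R) : s <= 0 ->
  RL_integral alpha v s = 0.
Proof.
move=> s0; rewrite /RL_integral set_itv_ge ?Rintegral_set0 ?mulr0//.
by rewrite bnd_simp -leNgt.
Qed.

Lemma eq_RL_integral (R : realType) (alpha : R) (v w : R -> R) (s : R) :
  (forall x, 0 < x < s -> v x = w x) -> RL_integral alpha v s = RL_integral alpha w s.
Proof.
move=> vw; rewrite /RL_integral; congr (_ * _); apply: eq_Rintegral => x.
by rewrite inE /= in_itv/= => /vw ->.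
Qed.

Lemma Gamma_ge0 (R : realType) (a : R) : 0 <= Gamma a.
Proof.
by apply: Rintegral_ge0 => x _; rewrite mulr_ge0 ?powR_ge0// expR_ge0.
Qed.

(** Dominated convergence in [regular_kernel_shift_le] as the shift of the kernel
    tends to zero. *)
Lemma RL_integral_shift_le (R : realType) (v V : R -> R) (alpha eps t : R) :
  0 < alpha < 1 -> 0 < eps -> 0 <= t -> continuous v ->
  (forall x, x <= 0 -> v x = 0) ->
  (forall x, - eps <= x -> is_derive x 1 V (v x)) ->
  (forall x, 0 <= x <= t -> V x - V (x - eps) <= V t - V (t - eps)) ->
  RL_integral alpha v (t - eps) <= RL_integral alpha v t.
Proof.
move=> a01 e0 t0 cv v0 VD Vmax.
have [a0 _] := andP a01.
apply: ler_wpM2l; first by rewrite invr_ge0 Gamma_ge0.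
have cA (s : R) : {within `[0, s], continuous v} by exact: continuous_subspaceT.
have bd (s : R) : exists M : R, forall x : R, `]0, s[%classic x -> `|v x| <= M.
  have [M vM] := segment_bounded (cA s); exists M => x.
  by rewrite /= in_itv/= => /andP[x0 xs]; apply: vM; rewrite !ltW.
have mv (s : R) : measurable_fun `]0, s[ v.
  by apply: measurable_funTS; exact: continuous_measurable_fun.
have [M1 b1] := bd (t - eps); have [M2 b2] := bd t.
have l1 := cvg_regular_RLint a01 (mv _) b1.
have l2 := cvg_regular_RLint a01 (mv _) b2.
apply: ler_cvg_to l1 l2 _; apply: nearW => n.
have d0 := inv_succ_gt0 R n.
have oo_oc (s : R) : \int[mu]_(x in `]0, s[) ((s - x + inv_succ R n) `^ (- alpha) * v x) =
    \int[mu]_(x in `]0, s]) ((s - x + inv_succ R n) `^ (- alpha) * v x).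
  rewrite Rintegral_itv_bndo_bndc//; apply: (@integrableS _ _ _ mu `[0, s]) => //.
    exact: subset_itv_oo_cc.
  apply: within_integrable; apply: continuous_within_subset => x.
  rewrite /= in_itv/= => /andP[_ xs].
  by apply: continuousM; [apply: continuous_reflected_powR; lra|exact: cv].
rewrite !oo_oc; exact: regular_kernel_shift_le Vmax.
Qed.

Lemma RL_integral_norm_le (R : realType) (alpha M s : R) (v : R -> R) :
  0 < alpha < 1 -> 0 <= s -> measurable_fun `]0, s[ v ->
  (forall x, `]0, s[%classic x -> `|v x| <= M) ->
  `|RL_integral alpha v s| <= (Gamma (1 - alpha))^-1 * (M * (s `^ (1 - alpha) / (1 - alpha))).
Proof.
move=> a01; rewrite le_eqVlt => /predU1P[<-|s0] mv vM.
  rewrite RL_integral_le0// normr0.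
  have /andP[a0 a1] := a01.
  by rewrite powR0 ?mul0r ?mulr0// gt_eqF// subr_gt0.
rewrite /RL_integral normrM ger0_norm ?invr_ge0 ?Gamma_ge0//.
rewrite ler_wpM2l ?invr_ge0 ?Gamma_ge0//.
have vi := weak_kernel_mul_integrable a01 mv vM.
have ki := weak_kernel_integrable s a01.
apply: le_trans (le_normr_Rintegral _ vi) _ => //.
have M0 : 0 <= M.
  by apply: le_trans (vM (s / 2) _); rewrite ?normr_ge0//= in_itv/=; lra.
have ki' : mu.-integrable `]0, s[ (EFin \o (fun x => (s - x) `^ (- alpha))) by exact: ki.
apply: (@le_trans _ _ (\int[mu]_(x in `]0, s[) (M * (s - x) `^ (- alpha)))).
  apply: le_Rintegral => //.
  - exact: integrable_norm vi.
  - exact: (@integrableZl _ _ _ mu `]0, s[ (measurable_itv _) M _ ki).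
  - move=> x sx; rewrite /= normrM (ger0_norm (powR_ge0 _ _)) mulrC.
    by rewrite ler_wpM2r ?powR_ge0// vM.
rewrite RintegralZl// ler_wpM2l// -lee_fin /Rintegral fineK.
  exact: weak_kernel_integral_le.
exact: integrable_fin_num ki.
Qed.

(** * The maximum principle for the Riemann-Liouville derivative *)

Lemma near_left_within (R : realType) (T t : R) (P : R -> Prop) : 0 < t <= T ->
  (\forall s \near within `[0, T] t^', P s) -> \forall s \near t^'-, P s.
Proof.
move=> /andP[t0 tT] h.
have {}h : nbhs t (fun s => s != t -> `[0, T]%classic s -> P s) by exact: h.
suff : nbhs t (fun s => s < t -> P s) by [].
move: (lt_nbhsr t0) h; apply: filterS2 => s s0 hs st.
apply: hs; first by rewrite lt_eqF.
by rewrite /= in_itv/= ltW//= (le_trans (ltW st) tT).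
Qed.

Lemma near_within_interior (R : realType) (T t : R) (P : R -> Prop) : 0 < t < T ->
  (\forall s \near within `[0, T] t^', P s) -> \forall s \near t^', P s.
Proof.
move=> /andP[t0 tT] h.
have {}h : nbhs t (fun s => s != t -> `[0, T]%classic s -> P s) by exact: h.
suff : nbhs t (fun s => s != t -> P s) by [].
move: (lt_nbhsr t0) (lt_nbhsl tT) h; apply: filterS3.
move=> s s0 sT hs st; apply: hs => //.
by rewrite /= in_itv/= !ltW.
Qed.

Lemma RL_deriv_is_derive (R : realType) (T alpha t d : R) (v : R -> R) :
  0 < t < T -> RL_deriv_at T alpha v t d -> is_derive t 1 (RL_integral alpha v) d.
Proof.
move=> tT h; apply: is_derive_of_quotient => A /h.
by move=> /(near_within_interior tT).
Qed.

Lemma RL_deriv_cvg_left (R : realType) (T alpha t d : R) (v : R -> R) :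
  0 < t <= T -> RL_deriv_at T alpha v t d ->
  RL_integral alpha v s @[s --> t^'-] --> RL_integral alpha v t.
Proof.
move=> tT h; set J := RL_integral alpha v.
have q : (J s - J t) / (s - t) @[s --> t^'-] --> d.
  by move=> A /h /(near_left_within tT).
have st : s - t @[s --> t^'-] --> t - t.
  by apply: cvg_at_left_filter; apply: cvgB; [exact: cvg_id|exact: cvg_cst].
have c : (J s - J t) / (s - t) * (s - t) + J t @[s --> t^'-] --> J t.
  rewrite -[X in _ --> X]add0r -(mulr0 d) -(subrr t).
  by apply: cvgD; [exact: cvgM q st|exact: cvg_cst].
suff e : {near t^'-, (fun s => (J s - J t) / (s - t) * (s - t) + J t) =1 J}.
  exact: (cvg_trans (near_eq_cvg e) c).
near=> s; rewrite mulfVK ?subrK// subr_eq0 lt_eqF//.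
Unshelve. all: by end_near. Qed.

(** Composition with this retraction onto [0, T] turns continuity within the
    interval into continuity on the line. *)
Definition clamp (R : realType) (T s : R) : R := Num.min (Num.max s 0) T.

Lemma clamp_in (R : realType) (T s : R) : 0 <= T -> `[0, T]%classic (clamp T s).
Proof.
by move=> T0; rewrite /= in_itv/= /clamp le_min le_max lexx orbT T0 ge_min lexx orbT.
Qed.

Lemma clamp_id (R : realType) (T s : R) : 0 <= s <= T -> clamp T s = s.
Proof. by move=> /andP[s0 sT]; rewrite /clamp max_l// min_l. Qed.

Lemma clamp_neg (R : realType) (T s : R) : 0 <= T -> s <= 0 -> clamp T s = 0.
Proof. by move=> T0 s0; rewrite /clamp max_r// min_l. Qed.

Lemma continuous_clamp (R : realType) (T : R) (v : R -> R) : 0 <= T ->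
  {within `[0, T], continuous v} -> continuous (fun s => v (clamp T s)).
Proof.
move=> T0 /subspace_continuousP cv s.
have cc : clamp T x @[x --> s] --> clamp T s.
  apply: (@continuous_min _ _ (fun x : R => Num.max x 0) (fun _ => T)).
    apply: (@continuous_max _ _ (fun x : R => x) (fun _ => 0)); [exact: cvg_id|exact: cvg_cst].
  exact: cvg_cst.
move=> A /(cv _ (clamp_in s T0)); rewrite /within/= => /cc.
rewrite !nbhs_simpl/=; apply: filterS => x; apply; exact: clamp_in.
Qed.

(** Suppose that [G < v t1].  The averages of [v], continued by 0 to the left, over
    windows of a short length [eps] attain their maximum over [0, t1] at some [t].
    By uniform continuity [v] exceeds [G] on the whole window ending at [t], where
    the derivative [d] is therefore negative, and by the mean value theorem the
    fractional integral decreases strictly across this window.  That contradicts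
    [RL_integral_shift_le].  The averages are used since [v] itself need not be
    differentiable. *)
Theorem RL_max_principle (R : realType) (T alpha t1 G : R) (v d : R -> R) :
  0 < alpha < 1 -> 0 < t1 <= T -> 0 <= G ->
  {within `[0, T], continuous v} -> v 0 = 0 ->
  (forall t, 0 < t <= t1 -> RL_deriv_at T alpha v t (d t)) ->
  (forall t, 0 < t <= t1 -> G < v t -> d t < 0) ->
  v t1 <= G.
Proof.
move=> a01 /andP[t10 t1T] G0 cv v0 vd vsign.
have T0 : 0 < T by exact: lt_le_trans t1T.
rewrite leNgt; apply/negP => Gv.
pose w s := v (clamp T s).
have cw : continuous w by apply: continuous_clamp => //; exact: ltW.
have wid s : 0 <= s <= T -> w s = v s by move=> h; rewrite /w clamp_id.
have w0 s : s <= 0 -> w s = 0 by move=> h; rewrite /w clamp_neg// ltW.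
have JE s : s <= T -> RL_integral alpha w s = RL_integral alpha v s.
  by move=> sT; apply: eq_RL_integral => x /andP[x0 xs]; rewrite wid//; lra.
pose e := (v t1 - G) / 2.
have e0 : 0 < e by rewrite divr_gt0// subr_gt0.
have [dl dl0 wdl] := heine (@segment_compact _ (-1 - 1) t1) cw e0.
have [eps [eps0 epsdl eps1]] : exists eps : R, [/\ 0 < eps, eps < dl & eps < 1].
  by case: (ltP dl 1) => h; [exists (dl / 2)|exists (1 / 2)]; split; lra.
have [V VD] := primitive_exists (- 1 - 1) cw.
have VD' z : - eps <= z -> is_derive z 1 V (w z) by move=> ze; apply: VD; lra.
have win t : -1 <= t -> exists2 x, t - eps < x < t & V t - V (t - eps) = eps * w x.
  move=> t1'; have tt : t - eps < t by lra.
  have [||x] := @MVT R V w (t - eps) t tt.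
  - by move=> x; rewrite in_itv/= => /andP[x0 _]; apply: VD; lra.
  - apply: continuous_within_subset => x; rewrite /= in_itv/= => /andP[x0 _].
    have h : -1 - 1 < x by lra.
    exact: is_derive_continuous (VD x h).
  - by rewrite in_itv/= => xt ->; exists x => //; ring.
have cW : {within `[0, t1], continuous (fun x => V x - V (x - eps))}.
  apply: continuous_within_subset => x; rewrite /= in_itv/= => /andP[x0 _].
  have h1 : -1 - 1 < x by lra.
  have h2 : -1 - 1 < x - eps by lra.
  apply: continuousB; first exact: is_derive_continuous (VD x h1).
  apply: (@continuous_comp _ _ _ (fun y : R => y - eps) V); last exact: is_derive_continuous (VD _ h2).
  by apply: continuousB; [exact: cvg_id|exact: cvg_cst].
have [t] := EVT_max (ltW t10) cW.
rewrite in_itv/= => /andP[t0 tt1] tmax.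
have [x xt Wx] : exists2 x, t - eps < x < t & V t - V (t - eps) = eps * w x by apply: win; lra.
(* The average over the window at [t] is at least the one over the window at
   [t1], where [w] is within [e] of [v t1 = G + 2 * e]. *)
have wx : G + e < w x.
  have [y yt Wy] : exists2 y, t1 - eps < y < t1 & V t1 - V (t1 - eps) = eps * w y by apply: win; lra.
  have : V t1 - V (t1 - eps) <= V t - V (t - eps) by apply: tmax; rewrite in_itv/= lexx ltW.
  rewrite Wx Wy ler_pM2l// => /(lt_le_trans _); apply.
  have : `|w t1 - w y| < e.
    apply: wdl; first by rewrite /= in_itv/=; lra.
    by rewrite ger0_norm; lra.
  rewrite (wid t1); last lra.
  by rewrite ltr_norml /e => /andP[_]; lra.
have x0 : 0 < x.
  by rewrite ltNge; apply/negP => /w0 wx0; move: wx; rewrite wx0; lra.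
have {}t0 : 0 < t by lra.
(* A window that reaches below 0 is cut at 0: the fractional integral vanishes at
   both of its possible left ends. *)
have [a [a0 aeps at_ ax aE]] : exists a, [/\ 0 <= a, t - eps <= a, a < t, a < x &
    a = t - eps \/ a = 0 /\ t - eps <= 0].
  case: (leP 0 (t - eps)) => h.
    by exists (t - eps); split; [exact: h|exact: lexx|lra|lra|left].
  by exists 0; split; [exact: lexx|exact: ltW|exact: t0|exact: x0|right; split=> //; exact: ltW].
have vd' y : a < y < t -> is_derive y 1 (RL_integral alpha v) (d y).
  move=> yt; apply: (@RL_deriv_is_derive _ T); first lra.
  by apply: vd; lra.
have dneg y : a < y < t -> d y < 0.
  move=> /andP[ay yt].
  apply: vsign; first lra.
  have : `|w x - w y| < e.
    apply: wdl; first by rewrite /= in_itv/=; lra.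
    by rewrite ltr_norml; apply/andP; split; lra.
  rewrite (wid y); last lra.
  by rewrite ltr_norml => /andP[_]; lra.
have cJ : {within `[a, t], continuous (RL_integral alpha v)}.
  apply/(continuous_within_itvP _ at_); split.
  - by move=> y; rewrite in_itv/= => yt; apply: is_derive_continuous (vd' y yt).
  - have := a0; rewrite le_eqVlt => /predU1P[a00|a00].
      rewrite -a00 (RL_integral_le0 _ _ (lexx 0)).
      have [M wM] : exists M : R, forall x, 0 <= x <= T -> `|w x| <= M.
        by apply: segment_bounded; exact: continuous_subspaceT.
      apply/norm_cvg0P.
      apply: (@squeeze_cvgr _ _ _ _ (fun=> 0)
        (fun s => (Gamma (1 - alpha))^-1 * (M * (s `^ (1 - alpha) / (1 - alpha))))).
      - near=> s; rewrite normr_ge0/=.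
        have sT : s <= T by near: s; exact: nbhs_right_le.
        have s0 : 0 < s by near: s; exact: nbhs_right_gt.
        rewrite -(JE _ sT); apply: RL_integral_norm_le; [exact: a01|exact: ltW| |].
          by apply: measurable_funTS; exact: continuous_measurable_fun.
        by move=> y; rewrite /= in_itv/= => /andP[y0 ys]; apply: wM; lra.
      - exact: cvg_cst.
      - have h := @powR_cvg0 R (1 - alpha).
        have a1 : 0 < 1 - alpha by case/andP: a01; lra.
        rewrite -[X in _ --> X](mulr0 (Gamma (1 - alpha))^-1); apply: cvgM; first exact: cvg_cst.
        rewrite -[X in _ --> X](mulr0 M); apply: cvgM; first exact: cvg_cst.
        rewrite -[X in _ --> X](mul0r (1 - alpha)^-1); apply: cvgM; last exact: cvg_cst.
        exact: h a1.
    apply: cvg_at_right_filter.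
    have D : is_derive a 1 (RL_integral alpha v) (d a).
      by apply: (@RL_deriv_is_derive _ T); [lra|apply: vd; lra].
    exact: is_derive_continuous D.
  - by apply: (@RL_deriv_cvg_left _ T _ _ (d t)); [lra|apply: vd; lra].
have vd2 y : y \in `]a, t[ -> is_derive y 1 (RL_integral alpha v) (d y).
  by rewrite in_itv; exact: vd'.
have [y] := MVT at_ vd2 cJ.
rewrite in_itv/= => /andP[ay yt] /esym/eqP E.
have tT : t <= T by exact: le_trans t1T.
have aT : a <= T by exact: le_trans (ltW at_) tT.
have mono : RL_integral alpha w (t - eps) <= RL_integral alpha w t.
  apply: RL_integral_shift_le VD' _; [exact: a01|exact: eps0|exact: ltW|exact: cw|exact: w0|].
  by move=> z /andP[z0 zt]; apply: tmax; rewrite in_itv/= z0; exact: le_trans tt1.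
have {}aE : RL_integral alpha w a = RL_integral alpha w (t - eps).
  by case: aE => [->//|[-> h]]; rewrite (RL_integral_le0 _ _ h) RL_integral_le0.
have dy : 0 <= d y.
  have : 0 <= d y * (t - a).
    by rewrite (eqP E) subr_ge0 -(JE _ aT) -(JE _ tT) aE.
  by rewrite pmulr_lge0 ?subr_gt0.
by have := dneg y; rewrite ay yt ltNge dy => /(_ isT).
Unshelve. all: by end_near. Qed.

Lemma continuous_kernel_integrable (R : realType) (T alpha s : R) (v : R -> R) :
  0 < alpha < 1 -> 0 < s <= T -> {within `[0, T], continuous v} ->
  mu.-integrable `]0, s[ (EFin \o (fun x => (s - x) `^ (- alpha) * v x)).
Proof.
move=> a01 /andP[s0 sT] cv; have T0 : 0 <= T := ltW (lt_le_trans s0 sT).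
have cvc := continuous_clamp T0 cv.
have [M vM] := segment_bounded cv.
have inT x : `]0, s[%classic x -> 0 <= x <= T.
  by rewrite /= in_itv/= => /andP[/ltW -> xs] /=; exact: le_trans (ltW xs) sT.
apply: (weak_kernel_mul_integrable (M := M)) => //.
- have := @measurable_funTS _ _ _ _ `]0, s[%classic _
    (continuous_measurable_fun cvc).
  by apply: eq_measurable_fun => x; rewrite inE => /inT /clamp_id ->.
- by move=> x /inT; exact: vM.
Qed.

Lemma RL_integral_lin (R : realType) (T alpha c s : R) (v w : R -> R) :
  0 < alpha < 1 -> s <= T ->
  {within `[0, T], continuous v} -> {within `[0, T], continuous w} ->
  RL_integral alpha (fun x => v x + c * w x) s =
  RL_integral alpha v s + c * RL_integral alpha w s.
Proof.
move=> a01 sT cv cw; have [s0|s0] := leP s 0.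
  by rewrite !RL_integral_le0// mulr0 addr0.
have s0T : 0 < s <= T by rewrite s0.
have iv := continuous_kernel_integrable a01 s0T cv.
have iw := continuous_kernel_integrable a01 s0T cw.
rewrite /RL_integral mulrCA -mulrDr; congr (_ * _).
have mI : measurable (`]0, s[%classic : set (measurableTypeR R)) by exact: measurable_itv.
rewrite -(RintegralZl c mI iw) -RintegralD//; last exact: integrable_scale.
by apply: eq_Rintegral => x _; ring.
Qed.

Lemma RL_deriv_lin (R : realType) (T alpha c t d e : R) (v w : R -> R) :
  0 < alpha < 1 -> 0 < t <= T ->
  {within `[0, T], continuous v} -> {within `[0, T], continuous w} ->
  RL_deriv_at T alpha v t d -> RL_deriv_at T alpha w t e ->
  RL_deriv_at T alpha (fun x => v x + c * w x) t (d + c * e).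
Proof.
move=> a01 /andP[t0 tT] cv cw hv hw; rewrite /RL_deriv_at.
have H := cvgD hv (cvgM (cvg_cst c) hw).
have : \forall s \near within `[0, T] t^', `[0, T]%classic s by exact: (@withinT _ t^' `[0, T]%classic).
have F : Filter (within `[0, T] t^') by apply: within_filter.
move=> near_T; apply: cvg_trans (H F F F); apply: near_eq_cvg; move: near_T; apply: filterS => s.
rewrite /= in_itv/= => /andP[_ sT]; rewrite fctE /= !(RL_integral_lin (T := T))//.
move: (RL_integral _ _ _) (RL_integral _ _ _) (RL_integral _ _ _) (RL_integral _ _ _) ((s - t)^-1).
by move=> a b c' d' r; ring.
Qed.

Lemma continuous_within_lin (R : realType) (T c : R) (v w : R -> R) :
  {within `[0, T], continuous v} -> {within `[0, T], continuous w} ->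
  {within `[0, T], continuous (fun x => v x + c * w x)}.
Proof.
by move=> cv cw x; apply: cvgD; [exact: cv|apply: cvgM; [exact: cvg_cst|exact: cw]].
Qed.

Lemma RL_deriv_zero (R : realType) (T alpha t : R) :
  RL_deriv_at T alpha (fun=> 0) t 0.
Proof.
rewrite /RL_deriv_at.
have e s : RL_integral alpha (fun=> 0) s = 0 :> R.
  rewrite /RL_integral; set I := (X in _ * X).
  have -> : I = \int[mu]_(x in `]0, s[) (fun=> 0) x.
    by apply: eq_Rintegral => x _; rewrite mulr0.
  by rewrite (Rintegral_cst mu (measurable_itv `]0, s[)) mul0r mulr0.
by under eq_fun do rewrite !e subrr mul0r; exact: cvg_cst.
Qed.

Lemma continuous_within_sum (R : realType) (T : R) (I : Type) (r : seq I)
    (c : I -> R) (v : I -> R -> R) :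
  (forall i, {within `[0, T], continuous (v i)}) ->
  {within `[0, T], continuous (fun x => \sum_(i <- r) c i * v i x)}.
Proof.
move=> cv; elim: r => [|i r cS].
  have -> : (fun x => \sum_(i <- [::]) c i * v i x) = fun=> 0.
    by apply/funext => x; rewrite big_nil.
  by move=> x; exact: cvg_cst.
have -> : (fun x => \sum_(j <- i :: r) c j * v j x) =
    fun x => \sum_(j <- r) c j * v j x + c i * v i x.
  by apply/funext => x; rewrite big_cons addrC.
exact: continuous_within_lin.
Qed.

Lemma RL_deriv_sum (R : realType) (T alpha t : R) (I : Type) (r : seq I)
    (c : I -> R) (v : I -> R -> R) (d : I -> R) :
  0 < alpha < 1 -> 0 < t <= T ->
  (forall i, {within `[0, T], continuous (v i)}) ->
  (forall i, RL_deriv_at T alpha (v i) t (d i)) ->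
  RL_deriv_at T alpha (fun x => \sum_(i <- r) c i * v i x) t (\sum_(i <- r) c i * d i).
Proof.
move=> a01 tT cv hv; elim: r => [|i r hS].
  have -> : (fun x => \sum_(i <- [::]) c i * v i x) = fun=> 0.
    by apply/funext => x; rewrite big_nil.
  by rewrite big_nil; exact: RL_deriv_zero.
have -> : (fun x => \sum_(j <- i :: r) c j * v j x) =
    fun x => \sum_(j <- r) c j * v j x + c i * v i x.
  by apply/funext => x; rewrite big_cons addrC.
by rewrite big_cons addrC; apply: RL_deriv_lin => //; exact: continuous_within_sum.
Qed.

(** Where [v] exceeds [B / lam], its derivative [g - lam * v] is negative, so the
    maximum principle applies to [v], and likewise to [- v]. *)
Lemma RL_decay_bound (R : realType) (T alpha t1 lam B : R) (v g : R -> R) :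
  0 < alpha < 1 -> 0 < t1 <= T -> 0 < lam ->
  {within `[0, T], continuous v} -> v 0 = 0 ->
  (forall t : R, 0 < t <= t1 -> RL_deriv_at T alpha v t (g t - lam * v t)) ->
  (forall t : R, 0 < t <= t1 -> `|g t| <= B) ->
  `|v t1| <= B / lam.
Proof.
move=> a01 t1T lam0 cv v0 hv hg; have [t10 t1T'] := andP t1T.
have B0 : 0 <= B by apply: le_trans (hg t1 _) => //; rewrite t10 lexx.
have G0 : 0 <= B / lam by rewrite divr_ge0// ltW.
have GB x : B / lam < x -> B < lam * x by rewrite ltr_pdivrMr// mulrC.
have up : v t1 <= B / lam.
  apply: (RL_max_principle a01 t1T G0 cv v0 hv) => t t0 /GB h.
  by rewrite subr_lt0; apply: le_lt_trans h; exact: le_trans (ler_norm _) (hg _ t0).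
have lo : - v t1 <= B / lam.
  have c0 : {within `[0, T], continuous (fun _ : R => 0 : R)} by move=> x; exact: cvg_cst.
  have cn := continuous_within_lin (c := -1) c0 cv.
  suff : 0 + -1 * v t1 <= B / lam by rewrite add0r mulN1r.
  apply: (@RL_max_principle R T alpha t1 (B / lam) (fun x => 0 + -1 * v x)
    (fun t => 0 + -1 * (g t - lam * v t)) a01 t1T G0 cn).
  - by rewrite v0 mulr0 addr0.
  - move=> t t0; apply: RL_deriv_lin => //; [|exact: RL_deriv_zero|exact: hv].
    by have /andP[-> h] := t0; exact: le_trans h t1T'.
  - move=> t t0; rewrite !add0r !mulN1r => /GB; rewrite mulrN => h.
    rewrite oppr_lt0 subr_gt0; apply: (@lt_le_trans _ _ (- B)); first by rewrite ltrNr.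
    by have := hg _ t0; rewrite ler_norml => /andP[].
by rewrite ler_norml up lerNl lo.
Qed.

(** * Trigonometric inequalities and the Fejer kernel *)

Lemma nonneg_of_derive (R : realType) (f df : R -> R) (x : R) :
  (forall y : R, is_derive y 1 f (df y)) -> f 0 = 0 ->
  (forall y, 0 < y -> 0 <= df y) -> 0 <= x -> 0 <= f x.
Proof.
move=> fd f0 df0 x0.
have c : {within `[0, x], continuous f}.
  by apply: continuous_within_subset => y _; exact: is_derive_continuous (fd y).
have := x0; rewrite le_eqVlt => /predU1P[<-|x0']; first by rewrite f0.
have [y] := @MVT R f df 0 x x0' (fun y _ => fd y) c.
rewrite in_itv/= => /andP[y0 _]; rewrite f0 !subr0 => ->.
by rewrite mulr_ge0// df0.
Qed.

Lemma sin_le_id (R : realType) (x : R) : 0 <= x -> sin x <= x.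
Proof.
move=> x0; rewrite -subr_ge0.
apply: (@nonneg_of_derive R (fun y => y - sin y) (fun y => 1 - cos y)) => //.
by rewrite sin0 subr0.
Qed.

Lemma normr_sin_le (R : realType) (x : R) : `|sin x| <= `|x|.
Proof.
wlog x0 : x / 0 <= x => [H|].
  have [/H//|x0] := leP 0 x.
  by have := H (- x); rewrite sinN !normrN; apply; rewrite oppr_ge0 ltW.
rewrite (ger0_norm x0) ler_norml sin_le_id// andbT -subr_ge0 opprK.
apply: (@nonneg_of_derive R (fun y => sin y + y) (fun y => cos y + 1)) => //.
by rewrite sin0 addr0.
Qed.

Lemma oneB_cos (R : realType) (x : R) : 1 - cos x = 2 * sin (x / 2) ^+ 2.
Proof.
have := cosD (x / 2) (x / 2); rewrite -splitr -!expr2 => ->.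
by have := cos2Dsin2 (x / 2); lra.
Qed.

Lemma cos_ge_quadratic (R : realType) (x : R) : 1 - x ^+ 2 / 2 <= cos x.
Proof.
have h : sin (x / 2) ^+ 2 <= (x / 2) ^+ 2.
  by rewrite -real_normK ?num_real// -[X in _ <= X]real_normK ?num_real// lerXn2r ?nnegrE// normr_sin_le.
have := oneB_cos x; nra.
Qed.

Lemma sin_ge_cubic (R : realType) (x : R) : 0 <= x -> x - x ^+ 3 / 6 <= sin x.
Proof.
move=> x0; rewrite -subr_ge0.
pose f (y : R) := sin y - (y - y ^+ 3 / 6).
pose df (y : R) := cos y - (1 - y ^+ 2 / 2).
apply: (@nonneg_of_derive R f df); last exact: x0.
- move=> y; rewrite /f /df; apply: is_derive_eq.
  rewrite /GRing.scale/=. by field.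
- by rewrite /f sin0; ring.
- by move=> y _; rewrite subr_ge0 cos_ge_quadratic.
Qed.

Lemma sin_ge_third (R : realType) (x : R) : 0 <= x <= 2 -> x / 3 <= sin x.
Proof. move=> /andP[x0 x2]; apply: le_trans (sin_ge_cubic x0); nra. Qed.

(** Up to half a period, [1 - cos] dominates a square.  It replaces the square as
    test function because the Fejer kernel integrates it in closed form. *)
Lemma sqr_le_oneB_cos (R : realType) (z : R) : `|z| <= 1 ->
  z ^+ 2 <= 9 / 2 * (1 - cos (pi * z)).
Proof.
wlog z0 : z / 0 <= z => [H|].
  have [/H//|z0 z1] := leP 0 z.
  by have := H (- z); rewrite sqrrN mulrN cosN normrN; apply => //; lra.
rewrite ger0_norm// => z1.
have p2 := pi_ge2 R; have p4 : pi <= 4 :> R by have := pihalf_lt2 R; lra.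
have h : pi * z / 2 / 3 <= sin (pi * z / 2).
  by apply: sin_ge_third; apply/andP; split; nra.
have h1 : z / 3 <= sin (pi * z / 2) by nra.
rewrite oneB_cos.
have : (z / 3) ^+ 2 <= sin (pi * z / 2) ^+ 2 by rewrite lerXn2r ?nnegrE; lra.
by lra.
Qed.

(** The usual Fejer kernel multiplied by [n], which keeps the identities below free
    of quotients. *)
Definition fejer (R : realType) (n : nat) (x : R) : R :=
  n%:R + 2 * \sum_(1 <= m < n) ((n%:R - m%:R) * cos (m%:R * x)).

Lemma fejerS (R : realType) n (x : R) :
  fejer n.+1 x = fejer n x + 1 + 2 * \sum_(1 <= m < n.+1) cos (m%:R * x).
Proof.
rewrite /fejer; case: n => [|n]; first by rewrite !big_geq//; ring.
have -> : \sum_(1 <= m < n.+2) ((n.+2%:R - m%:R) * cos (m%:R * x)) =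
    \sum_(1 <= m < n.+1) ((n.+1%:R - m%:R) * cos (m%:R * x)) +
    \sum_(1 <= m < n.+2) cos (m%:R * x).
  rewrite -[X in X + _]addr0 -[X in _ + X + _](mul0r (cos (n.+1%:R * x))).
  rewrite -[X in _ + X * _ + _](subrr (n.+1%:R)) -big_nat_recr//= -big_split/=.
  by apply: eq_big_nat => m _; rewrite -(natr1 n.+1); ring.
by rewrite -(natr1 n.+1); ring.
Qed.

(** The squared modulus of a geometric sum of unit complex numbers. *)
Lemma fejer_sqr (R : realType) n (x : R) :
  fejer n x = (\sum_(j < n) cos (j%:R * x)) ^+ 2 + (\sum_(j < n) sin (j%:R * x)) ^+ 2.
Proof.
elim: n => [|n IH]; first by rewrite /fejer big_geq// !big_ord0; ring.
rewrite fejerS IH !big_ord_recr/=.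
set C := \sum_(i < n) cos _; set S := \sum_(i < n) sin _.
have E : \sum_(1 <= m < n.+1) cos (m%:R * x) = C * cos (n%:R * x) + S * sin (n%:R * x).
  rewrite big_add1/= big_mkord (reindex_inj rev_ord_inj)/= !mulr_suml -big_split/=.
  apply: eq_bigr => i _; rewrite -cosB -[RHS]cosN opprB -mulrBl.
  have -> : (n - i.+1).+1%:R = n%:R - i%:R :> R; last exact: erefl.
  by rewrite (subnSK (ltn_ord i)) (natrB _ (ltnW (ltn_ord i))).
rewrite E; have := cos2Dsin2 (n%:R * x); set c := cos _; set s := sin _ => cs.
have -> : (C + c) ^+ 2 + (S + s) ^+ 2 =
    C ^+ 2 + S ^+ 2 + (c ^+ 2 + s ^+ 2) + 2 * (C * c + S * s) by ring.
by rewrite cs.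
Qed.

Lemma fejer_ge0 (R : realType) n (x : R) : 0 <= fejer n x.
Proof. by rewrite fejer_sqr addr_ge0 ?sqr_ge0. Qed.

(** * Orthonormality of the sine functions *)

Lemma dirichlet_oneB_cos (R : realType) n (x : R) :
  (1 + 2 * \sum_(1 <= m < n.+1) cos (m%:R * x)) * (1 - cos x) =
  cos (n%:R * x) - cos (n.+1%:R * x).
Proof.
elim: n => [|n IH]; first by rewrite big_geq// mul0r cos0 mul1r; ring.
rewrite big_nat_recr//= [2 * (_ + _)]mulrDr addrA mulrDl IH.
have e1 : cos (n.+2%:R * x) = cos (n.+1%:R * x) * cos x - sin (n.+1%:R * x) * sin x.
  by rewrite -cosD -[in LHS](natr1 n.+1) mulrDl mul1r.
have e2 : cos (n%:R * x) = cos (n.+1%:R * x) * cos x + sin (n.+1%:R * x) * sin x.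
  by rewrite -cosB -(natr1 n) mulrDl mul1r addrK.
by rewrite e1 e2; ring.
Qed.

(** The kernel has mass [n], but against [1 - cos] its mass stays bounded: this is
    its concentration at the origin. *)
Lemma fejer_oneB_cos (R : realType) n (x : R) :
  fejer n x * (1 - cos x) = 1 - cos (n%:R * x).
Proof.
elim: n => [|n IH].
  by rewrite /fejer big_geq// mul0r cos0; ring.
by rewrite fejerS -addrA mulrDl IH dirichlet_oneB_cos; ring.
Qed.

Lemma sin_natpi (R : realType) (m : nat) : sin (m%:R * pi) = 0 :> R.
Proof.
rewrite mulr_natl -[X in sin X]add0r (alternatingn (@sinDpi R)).
by rewrite sin0 mulr0.
Qed.

Lemma cos_natpi (R : realType) (m : nat) : cos (m%:R * pi) = (-1) ^+ m :> R.
Proof.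
rewrite mulr_natl -[X in cos X]add0r (alternatingn (@cosDpi R)).
by rewrite cos0 mulr1.
Qed.

Lemma Omega_integrable (R : realType) (f : R -> R) :
  {within `[0, 1], continuous f} -> mu.-integrable Omega (EFin \o f).
Proof.
move=> cf; apply: integrableS (within_integrable cf).
- exact: measurable_itv.
- exact: measurable_itv.
- exact: subset_itv_oo_cc.
Qed.

Lemma continuous_Omega_integrable (R : realType) (f : R -> R) :
  continuous f -> mu.-integrable Omega (EFin \o f).
Proof. by move=> cf; apply: Omega_integrable; exact: continuous_subspaceT. Qed.

Lemma measurable_Omega (R : realType) : measurable (@Omega R : set (measurableTypeR R)).
Proof. exact: measurable_itv. Qed.

Lemma continuous_phi (R : realType) k : continuous (@phi R k).
Proof.
move=> x; apply: cvgM; first exact: cvg_cst.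
apply: (@continuous_comp _ _ _ (fun y : R => k%:R * pi * y) sin); last exact: continuous_sin.
by apply: cvgM; [exact: cvg_cst|exact: cvg_id].
Qed.

Lemma lebesgue_Omega (R : realType) : mu (@Omega R : set (measurableTypeR R)) = 1%:E.
Proof.
have := lebesgue_measure_itv (`]0, 1[ : interval R).
by rewrite /= lte_fin ltr01 oppr0 adde0.
Qed.

Lemma Rintegral_Omega_cst (R : realType) (c : R) : \int[mu]_(x in Omega) (fun=> c) x = c.
Proof.
by rewrite (Rintegral_cst mu (@measurable_Omega R)) [X in fine X]lebesgue_Omega mulr1.
Qed.

Lemma measurable_phi (R : realType) k : measurable_fun Omega (phi k : measurableTypeR R -> R).
Proof.
by apply: measurable_funTS; apply: continuous_measurable_fun; exact: continuous_phi.
Qed.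

Lemma Rintegral_sum (R : realType) (I : eqType) (D : set (measurableTypeR R)) (r : seq I) (P : pred I)
    (f : I -> R -> R) : measurable D ->
  (forall i, P i -> mu.-integrable D (EFin \o f i)) ->
  mu.-integrable D (EFin \o (fun x => \sum_(i <- r | P i) f i x)) /\
  \int[mu]_(x in D) (\sum_(i <- r | P i) f i x) =
    \sum_(i <- r | P i) \int[mu]_(x in D) f i x.
Proof.
move=> mD fi; elim: r => [|i r [IH1 IH2]].
  rewrite big_nil.
  have -> : (fun x : R => \sum_(i <- [::] | P i) f i x) = fun=> 0.
    by apply/funext => x; rewrite big_nil.
  split; first exact: integrable0.
  by rewrite Rintegral_cst// mul0r.
have [Pi|/negbTE Pi] := boolP (P i).
- have E (x : R) : \sum_(j <- i :: r | P j) f j x = f i x + \sum_(j <- r | P j) f j x.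
    by rewrite big_cons Pi.
  have -> : (fun x : R => \sum_(j <- i :: r | P j) f j x) =
      (fun x => f i x + \sum_(j <- r | P j) f j x) by apply/funext.
  split; last by rewrite RintegralD// ?big_cons ?Pi ?IH2//; exact: fi.
  by have h := integrableD mD (fi i Pi) IH1; apply: (eq_integrable mD) h => x _; rewrite /= EFinD.
- have -> : (fun x : R => \sum_(j <- i :: r | P j) f j x) =
      (fun x => \sum_(j <- r | P j) f j x) by apply/funext => x; rewrite big_cons Pi.
  by rewrite big_cons Pi.
Qed.

Lemma Rintegral_cos (R : realType) (m : nat) :
  \int[mu]_(y in Omega) cos (m%:R * (pi * y)) = (m == 0)%:R :> R.
Proof.
case: m => [|m].
  under eq_Rintegral do rewrite mul0r cos0.
  exact: Rintegral_Omega_cst.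
pose c : R := m.+1%:R * pi.
have c0 : c != 0 by rewrite mulf_neq0// gt_eqF// pi_gt0.
pose F (y : R) := c^-1 * sin (c * y).
have FD (y : R) : is_derive y 1 F (cos (c * y)).
  have D2 := is_derive1_comp (is_derive_sin (c * y)) (is_derive_lin c y).
  apply: is_derive_eq; rewrite /GRing.scale/=; field; exact: c0.
have cc : continuous (fun y : R => cos (c * y)).
  by apply: continuous_cos_arg; exact: continuous_lin.
transitivity (\int[mu]_(y in `[0, 1]) cos (c * y)).
  rewrite /Omega Rintegral_oo_cc.
    by apply: eq_Rintegral => y _; rewrite mulrA.
  apply: within_integrable; apply: continuous_subspaceT => y.
  by have := cc y; under eq_fun do rewrite /c -mulrA.
have -> : \int[mu]_(y in `[0, 1]) cos (c * y) = F 1 - F 0.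
  apply: Rintegral_FTC2; [exact: ler01|exact: continuous_subspaceT|].
  by apply: continuous_within_subset => y _; exact: is_derive_continuous (FD y).
by rewrite /F mulr1 mulr0 sin0 sin_natpi !mulr0 subrr.
Qed.

Lemma mul_phi (R : realType) k l (x y : R) :
  phi k x * phi l y = cos (k%:R * (pi * x) - l%:R * (pi * y)) - cos (k%:R * (pi * x) + l%:R * (pi * y)).
Proof.
rewrite /phi cosB cosD -!(mulrA _%:R).
transitivity ((Num.sqrt 2) ^+ 2 * (sin (k%:R * (pi * x)) * sin (l%:R * (pi * y)))); first ring.
by rewrite sqr_sqrtr//; ring.
Qed.

Lemma innerC (R : realType) (v w : R -> R) : inner v w = inner w v.
Proof. by apply: eq_Rintegral => x _; rewrite mulrC. Qed.

Lemma inner_phi (R : realType) k l : (0 < k)%N -> (0 < l)%N ->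
  inner (@phi R k) (phi l) = (k == l)%:R.
Proof.
wlog kl : k l / (l <= k)%N => [H k0 l0|k0 l0].
  have [lk|kl] := leqP l k; first exact: H.
  by rewrite innerC eq_sym; apply: H => //; exact: ltnW.
rewrite /inner.
have E y : phi k y * phi l y = cos ((k - l)%:R * (pi * y)) - cos ((k + l)%:R * (pi * y)) :> R.
  by rewrite mul_phi natrB// natrD; congr (cos _ - cos _); ring.
under eq_Rintegral do rewrite E.
have ci m : mu.-integrable Omega (EFin \o (fun y : R => cos (m%:R * (pi * y)))).
  apply: continuous_Omega_integrable; apply: continuous_cos_arg; apply: continuous_mul_fun.
    exact: continuous_cst_fun.
  exact: continuous_lin.
rewrite RintegralB//; [|exact: measurable_Omega].
rewrite !Rintegral_cos addn_eq0 [X in _ - X](_ : _ = 0); last by case: k {kl E} k0.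
by rewrite subr0 subn_eq0 eqn_leq kl andbT.
Qed.

(** * Uniform convergence of Fejer means *)

Lemma continuous_bigsum (R : realType) (I : Type) (r : seq I) (f : I -> R -> R) :
  (forall i, continuous (f i)) -> continuous (fun x => \sum_(i <- r) f i x).
Proof.
move=> cf; elim: r => [|i r IH].
  have -> : (fun x : R => \sum_(i <- [::]) f i x) = fun=> 0.
    by apply/funext => x; rewrite big_nil.
  by move=> x; exact: cvg_cst.
have -> : (fun x : R => \sum_(j <- i :: r) f j x) = fun x => f i x + \sum_(j <- r) f j x.
  by apply/funext => x; rewrite big_cons.
by move=> x; apply: cvgD; [exact: cf|exact: IH].
Qed.

Lemma continuous_fejer (R : realType) n (f : R -> R) : continuous f ->
  continuous (fun y => fejer n (f y)).
Proof.
move=> cf; apply: continuous_add_fun; first exact: continuous_cst_fun.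
apply: continuous_mul_fun; first exact: continuous_cst_fun.
apply: continuous_bigsum => m; apply: continuous_mul_fun; first exact: continuous_cst_fun.
apply: continuous_cos_arg; apply: continuous_mul_fun => //; exact: continuous_cst_fun.
Qed.

Lemma continuous_affine (R : realType) (a b : R) : continuous (fun y : R => a + b * y).
Proof.
by apply: continuous_add_fun; [exact: continuous_cst_fun|exact: continuous_lin].
Qed.

Definition fejer_mean (R : realType) (n : nat) (v : R -> R) (x : R) : R :=
  \sum_(1 <= m < n) (1 - m%:R / n%:R) * (inner v (phi m) * phi m x).

Section FejerApproximation.
Variables (R : realType) (psi : R -> R) (n : nat) (x : R).
Hypotheses (cpsi : continuous psi) (n0 : (0 < n)%N).
(* The odd continuation of [psi] is convolved with the kernel; folding the integral
   back to (0, 1) leaves a direct term [Fm] and a reflected term [Fp]. *)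
Let Fm (y : R) := fejer n (pi * x + - pi * y).
Let Fp (y : R) := fejer n (pi * x + pi * y).

Let cFm : continuous Fm.
Proof. by apply: continuous_fejer; exact: continuous_affine. Qed.
Let cFp : continuous Fp.
Proof. by apply: continuous_fejer; exact: continuous_affine. Qed.

Let fejer_add (y : R) : 2^-1 * (Fm y + Fp y) =
  n%:R + \sum_(1 <= m < n) ((n%:R - m%:R) * 2 * cos (m%:R * (pi * x))) * cos (m%:R * (pi * y)).
Proof.
rewrite /Fm /Fp /fejer.
transitivity (n%:R + \sum_(1 <= m < n) ((n%:R - m%:R) * cos (m%:R * (pi * x + - pi * y)) +
   (n%:R - m%:R) * cos (m%:R * (pi * x + pi * y)))).
  by rewrite big_split/=; field.
congr (_ + _); apply: eq_bigr => m _.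
have -> : m%:R * (pi * x + - pi * y) = m%:R * (pi * x) - m%:R * (pi * y) by ring.
have -> : m%:R * (pi * x + pi * y) = m%:R * (pi * x) + m%:R * (pi * y) by ring.
by rewrite cosB cosD; ring.
Qed.

Let fejer_sub (y : R) : 2^-1 * (Fm y - Fp y) =
  \sum_(1 <= m < n) (n%:R - m%:R) * (phi m x * phi m y).
Proof.
rewrite /Fm /Fp /fejer.
transitivity (\sum_(1 <= m < n) ((n%:R - m%:R) * cos (m%:R * (pi * x + - pi * y)) -
   (n%:R - m%:R) * cos (m%:R * (pi * x + pi * y)))).
  by rewrite sumrB/=; field.
apply: eq_bigr => m _; rewrite mul_phi -mulrBr mulNr; congr (_ * (cos _ - cos _)); ring.
Qed.

Let ci (f : R -> R) : continuous f -> mu.-integrable Omega (EFin \o f).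
Proof. exact: continuous_Omega_integrable. Qed.

Let ccos (m : nat) : continuous (fun y : R => cos (m%:R * (pi * y))).
Proof.
by apply: continuous_cos_arg; apply: continuous_mul_fun; [exact: continuous_cst_fun|exact: continuous_lin].
Qed.

Let int_fejer_add : \int[mu]_(y in Omega) (2^-1 * (Fm y + Fp y)) = n%:R.
Proof.
under eq_Rintegral do rewrite fejer_add.
have cc m : continuous (fun y : R => ((n%:R - m%:R) * 2 * cos (m%:R * (pi * x))) * cos (m%:R * (pi * y))).
  by apply: continuous_mul_fun; [exact: continuous_cst_fun|exact: ccos].
rewrite RintegralD; [|exact: measurable_Omega|exact/ci/continuous_cst_fun|
  by apply: ci; exact: continuous_bigsum].
rewrite Rintegral_Omega_cst -[RHS]addr0; congr (_ + _).
have [_ ->] := Rintegral_sum (index_iota 1 n) (P := xpredT) (@measurable_Omega R)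
  (fun m _ => ci (cc m)).
rewrite big_nat big1// => m /andP[m0 _].
rewrite RintegralZl; [|exact: measurable_Omega|apply: ci; exact: ccos].
by rewrite Rintegral_cos; case: m m0 => // m _; rewrite mulr0.
Qed.

Let mean_integral : n%:R * fejer_mean n psi x =
  \int[mu]_(y in Omega) (psi y * (2^-1 * (Fm y - Fp y))).
Proof.
have cc m : continuous (fun y : R => (n%:R - m%:R) * phi m x * (psi y * phi m y)).
  apply: continuous_mul_fun; first exact: continuous_cst_fun.
  by apply: continuous_mul_fun => //; exact: continuous_phi.
transitivity (\int[mu]_(y in Omega) \sum_(1 <= m < n) (n%:R - m%:R) * phi m x * (psi y * phi m y)).
  have [_ ->] := Rintegral_sum (index_iota 1 n) (P := xpredT) (@measurable_Omega R)
    (fun m _ => ci (cc m)).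
  rewrite /fejer_mean big_distrr/=; apply: eq_big_nat => m /andP[m0 mn].
  rewrite RintegralZl; [|exact: measurable_Omega|].
    rewrite /inner; set I := Rintegral _ _ _.
    have : n%:R != 0 :> R by rewrite pnatr_eq0 -lt0n.
    by move=> ?; field.
  by apply: ci; apply: continuous_mul_fun => //; exact: continuous_phi.
apply: eq_Rintegral => y _; rewrite fejer_sub big_distrr/=.
by apply: eq_bigr => m _; ring.
Qed.

(** Korovkin's argument.  The kernels are nonnegative, have total mass [n] and
    integrate the test function to 1, so a modulus of continuity of the form
    [e + C * (1 - cos)] yields the error [e + C / n].  The second hypothesis is the
    modulus of continuity of the odd continuation across the boundary. *)
Lemma fejer_mean_approx (e C : R) : 0 <= e -> 0 <= C ->
  (forall y, 0 < y < 1 -> `|psi x - psi y| <= e + C * (1 - cos (pi * (x - y)))) ->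
  (forall y, 0 < y < 1 -> `|psi x + psi y| <= e + C * (1 - cos (pi * (x + y)))) ->
  `|psi x - fejer_mean n psi x| <= e + C / n%:R.
Proof.
move=> e0 C0 Hm Hp.
have nR : 0 < n%:R :> R by rewrite ltr0n.
pose I (y : R) := 2^-1 * (Fm y * (psi x - psi y) + Fp y * (psi x + psi y)).
pose B (y : R) := e * (2^-1 * (Fm y + Fp y)) + C * (1 - 2^-1 * (2 * cos (n%:R * (pi * x))) * cos (n%:R * (pi * y))).
have cA : continuous (fun y : R => 2^-1 * (Fm y + Fp y)).
  by apply: continuous_mul_fun; [exact: continuous_cst_fun|exact: continuous_add_fun].
have cS : continuous (fun y : R => 2^-1 * (Fm y - Fp y)).
  by apply: continuous_mul_fun; [exact: continuous_cst_fun|exact: continuous_sub_fun].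
have cI : continuous I.
  apply: continuous_mul_fun; first exact: continuous_cst_fun.
  apply: continuous_add_fun; apply: continuous_mul_fun => //.
    by apply: continuous_sub_fun => //; exact: continuous_cst_fun.
  by apply: continuous_add_fun => //; exact: continuous_cst_fun.
have cB2 : continuous (fun y : R => 1 - 2^-1 * (2 * cos (n%:R * (pi * x))) * cos (n%:R * (pi * y))).
  apply: continuous_sub_fun; first exact: continuous_cst_fun.
  by apply: continuous_mul_fun; [exact: continuous_cst_fun|exact: ccos].
have cB : continuous B.
  by apply: continuous_add_fun; apply: continuous_mul_fun => //; exact: continuous_cst_fun.
have IE : n%:R * (psi x - fejer_mean n psi x) = \int[mu]_(y in Omega) I y.
  rewrite mulrBr mean_integral mulrC -int_fejer_add.
  rewrite -RintegralZl; [|exact: measurable_Omega|exact: ci cA].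
  rewrite -RintegralB; [|exact: measurable_Omega| |].
  - by apply: eq_Rintegral => y _; rewrite /I; field.
  - by apply: ci; apply: continuous_mul_fun => //; exact: continuous_cst_fun.
  - by apply: ci; apply: continuous_mul_fun.
have BE : \int[mu]_(y in Omega) B y = e * n%:R + C.
  rewrite RintegralD; [|exact: measurable_Omega| |].
  - rewrite RintegralZl; [|exact: measurable_Omega|exact: ci cA].
    rewrite int_fejer_add RintegralZl; [|exact: measurable_Omega|exact: ci cB2].
    rewrite RintegralB; [|exact: measurable_Omega|exact/ci/continuous_cst_fun|].
      rewrite Rintegral_Omega_cst RintegralZl; [|exact: measurable_Omega|apply: ci; exact: ccos].
      by rewrite Rintegral_cos (negbTE (_ : n != 0)%N) -?lt0n// mulr0 subr0 mulr1.
    by apply: ci; apply: continuous_mul_fun; [exact: continuous_cst_fun|exact: ccos].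
  - by apply: ci; apply: continuous_mul_fun => //; exact: continuous_cst_fun.
  - by apply: ci; apply: continuous_mul_fun => //; exact: continuous_cst_fun.
have IB y : 0 < y < 1 -> `|I y| <= B y.
  move=> y01; rewrite /I normrM ger0_norm// ?invr_ge0//.
  have Fm0 : 0 <= Fm y by exact: fejer_ge0.
  have Fp0 : 0 <= Fp y by exact: fejer_ge0.
  have h1 : `|Fm y * (psi x - psi y)| <= Fm y * (e + C * (1 - cos (pi * (x - y)))).
    by rewrite normrM (ger0_norm Fm0) ler_wpM2l// Hm.
  have h2 : `|Fp y * (psi x + psi y)| <= Fp y * (e + C * (1 - cos (pi * (x + y)))).
    by rewrite normrM (ger0_norm Fp0) ler_wpM2l// Hp.
  have k1 : Fm y * (1 - cos (pi * (x - y))) = 1 - cos (n%:R * (pi * x) - n%:R * (pi * y)).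
    rewrite /Fm (_ : pi * x + - pi * y = pi * (x - y)); last by ring.
    by rewrite fejer_oneB_cos; congr (1 - cos _); ring.
  have k2 : Fp y * (1 - cos (pi * (x + y))) = 1 - cos (n%:R * (pi * x) + n%:R * (pi * y)).
    rewrite /Fp (_ : pi * x + pi * y = pi * (x + y)); last by ring.
    by rewrite fejer_oneB_cos; congr (1 - cos _); ring.
  have -> : B y = 2^-1 * (Fm y * (e + C * (1 - cos (pi * (x - y)))) + Fp y * (e + C * (1 - cos (pi * (x + y))))).
    transitivity (e * (2^-1 * (Fm y + Fp y)) + C * (2^-1 *
      (Fm y * (1 - cos (pi * (x - y))) + Fp y * (1 - cos (pi * (x + y)))))); last by ring.
    by rewrite k1 k2 cosB cosD /B; field.
  rewrite ler_wpM2l ?invr_ge0//; apply: le_trans (ler_normD _ _) _; exact: lerD.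
have : `|n%:R * (psi x - fejer_mean n psi x)| <= e * n%:R + C.
  rewrite IE -BE; apply: le_trans (le_normr_Rintegral _ (ci cI)) _; first exact: measurable_Omega.
  apply: le_Rintegral; [exact: measurable_Omega| |exact: ci cB|].
    by apply: ci => y; apply: cvg_norm; exact: cI.
  by move=> y; rewrite /Omega/= in_itv/=; exact: IB.
rewrite normrM gtr0_norm// => h.
rewrite -(ler_pM2l nR); apply: le_trans h _.
by rewrite mulrDr mulrCA divff ?gt_eqF// mulr1 mulrC.
Qed.

End FejerApproximation.

(** Near the diagonal by uniform continuity, away from it by boundedness. *)
Lemma quadratic_modulus (R : realType) (psi : R -> R) (e : R) :
  continuous psi -> 0 < e -> exists2 C, 0 <= C &
  forall x y, 0 <= x <= 1 -> 0 <= y <= 1 -> `|psi x - psi y| <= e + C * (x - y) ^+ 2.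
Proof.
move=> cpsi e0.
have [d d0 hd] := heine (@segment_compact _ 0 1) cpsi e0.
have [M hM] : exists M, forall x : R, 0 <= x <= 1 -> `|psi x| <= M.
  by apply: segment_bounded; exact: continuous_subspaceT.
have M0 : 0 <= M by apply: le_trans (hM 0 _); rewrite ?lexx ?ler01.
have d2 : 0 < d ^+ 2 by rewrite exprn_gt0.
exists (2 * M / d ^+ 2); first by rewrite divr_ge0// ?mulr_ge0// ltW.
move=> x y x01 y01; have [xy|xy] := ltP `|x - y| d.
  apply: le_trans (ltW (hd _ _ _ xy)) _; first by rewrite /= in_itv.
  by rewrite lerDl mulr_ge0 ?sqr_ge0// divr_ge0 ?mulr_ge0// ltW.
have h1 : `|psi x| <= M by exact: hM.
have h2 : `|psi y| <= M by exact: hM.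
have h3 : d ^+ 2 <= (x - y) ^+ 2.
  by rewrite -[X in _ <= X]real_normK ?num_real// lerXn2r ?nnegrE// ltW.
have h4 : 2 * M <= 2 * M / d ^+ 2 * (x - y) ^+ 2.
  by rewrite -mulrA ler_peMr ?mulr_ge0// ler_pdivlMl// mulr1.
apply: le_trans (ler_normB _ _) _; lra.
Qed.

(** In the bound of the sum, [psi x] and [- psi y] are compared through the zero
    boundary value at the nearer end point: at 0 if [x + y <= 1], otherwise at 1,
    where the reflection [x -> 1 - x] leaves the cosine unchanged. *)
Lemma korovkin_modulus (R : realType) (psi : R -> R) (e : R) :
  continuous psi -> psi 0 = 0 -> psi 1 = 0 -> 0 < e -> exists2 C, 0 <= C &
  forall x y, 0 <= x <= 1 -> 0 <= y <= 1 ->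
    `|psi x - psi y| <= e + C * (1 - cos (pi * (x - y))) /\
    `|psi x + psi y| <= e + C * (1 - cos (pi * (x + y))).
Proof.
move=> cpsi psi0 psi1 e0; have e20 : 0 < e / 2 by rewrite divr_gt0.
have [C C0 hC] := quadratic_modulus cpsi e20.
exists (C * (9 / 2)); first by rewrite mulr_ge0.
have key x y : 0 <= x <= 1 -> 0 <= y <= 1 -> x + y <= 1 ->
    C * x ^+ 2 + C * y ^+ 2 <= C * (9 / 2) * (1 - cos (pi * (x + y))).
  move=> x01 y01 xy; rewrite -mulrDr -mulrA ler_wpM2l//.
  have h : `|x + y| <= 1 by rewrite ger0_norm; lra.
  by apply: le_trans (sqr_le_oneB_cos h); nra.
have Z : 0 <= (0 : R) <= 1 by rewrite lexx ler01.
have O : 0 <= (1 : R) <= 1 by rewrite lexx ler01.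
move=> x y x01 y01; split.
  have h : `|x - y| <= 1 by rewrite ler_norml; lra.
  apply: le_trans (hC _ _ x01 y01) _.
  have := ler_wpM2l C0 (sqr_le_oneB_cos h); lra.
have [xy|xy] := leP (x + y) 1.
  have := hC _ _ x01 Z; have := hC _ _ y01 Z; rewrite psi0 !subr0 => hy hx.
  have := key _ _ x01 y01 xy.
  have := ler_normD (psi x) (psi y); lra.
have hx := hC _ _ O x01; have hy := hC _ _ O y01.
rewrite psi1 !sub0r !normrN in hx hy.
have x1 : 0 <= 1 - x <= 1 by lra.
have y1 : 0 <= 1 - y <= 1 by lra.
have xy1 : (1 - x) + (1 - y) <= 1 by lra.
have := key _ _ x1 y1 xy1.
have -> : cos (pi * (1 - x + (1 - y))) = cos (pi * (x + y)).
  have -> : pi * (1 - x + (1 - y)) = - (pi * (x + y)) + pi *+ 2 by ring.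
  by rewrite cosD2pi cosN.
have := ler_normD (psi x) (psi y); lra.
Qed.

Theorem fejer_uniform (R : realType) (psi : R -> R) (e : R) :
  continuous psi -> psi 0 = 0 -> psi 1 = 0 -> 0 < e -> exists n0 : nat,
  forall n x, (n0 <= n)%N -> (0 < n)%N -> 0 <= x <= 1 -> `|psi x - fejer_mean n psi x| <= e.
Proof.
move=> cpsi psi0 psi1 e0; have e20 : 0 < e / 2 by rewrite divr_gt0.
have [C C0 hC] := korovkin_modulus cpsi psi0 psi1 e20.
exists (Num.trunc (C / (e / 2))).+1 => n x nn n0 x01.
have nR : 0 < n%:R :> R by rewrite ltr0n.
have bnd : C / n%:R <= e / 2.
  rewrite ler_pdivrMr// mulrC -ler_pdivrMr//.
  apply: le_trans (ltW (truncnS_gt _)) _; by rewrite ler_nat.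
have H y : 0 < y < 1 -> 0 <= y <= 1 by move=> /andP[y0 y1]; rewrite !ltW.
apply: le_trans (@fejer_mean_approx R psi n x cpsi n0 (e / 2) C (ltW e20) C0 _ _) _.
- by move=> y /H y01; have [] := hC x y x01 y01.
- by move=> y /H y01; have [] := hC x y x01 y01.
- lra.
Qed.

Lemma sum_cauchy_schwarz (R : realType) (I : Type) (r : seq I) (P : pred I) (a b : I -> R) :
  (\sum_(i <- r | P i) a i * b i) ^+ 2 <=
  (\sum_(i <- r | P i) a i ^+ 2) * (\sum_(i <- r | P i) b i ^+ 2).
Proof.
set A := \sum_(i <- r | P i) a i ^+ 2; set B := \sum_(i <- r | P i) b i ^+ 2.
set S := \sum_(i <- r | P i) a i * b i.
have A0 : 0 <= A by apply: sumr_ge0 => i _; exact: sqr_ge0.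
have B0 : 0 <= B by apply: sumr_ge0 => i _; exact: sqr_ge0.
have key (p q : R) : 0 <= p ^+ 2 * A - 2 * (p * q) * S + q ^+ 2 * B.
  have -> : p ^+ 2 * A - 2 * (p * q) * S + q ^+ 2 * B =
      \sum_(i <- r | P i) (p * a i - q * b i) ^+ 2.
    rewrite /A /B /S !mulr_sumr -sumrB -big_split/=; apply: eq_bigr => i _; ring.
  by apply: sumr_ge0 => i _; exact: sqr_ge0.
move: B0; rewrite le_eqVlt => /predU1P[B0|B0].
  rewrite -B0 mulr0; case: (eqVneq S 0) => [->|S0]; first by rewrite expr0n.
  have := key 1 ((A + 1) / S); rewrite -B0 mulr0 addr0 expr1n !mul1r -mulrA divfK//; lra.
have := key B S; nra.
Qed.

Lemma sum_cauchy_schwarz_sqrt (R : realType) (I : Type) (r : seq I) (P : pred I) (a b : I -> R) :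
  \sum_(i <- r | P i) a i * b i <=
  Num.sqrt (\sum_(i <- r | P i) a i ^+ 2) * Num.sqrt (\sum_(i <- r | P i) b i ^+ 2).
Proof.
rewrite -sqrtrM; last by apply: sumr_ge0 => i _; exact: sqr_ge0.
apply: le_trans (ler_norm _) _; rewrite -sqrtr_sqr ler_wsqrtr//.
exact: sum_cauchy_schwarz.
Qed.

(** * The L^1 norm in terms of sine coefficients *)

Lemma bessel (R : realType) (psi : R -> R) (n : nat) : continuous psi ->
  \sum_(1 <= k < n) inner psi (phi k) ^+ 2 <= \int[mu]_(x in Omega) psi x ^+ 2.
Proof.
move=> cpsi; have mO := @measurable_Omega R.
have ci (f : R -> R) : continuous f -> mu.-integrable Omega (EFin \o f).
  exact: continuous_Omega_integrable.
pose S (x : R) := \sum_(1 <= k < n) inner psi (phi k) * phi k x.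
have cc k : continuous (fun x : R => inner psi (phi k) * phi k x).
  by apply: continuous_mul_fun; [exact: continuous_cst_fun|exact: continuous_phi].
have cS : continuous S by exact: continuous_bigsum.
have sumI (w : R -> R) : continuous w ->
    \int[mu]_(x in Omega) (w x * S x) = \sum_(1 <= k < n) inner psi (phi k) * inner w (phi k).
  move=> cw.
  have ck k : continuous (fun x : R => inner psi (phi k) * (w x * phi k x)).
    apply: continuous_mul_fun; first exact: continuous_cst_fun.
    by apply: continuous_mul_fun => //; exact: continuous_phi.
  transitivity (\int[mu]_(x in Omega) \sum_(1 <= k < n) inner psi (phi k) * (w x * phi k x)).
    by apply: eq_Rintegral => x _; rewrite /S mulr_sumr; apply: eq_bigr => k _; ring.
  have [_ ->] := Rintegral_sum (index_iota 1 n) (P := xpredT) mO (fun k _ => ci _ (ck k)).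
  apply: eq_bigr => k _; rewrite RintegralZl//.
  by apply: ci; apply: continuous_mul_fun => //; exact: continuous_phi.
have I1 : \int[mu]_(x in Omega) (psi x * S x) = \sum_(1 <= k < n) inner psi (phi k) ^+ 2.
  by rewrite sumI//; apply: eq_bigr => k _; rewrite expr2.
have I2 : \int[mu]_(x in Omega) (S x * S x) = \sum_(1 <= k < n) inner psi (phi k) ^+ 2.
  rewrite sumI//; apply: eq_big_nat => k /andP[k0 kn]; rewrite expr2; congr (_ * _).
  rewrite innerC.
  rewrite /inner sumI; last exact: continuous_phi.
  rewrite (bigD1_seq k) ?mem_index_iota ?k0 ?iota_uniq//= inner_phi// eqxx mulr1.
  rewrite big_nat_cond big1 ?addr0// => l /andP[/andP[l0 _] lk].
  by rewrite inner_phi// eq_sym (negbTE lk) mulr0.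
have : 0 <= \int[mu]_(x in Omega) ((psi x ^+ 2 - 2 * (psi x * S x)) + S x * S x).
  apply: Rintegral_ge0 => x _.
  have -> : psi x ^+ 2 - 2 * (psi x * S x) + S x * S x = (psi x - S x) ^+ 2 by ring.
  exact: sqr_ge0.
have c2 : continuous (fun x => psi x ^+ 2).
  by under eq_fun do rewrite expr2; exact: continuous_mul_fun.
have cPS : continuous (fun x => psi x * S x) by exact: continuous_mul_fun.
have c3 : continuous (fun x => 2 * (psi x * S x)).
  by apply: continuous_mul_fun => //; exact: continuous_cst_fun.
rewrite RintegralD//; [|by apply: ci; exact: continuous_sub_fun|by apply: ci; exact: continuous_mul_fun].
rewrite RintegralB//; [|exact: ci c2|exact: ci c3].
rewrite RintegralZl//; last exact: ci.
by rewrite I1 I2; lra.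
Qed.

Lemma bounded_mul_integrable (R : realType) (v w : R -> R) (M : R) :
  mu.-integrable Omega (EFin \o v) -> measurable_fun Omega w ->
  (forall x, Omega x -> `|w x| <= M) ->
  mu.-integrable Omega (EFin \o (fun x => v x * w x)).
Proof.
move=> vi mw wM; have mO := @measurable_Omega R.
have vM := integrableZl mO M (integrable_abse vi).
apply: le_integrable vM => //.
  apply/measurable_EFinP; apply: measurable_funM => //.
  by apply/measurable_EFinP; case/integrableP: vi.
move=> x Ox /=; rewrite lee_fin normrM [X in _ <= X]normrM normr_id mulrC.
by rewrite ler_wpM2r//; apply: le_trans (wM x Ox) (ler_norm _).
Qed.

Lemma continuous_mul_integrable (R : realType) (v w : R -> R) :
  mu.-integrable Omega (EFin \o v) -> continuous w ->
  mu.-integrable Omega (EFin \o (fun x => v x * w x)).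
Proof.
move=> vi cw; have [M wM] : exists M, forall x : R, 0 <= x <= 1 -> `|w x| <= M.
  by apply: segment_bounded; exact: continuous_subspaceT.
apply: (@bounded_mul_integrable _ _ _ M) => //.
  by apply: measurable_funTS; exact: continuous_measurable_fun.
by move=> x; rewrite /Omega/= in_itv/= => /andP[x0 x1]; apply: wM; rewrite !ltW.
Qed.

(** The coefficients of a Fejer mean of [psi] are dominated by those of [psi], whose
    squares add up to at most 1; by the Cauchy-Schwarz inequality the pairing of
    [v] with the mean is at most [sqrt Q].  The means converge uniformly to [psi]. *)
Lemma pairing_le (R : realType) (v psi : R -> R) (Q : R) :
  mu.-integrable Omega (EFin \o v) ->
  continuous psi -> psi 0 = 0 -> psi 1 = 0 ->
  (forall x, 0 < x < 1 -> `|psi x| <= 1) ->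
  (forall n, \sum_(1 <= k < n) inner v (phi k) ^+ 2 <= Q) ->
  \int[mu]_(x in Omega) (v x * psi x) <= Num.sqrt Q.
Proof.
move=> vi cpsi psi0 psi1 psib vQ; have mO := @measurable_Omega R.
have Q0 : 0 <= Q by apply: le_trans (vQ 0%N); apply: sumr_ge0 => k _; exact: sqr_ge0.
pose V := \int[mu]_(x in Omega) `|v x|.
have V0 : 0 <= V by apply: Rintegral_ge0.
apply/ler_addgt0Pr => e e0.
have V1 : 0 < V + 1 by apply: ltr_wpDl.
have d0 : 0 < e / (V + 1) by rewrite divr_gt0.
have [n0 hn] := fejer_uniform cpsi psi0 psi1 d0.
pose n := n0.+1.
have {}hn x : 0 <= x <= 1 -> `|psi x - fejer_mean n psi x| <= e / (V + 1) by exact: hn.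
have cs m : continuous (fun x : R => (1 - m%:R / n%:R) * (inner psi (phi m) * phi m x)).
  apply: continuous_mul_fun; first exact: continuous_cst_fun.
  by apply: continuous_mul_fun; [exact: continuous_cst_fun|exact: continuous_phi].
have cF : continuous (fejer_mean n psi) by exact: continuous_bigsum.
have cd : continuous (fun x => psi x - fejer_mean n psi x) by exact: continuous_sub_fun.
have i1 := continuous_mul_integrable vi cd.
have i2 := continuous_mul_integrable vi cF.
have -> : \int[mu]_(x in Omega) (v x * psi x) =
    \int[mu]_(x in Omega) (v x * fejer_mean n psi x) +
    \int[mu]_(x in Omega) (v x * (psi x - fejer_mean n psi x)).
  by rewrite -RintegralD//; apply: eq_Rintegral => x _; ring.
apply: lerD.
- have ii m : mu.-integrable Omega (EFin \o (fun x => ((1 - m%:R / n%:R) * inner psi (phi m)) * (v x * phi m x))).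
    apply: integrable_scale => //; apply: (continuous_mul_integrable vi); exact: continuous_phi.
  have -> : \int[mu]_(x in Omega) (v x * fejer_mean n psi x) =
      \sum_(1 <= m < n) ((1 - m%:R / n%:R) * inner psi (phi m)) * inner v (phi m).
    transitivity (\int[mu]_(x in Omega) \sum_(1 <= m < n) (((1 - m%:R / n%:R) * inner psi (phi m)) * (v x * phi m x))).
      by apply: eq_Rintegral => x _; rewrite /fejer_mean mulr_sumr; apply: eq_bigr => m _; ring.
    have [_ ->] := Rintegral_sum (index_iota 1 n) (P := xpredT) mO (fun m _ => ii m).
    apply: eq_bigr => m _; rewrite RintegralZl//.
    by apply: continuous_mul_integrable => //; exact: continuous_phi.
  apply: le_trans (sum_cauchy_schwarz_sqrt _ _ _ _) _.
  rewrite -[X in _ <= X]mul1r; apply: ler_pM; rewrite ?sqrtr_ge0//; last exact: ler_wsqrtr.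
  rewrite -[X in _ <= X]sqrtr1; apply: ler_wsqrtr.
  apply: (@le_trans _ _ (\sum_(1 <= k < n) inner psi (phi k) ^+ 2)).
    rewrite big_nat_cond [X in _ <= X]big_nat_cond; apply: ler_sum => m /andP[/andP[m0 mn] _].
    rewrite exprMn ler_piMl ?sqr_ge0//.
    have n0' : 0 < n%:R :> R by rewrite ltr0n.
    have h1 : 0 <= m%:R / n%:R :> R by rewrite divr_ge0.
    have h2 : m%:R / n%:R <= 1 :> R by rewrite ler_pdivrMr// mul1r ler_nat ltnW.
    by rewrite expr_le1//; lra.
  apply: le_trans (bessel n cpsi) _.
  have c2 : continuous (fun x => psi x ^+ 2).
    by under eq_fun do rewrite expr2; exact: continuous_mul_fun.
  rewrite -(Rintegral_Omega_cst (1 : R)).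
  apply: le_Rintegral => //.
  - exact: continuous_Omega_integrable.
  - apply: continuous_Omega_integrable; exact: continuous_cst_fun.
  - move=> x; rewrite /Omega/= in_itv/= => x01.
    by rewrite -real_normK ?num_real// expr_le1// psib.
- apply: le_trans (ler_norm _) _; apply: le_trans (le_normr_Rintegral mO i1) _.
  apply: (@le_trans _ _ (\int[mu]_(x in Omega) (e / (V + 1) * `|v x|))).
    apply: le_Rintegral => //.
    + exact: integrable_norm i1.
    + by apply: integrable_scale => //; exact: integrable_norm vi.
    + move=> x; rewrite /Omega/= in_itv/= => /andP[x0 x1].
      by rewrite normrM mulrC ler_wpM2r// hn// !ltW.
  rewrite RintegralZl//; last exact: integrable_norm vi.
  rewrite -/V -mulrA; apply: ler_piMr; first exact: ltW.
  by rewrite ler_pdivrMl// mulr1 lerDl.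
Qed.

(** A regularised sign of [g] need not vanish at the end points.  It is multiplied
    by cut-offs [c n] that do and that increase to 1 inside, and dominated
    convergence removes them. *)
Lemma pairing_sign_le (R : realType) (v g : R -> R) (Q e : R) :
  mu.-integrable Omega (EFin \o v) -> continuous g -> 0 < e ->
  (forall n, \sum_(1 <= k < n) inner v (phi k) ^+ 2 <= Q) ->
  \int[mu]_(x in Omega) (v x * (g x / (`|g x| + e))) <= Num.sqrt Q.
Proof.
move=> vi cg e0 vQ; have mO := @measurable_Omega R.
pose s (x : R) := g x / (`|g x| + e).
have s1 x : `|s x| <= 1.
  have p : 0 < `|g x| + e by rewrite ltr_wpDl.
  by rewrite /s normrM normfV (gtr0_norm p) ler_pdivrMr// mul1r lerDl ltW.
have cs : continuous s.
  apply: continuous_mul_fun => // x; apply: cvgV; first by rewrite gt_eqF// ltr_wpDl.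
  by apply: cvgD; [apply: cvg_norm; exact: cg|exact: cvg_cst].
pose c (n : nat) (x : R) := 1 - (1 - x * (1 - x)) ^+ n.+1.
have cc n : continuous (c n).
  apply: continuous_sub_fun; first exact: continuous_cst_fun.
  elim: n.+1 => [|m IH].
    by under eq_fun do rewrite expr0; exact: continuous_cst_fun.
  under eq_fun do rewrite exprS; apply: continuous_mul_fun => //.
  apply: continuous_sub_fun; first exact: continuous_cst_fun.
  apply: continuous_mul_fun; first by move=> x; exact: cvg_id.
  by apply: continuous_sub_fun; [exact: continuous_cst_fun|move=> x; exact: cvg_id].
have c01 n x : 0 < x < 1 -> 0 <= c n x <= 1.
  move=> /andP[x0 x1]; rewrite /c.
  have h : 0 <= 1 - x * (1 - x) <= 1 by nra.
  have := exprn_ge0 n.+1 (proj1 (andP h)).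
  have : (1 - x * (1 - x)) ^+ n.+1 <= 1 by apply: exprn_ile1; lra.
  lra.
have bn n : \int[mu]_(x in Omega) (v x * (s x * c n x)) <= Num.sqrt Q.
  apply: pairing_le => //.
  - exact: continuous_mul_fun.
  - by rewrite /c mul0r subr0 expr1n subrr mulr0.
  - by rewrite /c subrr mulr0 subr0 expr1n subrr mulr0.
  - move=> x /(c01 n)/andP[h0 h1]; rewrite normrM -[X in _ <= X]mul1r.
    by rewrite ler_pM// ger0_norm.
have vs := continuous_mul_integrable vi cs.
have lim : \int[mu]_(x in Omega) (v x * (s x * c n x)) @[n --> \oo] -->
    \int[mu]_(x in Omega) (v x * s x).
  apply: fine_cvg; rewrite /Rintegral fineK; last exact: integrable_fin_num vs.
  apply: (@dominated_cvg _ _ _ mu Omega mO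
    (fun n x => (v x * (s x * c n x))%:E) _ (fun x => (`|v x|)%:E)) => //.
  - move=> n; have : mu.-integrable Omega (EFin \o (fun x => v x * (s x * c n x))).
      by apply: continuous_mul_integrable => //; exact: continuous_mul_fun.
    by case/integrableP.
  - move=> x; rewrite /Omega/= in_itv/= => /andP[x0 x1].
    apply: cvg_EFin; first exact: nearW.
    apply: cvgM; first exact: cvg_cst.
    rewrite -[X in _ --> X]mulr1; apply: cvgM; first exact: cvg_cst.
    rewrite -[X in _ --> X]subr0; apply: cvgB; first exact: cvg_cst.
    rewrite (cvg_shiftS (fun n => (1 - x * (1 - x)) ^+ n)); apply: cvg_expr.
    by rewrite ger0_norm; nra.
  - exact: integrable_normr.
  - move=> n x; rewrite /Omega/= in_itv/= => /(c01 n)/andP[h0 h1].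
    rewrite lee_fin normrM ler_piMr// normrM -[X in _ <= X]mul1r.
    by rewrite ler_pM// ger0_norm.
by apply: cvgr_to_le lim _; exact: nearW.
Qed.

(** Completeness of the sine system, by duality: [v] is tested against the
    regularised sign of a continuous function that is close to [v] in L^1. *)
Theorem L1_norm_le_sine_coef (R : realType) (v : R -> R) (Q : R) :
  mu.-integrable Omega (EFin \o v) ->
  (forall n, \sum_(1 <= k < n) inner v (phi k) ^+ 2 <= Q) ->
  \int[mu]_(x in Omega) `|v x| <= Num.sqrt Q.
Proof.
move=> vi vQ; have mO := @measurable_Omega R.
apply/ler_addgt0Pr => e e0; pose d := e / 3.
have d0 : 0 < d by rewrite divr_gt0.
have e3 : 2 * d + d = e by rewrite /d; field.
have muO : (mu (@Omega R : set (measurableTypeR R)) < +oo)%E by rewrite lebesgue_Omega ltry.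
have [g [cg vg]] : exists g : R -> R, continuous g /\ \int[mu]_(x in Omega) `|v x - g x| <= d.
  have [g_ [cg _ lg]] := approximation_continuous_integrable mO muO vi.
  have /fine_cvgP[] := lg.
  move=> [m _ mfin] /cvgrPdist_le/(_ _ d0)[p _ hp].
  exists (g_ (maxn m p)); split; first exact: cg.
  have := hp (maxn m p) (leq_maxr _ _); rewrite /= sub0r normrN.
  exact: le_trans (ler_norm _).
have gi : mu.-integrable Omega (EFin \o g) by exact: continuous_Omega_integrable.
pose s (x : R) := g x / (`|g x| + d).
have s1 x : `|s x| <= 1.
  have p : 0 < `|g x| + d by rewrite ltr_wpDl.
  by rewrite /s normrM normfV (gtr0_norm p) ler_pdivrMr// mul1r lerDl ltW.
have cs : continuous s.
  apply: continuous_mul_fun => // x; apply: cvgV; first by rewrite gt_eqF// ltr_wpDl.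
  by apply: cvgD; [apply: cvg_norm; exact: cg|exact: cvg_cst].
have vs := continuous_mul_integrable vi cs.
have ni : mu.-integrable Omega (EFin \o (fun x => `|v x - g x|)).
  by apply: integrable_normr => //; exact: integrable_sub.
have pt x : `|v x| <= v x * s x + (2 * `|v x - g x| + d).
  have gs : `|g x| - g x * s x <= d.
    have p : 0 < `|g x| + d by rewrite ltr_wpDl.
    have -> : `|g x| - g x * s x = d * (`|g x| / (`|g x| + d)).
      have h : g x * g x = `|g x| * `|g x| by rewrite -normrM ger0_norm// -expr2 sqr_ge0.
      by rewrite /s mulrA h; field; rewrite gt_eqF.
    by rewrite ler_piMr ?(ltW d0)// ler_pdivrMr// mul1r lerDl ltW.
  have h1 : `|v x| <= `|v x - g x| + `|g x|.
    by have := ler_normD (v x - g x) (g x); rewrite subrK.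
  have h2 : (g x - v x) * s x <= `|v x - g x|.
    apply: le_trans (ler_norm _) _; rewrite normrM distrC -[X in _ <= X]mulr1.
    by rewrite ler_wpM2l.
  lra.
have i2 : mu.-integrable Omega (EFin \o (fun x => 2 * `|v x - g x|)) by exact: integrable_scale.
have ic : mu.-integrable Omega (EFin \o (fun _ : R => d)).
  by apply: continuous_Omega_integrable; exact: continuous_cst_fun.
have i3 := integrable_add mO i2 ic.
apply: (@le_trans _ _ (\int[mu]_(x in Omega) (v x * s x + (2 * `|v x - g x| + d)))).
  apply: le_Rintegral => //; first exact: integrable_normr.
  exact: integrable_add.
rewrite RintegralD// RintegralD// RintegralZl//.
rewrite Rintegral_Omega_cst.
apply: lerD; first exact: pairing_sign_le vi cg d0 vQ.
by rewrite -e3 lerD2r ler_wpM2l.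
Qed.

(** * Power sums *)

Lemma predn_le_expR (R : realType) (k : nat) : (0 < k)%N ->
  k.-1%:R <= k%:R * expR (- k%:R^-1) :> R.
Proof.
move=> k0; have kR : 0 < k%:R :> R by rewrite ltr0n.
have := expR_ge1Dx (- k%:R^-1 : R) => /(ler_wpM2l (ltW kR)); apply: le_trans.
by rewrite mulrDr mulr1 mulrN divff ?gt_eqF// -[in X in _ <= X](prednK k0) -natr1 addrK.
Qed.

Lemma powR_expR (R : realType) (x a : R) : expR x `^ a = expR (a * x).
Proof. by rewrite /powR gt_eqF ?expR_gt0// expRK. Qed.

Lemma powRB1 (R : realType) (x b : R) : 0 < x -> x `^ (b - 1) = x `^ b / x.
Proof.
move=> x0; rewrite powRB; first by rewrite powRr1// ltW.
by apply/implyP => _; rewrite gt_eqF.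
Qed.

(** With [y = a / k], the quotient of consecutive powers is at most [exp (- y)], and
    [exp (- y) <= (1 + y)^-1 <= 1 - y / (1 + a)] as [y <= a]; hence the constant. *)
Lemma powR_pred_le (R : realType) (a : R) (k : nat) : 0 < a -> (0 < k)%N ->
  k%:R `^ (a - 1) <= (1 + a) / a * (k%:R `^ a - k.-1%:R `^ a).
Proof.
move=> a0 k0; have kR : 0 < k%:R :> R by rewrite ltr0n.
have h : k.-1%:R `^ a <= k%:R `^ a * expR (- (a / k%:R)).
  have -> : expR (- (a / k%:R)) = expR (- k%:R^-1) `^ a by rewrite powR_expR; congr expR; ring.
  rewrite -powRM ?ler0n ?expR_ge0//.
  by rewrite ge0_ler_powR ?nnegrE ?mulr_ge0 ?expR_ge0 ?predn_le_expR// ltW.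
set y := a / k%:R in h.
have y0 : 0 < y by rewrite divr_gt0.
have k1 : 1 <= k%:R :> R by rewrite ler1n.
have ya : y <= a by rewrite ler_pdivrMr// ler_peMr// ltW.
have e1 : expR (- y) <= (1 + y)^-1.
  by rewrite expRN lef_pV2 ?posrE ?expR_gt0 ?expR_ge1Dx//; lra.
have ka : 0 < k%:R `^ a by rewrite powR_gt0.
have e2 : y / (1 + a) <= 1 - expR (- y).
  have : (1 + y)^-1 <= 1 - y / (1 + a).
    have -> : 1 - y / (1 + a) = (1 + a - y) / (1 + a) by field; rewrite gt_eqF//; lra.
    rewrite ler_pdivlMr; last lra.
    rewrite mulrC ler_pdivrMr; last lra.
    nra.
  lra.
have e3 : k%:R `^ (a - 1) = k%:R `^ a / k%:R by exact: powRB1.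
rewrite e3.
apply: (@le_trans _ _ ((1 + a) / a * (k%:R `^ a * (1 - expR (- y))))); last first.
  rewrite ler_wpM2l//; first by rewrite divr_ge0; lra.
  by rewrite mulrBr mulr1 lerD2l lerN2.
apply: (@le_trans _ _ ((1 + a) / a * (k%:R `^ a * (y / (1 + a))))).
  rewrite le_eqVlt; apply/orP; left; apply/eqP; rewrite /y; field.
  by rewrite !gt_eqF//; lra.
rewrite ler_wpM2l//; first by rewrite divr_ge0; lra.
by rewrite ler_wpM2l// ltW.
Qed.

Lemma sum_powR_lt1 (R : realType) (a : R) (n : nat) : 0 < a -> (0 < n)%N ->
  \sum_(1 <= k < n) k%:R `^ (a - 1) <= (1 + a) / a * n%:R `^ a.
Proof.
move=> a0; case: n => // n _.
have c0 : 0 <= (1 + a) / a by rewrite divr_ge0; lra.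
apply: (@le_trans _ _ ((1 + a) / a * n%:R `^ a)); last first.
  by rewrite ler_wpM2l// ge0_ler_powR ?nnegrE ?ler_nat// ltW.
elim: n => [|n IH]; first by rewrite big_geq// mulr_ge0 ?powR_ge0.
rewrite big_nat_recr//=; apply: le_trans (lerD IH (powR_pred_le a0 (ltn0Sn n))) _.
by rewrite -mulrDr addrCA subrr addr0.
Qed.

Lemma sum_inv (R : realType) (n : nat) : (0 < n)%N ->
  \sum_(1 <= k < n) k%:R^-1 <= 1 + ln (n%:R : R).
Proof.
case: n => // n _; apply: (@le_trans _ _ (1 + ln (maxn n 1)%:R)); last first.
  by rewrite lerD2l ler_ln ?posrE ?ltr0n ?ler_nat ?leq_max ?orbT// geq_max leqnSn.
elim: n => [|[|n] IH].
- by rewrite big_geq// ln1 addr0.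
- by rewrite big_nat1 invr1 ln1 addr0.
rewrite big_nat_recr//=; apply: le_trans (lerD IH (lexx _)) _.
rewrite -addrA lerD2l !(maxn_idPl _)//.
have := predn_le_expR R (ltn0Sn n.+1); rewrite /= -ler_ln ?posrE ?mulr_gt0 ?expR_gt0 ?ltr0n//.
by rewrite lnM ?posrE ?expR_gt0 ?ltr0n// expRK lerBrDr.
Qed.

Lemma powRN_succ_le (R : realType) (a : R) (k : nat) : 0 < a -> (0 < k)%N ->
  k.+1%:R `^ (- a - 1) <= a^-1 * (k%:R `^ (- a) - k.+1%:R `^ (- a)).
Proof.
move=> a0 k0; have kR : 0 < k%:R :> R by rewrite ltr0n.
have kR1 : 0 < k.+1%:R :> R by rewrite ltr0n.
set y := a / k.+1%:R.
have h : k.+1%:R `^ (- a) * expR y <= k%:R `^ (- a).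
  have -> : k.+1%:R `^ (- a) * expR y = (k.+1%:R * expR (- k.+1%:R^-1)) `^ (- a).
    rewrite powRM ?expR_ge0// powR_expR; congr (_ * expR _); rewrite /y; ring.
  rewrite !powRN lef_pV2 ?posrE ?powR_gt0 ?mulr_gt0 ?expR_gt0//.
  rewrite ge0_ler_powR ?nnegrE ?mulr_ge0 ?expR_ge0 ?(ltW a0)//.
  exact: (predn_le_expR R (ltn0Sn k)).
have ka : 0 < k.+1%:R `^ (- a) :> R by rewrite powR_gt0.
have e3 : k.+1%:R `^ (- a - 1) = k.+1%:R `^ (- a) / k.+1%:R.
  exact: powRB1.
rewrite e3 ler_pdivlMl//.
apply: (@le_trans _ _ (k.+1%:R `^ (- a) * (expR y - 1))); last by rewrite mulrBr mulr1 lerD2r.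
rewrite mulrCA ler_wpM2l ?(ltW ka)//.
by rewrite lerBrDl; exact: expR_ge1Dx.
Qed.

Lemma sum_powR_gt1 (R : realType) (a : R) (n : nat) : 0 < a ->
  \sum_(1 <= k < n) k%:R `^ (- a - 1) <= 1 + a^-1.
Proof.
move=> a0; have ai : 0 < a^-1 by rewrite invr_gt0.
case: n => [|[|n]]; [by rewrite big_geq//; lra|by rewrite big_geq//; lra|].
apply: (@le_trans _ _ (1 + a^-1 * (1 - n.+1%:R `^ (- a)))); last first.
  by rewrite lerD2l ler_piMr ?ltW// lerBlDr lerDl powR_ge0.
elim: n => [|n IH]; first by rewrite big_nat1 !powR1 subrr mulr0 addr0.
rewrite big_nat_recr//=; apply: le_trans (lerD IH (powRN_succ_le a0 (ltn0Sn n))) _.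
rewrite -addrA -mulrDr; set x := _ `^ _; set y := _ `^ _; rewrite lerD2l ler_wpM2l ?(ltW ai)//; lra.
Qed.

Lemma sum_inv_sqr (R : realType) (N n : nat) : (0 < N)%N ->
  \sum_(N <= k < n) (k%:R ^+ 2)^-1 <= 2 / N%:R :> R.
Proof.
move=> N0; have NR : 0 < N%:R :> R by rewrite ltr0n.
have [nN|Nn] := leqP n N; first by rewrite big_geq// divr_ge0// ltW.
apply: (@le_trans _ _ (2 / N%:R - 2 / n%:R)); last by rewrite lerBlDr lerDl divr_ge0.
elim: n Nn => // n IH; rewrite ltnS leq_eqVlt => /predU1P[<-|Nn].
  rewrite big_nat1 -(natr1 N) -subr_ge0.
  have -> : 2 / N%:R - 2 / (N%:R + 1) - (N%:R ^+ 2)^-1 = (N%:R - 1) / (N%:R ^+ 2 * (N%:R + 1)) :> R.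
    by field; rewrite !gt_eqF//; lra.
  by rewrite divr_ge0 ?mulr_ge0 ?sqr_ge0 ?subr_ge0 ?ler1n//; lra.
rewrite big_nat_recr/=; last exact: ltnW.
have nR : 0 < n%:R :> R by rewrite ltr0n (leq_trans N0)// ltnW.
have n1 : 1 <= n%:R :> R by rewrite ler1n (leq_trans N0)// ltnW.
have : (n%:R ^+ 2)^-1 <= 2 / n%:R - 2 / n.+1%:R :> R.
  rewrite -(natr1 n) -subr_ge0.
  have -> : 2 / n%:R - 2 / (n%:R + 1) - (n%:R ^+ 2)^-1 = (n%:R - 1) / (n%:R ^+ 2 * (n%:R + 1)) :> R.
    by field; rewrite !gt_eqF//; lra.
  by rewrite divr_ge0 ?mulr_ge0 ?sqr_ge0 ?subr_ge0//; lra.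
have := IH Nn; set A := 2 / N%:R; set B := 2 / n%:R; set C := 2 / _; set D := _^-1; lra.
Qed.

(** * Pointwise convergence of sine series *)

Lemma normr_phi_le (R : realType) k (x : R) : `|phi k x| <= Num.sqrt 2.
Proof.
by rewrite /phi normrM ger0_norm ?sqrtr_ge0// ler_piMr ?sqrtr_ge0// ler_norml sin_geN1 sin_le1.
Qed.

(** Mode [k] of the difference carries the factor [k / n], so that coefficients of
    order [k^-2] leave a harmonic sum divided by [n].  Bounding [k^-1] by [k^(-1/2)]
    costs half an order, but still tends to zero. *)
Lemma fejer_mean_partial_sum (R : realType) (psi : R -> R) (B x : R) (n : nat) :
  (forall k, (0 < k)%N -> `|inner psi (phi k)| <= B / k%:R ^+ 2) -> (0 < n)%N -> 0 <= B ->
  `|fejer_mean n psi x - \sum_(1 <= k < n) inner psi (phi k) * phi k x| <=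
  3 * (Num.sqrt 2 * B) / Num.sqrt n%:R.
Proof.
move=> hB n0 B0; have nR : 0 < n%:R :> R by rewrite ltr0n.
have s2 : 0 <= Num.sqrt 2 :> R by exact: sqrtr_ge0.
rewrite /fejer_mean -sumrB; apply: le_trans (ler_norm_sum _ _ _) _.
apply: (@le_trans _ _ (\sum_(1 <= k < n) (Num.sqrt 2 * B / n%:R) * k%:R `^ (2^-1 - 1))).
  rewrite big_nat_cond [X in _ <= X]big_nat_cond; apply: ler_sum => k /andP[/andP[k0 kn] _].
  have kR : 0 < k%:R :> R by rewrite ltr0n.
  have -> : (1 - k%:R / n%:R) * (inner psi (phi k) * phi k x) - inner psi (phi k) * phi k x =
     - (k%:R / n%:R) * (inner psi (phi k) * phi k x) by ring.
  rewrite normrM normrN (ger0_norm (divr_ge0 (ltW kR) (ltW nR))) normrM.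
  apply: (@le_trans _ _ (k%:R / n%:R * (B / k%:R ^+ 2 * Num.sqrt 2))).
    apply: ler_wpM2l; first by rewrite divr_ge0// ltW.
    by apply: ler_pM; [| |exact: hB|exact: normr_phi_le].
  have -> : k%:R / n%:R * (B / k%:R ^+ 2 * Num.sqrt 2) = Num.sqrt 2 * B / n%:R * k%:R^-1.
    by field; rewrite !gt_eqF.
  rewrite ler_wpM2l ?divr_ge0 ?mulr_ge0 ?(ltW nR)//.
  have -> : (k%:R : R)^-1 = k%:R `^ (-1) by rewrite powR_inv1// ltW.
  apply: ler_powR; first by rewrite ler1n.
  lra.
rewrite -mulr_sumr.
have h2 : (0 : R) < 2^-1 by rewrite invr_gt0.
apply: le_trans (ler_wpM2l _ (sum_powR_lt1 h2 n0)) _; first by rewrite divr_ge0 ?mulr_ge0 ?(ltW nR).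
rewrite powR12_sqrt ?(ltW nR)//.
have sn : 0 < Num.sqrt n%:R :> R by rewrite sqrtr_gt0.
rewrite -[in X in X / n%:R * _]/(Num.sqrt 2 * B).
have -> : (n%:R : R)^-1 = (Num.sqrt n%:R)^-1 * (Num.sqrt n%:R)^-1.
  by rewrite -invfM -expr2 sqr_sqrtr// ltW.
rewrite le_eqVlt; apply/orP; left; apply/eqP; field; rewrite gt_eqF//.
Qed.

(** Fejer's theorem, together with the decay of the coefficients, which makes the
    Fejer means and the partial sums asymptotically equal. *)
Theorem sine_series_cvg (R : realType) (v : R -> R) (B x : R) :
  {within `[0, 1], continuous v} -> v 0 = 0 -> v 1 = 0 ->
  (forall k, (0 < k)%N -> `|inner v (phi k)| <= B / k%:R ^+ 2) -> 0 <= x <= 1 ->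
  \sum_(1 <= k < n) inner v (phi k) * phi k x @[n --> \oo] --> v x.
Proof.
move=> cv v0 v1 hB x01.
pose w s := v (clamp 1 s).
have cw : continuous w by apply: continuous_clamp.
have wE s : 0 <= s <= 1 -> w s = v s by move=> h; rewrite /w clamp_id.
have iE k : inner v (phi k) = inner w (phi k).
  apply: eq_Rintegral => y; rewrite inE /Omega/= in_itv/= => /andP[y0 y1].
  by rewrite wE// !ltW.
under eq_fun do under eq_bigr do rewrite iE.
have {}hB k : (0 < k)%N -> `|inner w (phi k)| <= B / k%:R ^+ 2 by rewrite -iE; exact: hB.
have B0 : 0 <= B by have := hB 1%N isT; rewrite expr1n divr1; exact: le_trans.
have w0 : w 0 = 0 by rewrite wE// lexx ler01.
have w1 : w 1 = 0 by rewrite wE// lexx ler01.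
rewrite -wE//; apply/cvgrPdist_le => e e0.
have e20 : 0 < e / 2 by rewrite divr_gt0.
have [n0 hn] := fejer_uniform cw w0 w1 e20.
pose K := 3 * (Num.sqrt 2 * B) / (e / 2).
have K0 : 0 <= K by rewrite divr_ge0 ?mulr_ge0 ?sqrtr_ge0// ltW.
exists (maxn n0 (Num.trunc (K ^+ 2)).+1) => // n hn0.
have /andP[nn0 nK] : (n0 <= n)%N && ((Num.trunc (K ^+ 2)).+1 <= n)%N.
  by rewrite -geq_max; exact: hn0.
have n1 : (0 < n)%N by case: n nK {nn0 hn0}.
have nR : 0 < n%:R :> R by rewrite ltr0n.
have sn : 0 < Num.sqrt n%:R :> R by rewrite sqrtr_gt0.
have Kn : K <= Num.sqrt n%:R.
  rewrite -(ger0_norm K0) -sqrtr_sqr; apply: ler_wsqrtr; apply: ltW.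
  by apply: lt_le_trans (truncnS_gt _) _; rewrite ler_nat.
rewrite (splitr e) -(subrKA (fejer_mean n w x)).
apply: le_trans (ler_normD _ _) _; apply: lerD; first exact: hn.
apply: le_trans (fejer_mean_partial_sum x hB n1 B0) _.
by rewrite ler_pdivrMr// [X in _ <= X]mulrC -ler_pdivrMr//.
Qed.

(** * Exchange of real integrals *)

Lemma fine_integrable (R : realType) (D : set (measurableTypeR R))
    (f : measurableTypeR R -> \bar R) : measurable D ->
  mu.-integrable D f ->
  mu.-integrable D (EFin \o (fun x => fine (f x))) /\
  (\int[mu]_(x in D) (fine (f x))%:E = \int[mu]_(x in D) f x)%E.
Proof.
move=> mD fi; have mf : measurable_fun D f by case/integrableP: fi.
have mfine : measurable_fun D (EFin \o (fun x => fine (f x))).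
  apply/measurable_EFinP; apply: (measurableT_comp (fine_measurable measurableT)).
  exact: mf.
split.
  apply: le_integrable fi => // x Dx /=.
  by case: (f x) => [r| |] //=; rewrite ?normr0 ?leey.
apply: ae_eq_integral => //.
have := integrable_ae mD fi; apply: filterS => x h Dx /=.
by rewrite fineK// h.
Qed.

Lemma integrable_fubini_G (R : realType)
    (f : plane R -> \bar R) :
  (mu \x mu)%E.-integrable setT f -> mu.-integrable setT (fubini_G mu f).
Proof.
move=> fi; have mf := measurable_int _ fi.
have mG : measurable_fun setT (fun y => \int[mu]_x `|f (x, y)|)%E.
  by apply: (measurable_fun_fubini_tonelli_G (abse \o f)) => //=; exact: measurableT_comp.
apply/integrableP; split; first exact: measurable_fubini_G fi.
have h := (@integrable21ltyP _ _ _ _ R mu mu f mf).1 fi.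
apply: le_lt_trans h.
apply: ge0_le_integral => //.
- by apply: measurableT_comp => //; exact: measurable_fubini_G fi.
- move=> y _; apply: le_abse_integral => //.
  exact: measurableT_comp.
Qed.

(** The inner integrals are real valued, so they take the value 0 at the points where
    the section is not integrable.  These points form a null set, and the identities
    hold as in the extended real case. *)
Section WeightedFubiniT.
Variables (R : realType) (K : R -> R -> R) (w : R -> R) (M : R).
Hypothesis mK : measurable_fun setT (fun p : plane R => K p.1 p.2).
Hypothesis Kfin : (\int[mu]_x \int[mu]_y `|(K x y)%:E| < +oo)%E.
Hypothesis mw : measurable_fun setT (w : measurableTypeR R -> R).
Hypothesis wM : forall y, `|w y| <= M.

Let f (p : plane R) : \bar R := (K p.1 p.2)%:E.
Let fw (p : plane R) : \bar R := (K p.1 p.2 * w p.2)%:E.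

Let mf : measurable_fun setT f.
Proof. exact/measurable_EFinP. Qed.

Let mfw : measurable_fun setT fw.
Proof.
apply/measurable_EFinP; apply: measurable_funM => //.
by apply: (measurableT_comp mw); exact: measurable_snd.
Qed.

Let fi : (mu \x mu)%E.-integrable setT f.
Proof. exact/integrable12ltyP. Qed.

Let fwi : (mu \x mu)%E.-integrable setT fw.
Proof.
have := integrableZl measurableT M (integrable_abse fi).
apply: le_integrable => // p _ /=.
rewrite lee_fin normrM [X in _ <= X]normrM normr_id mulrC ler_wpM2r//.
exact: le_trans (wM _) (ler_norm _).
Qed.

Lemma fubini_integrableT :
  mu.-integrable setT (EFin \o (fun y => \int[mu]_x K x y)).
Proof.
have [h _] := fine_integrable measurableT (integrable_fubini_G fi).
exact: h.
Qed.

Lemma fubini_weight_integrableT :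
  mu.-integrable setT (EFin \o (fun x => \int[mu]_y (K x y * w y))).
Proof.
have [h _] := fine_integrable measurableT (integrable_fubini_F fwi).
exact: h.
Qed.

Lemma fubini_weightT :
  \int[mu]_x (\int[mu]_y (K x y * w y)) = \int[mu]_y ((\int[mu]_x K x y) * w y).
Proof.
have [_ h1] := fine_integrable measurableT (integrable_fubini_F fwi).
have [_ h2] := fine_integrable measurableT (integrable_fubini_G fwi).
have F := Fubini fwi.
have -> : \int[mu]_x (\int[mu]_y (K x y * w y)) = fine (\int[mu]_x \int[mu]_y fw (x, y))%E.
  by rewrite /Rintegral; congr fine; exact: h1.
rewrite F -h2 /Rintegral; congr fine.
have mw' := fubini_integrableT.
apply: ae_eq_integral => //.
- by case/integrableP: (fine_integrable measurableT (integrable_fubini_G fwi)).1.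
- apply/measurable_EFinP; apply: measurable_funM => //.
  by apply/measurable_EFinP; case/integrableP: mw'.
- have := ae_integrable2 fi; apply: filterS => y iy _.
  by rewrite /fubini_G/= -(RintegralZr (w y) measurableT iy).
Qed.
End WeightedFubiniT.

Section MeasurableSections.
Variables (R : realType) (D1 D2 : set (measurableTypeR R)) (H : R -> R -> R).
Hypotheses (mD1 : measurable D1) (mD2 : measurable D2).
Hypothesis mH : measurable_fun (D1 `*` D2)
  (fun p : plane R => H p.1 p.2).

Let K (p : plane R) : \bar R :=
  (((fun p => H p.1 p.2) \_ (D1 `*` D2)) p)%:E.

Let mK : measurable_fun setT K.
Proof.
by apply/measurable_EFinP/(measurable_restrictT _ _).1 => //; exact: measurableX.
Qed.

Let KE (g : \bar R -> \bar R) x : g 0%E = 0%E -> x \in D1 ->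
  (\int[mu]_y g (K (x, y)) = \int[mu]_(y in D2) g (H x y)%:E)%E.
Proof.
move=> g0 xD; rewrite [RHS]integral_mkcond; apply: eq_integral => y _.
by rewrite /K !patchE in_setX xD /=; case: ifPn.
Qed.

Lemma measurable_integral_norm :
  measurable_fun D1 (fun x => \int[mu]_(y in D2) `|(H x y)%:E|)%E.
Proof.
have := measurable_fun_fubini_tonelli_F (m2 := mu) (abse \o K) _ _.
move=> /(_ (measurableT_comp (@abse_measurable _ setT) mK) (fun _ => abse_ge0 _)).
move/(measurable_funTS (D := D1)); apply: eq_measurable_fun => x xD.
by rewrite /fubini_F /= (KE (g := abse))// abse0.
Qed.

Lemma measurable_Rintegral_section :
  measurable_fun D1 (fun x => \int[mu]_(y in D2) H x y).
Proof.
have m1 := measurable_fun_fubini_tonelli_F (m2 := mu) (K^\+)%E (measurable_funepos mK)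
  (funepos_ge0 _).
have m2 := measurable_fun_fubini_tonelli_F (m2 := mu) (K^\-)%E (measurable_funeneg mK)
  (funeneg_ge0 _).
have m : measurable_fun setT (fun x => \int[mu]_y K (x, y))%E.
  have -> : (fun x => \int[mu]_y K (x, y))%E =
      (fubini_F mu (K^\+)%E \- fubini_F mu (K^\-)%E)%E.
    apply/funext => x; rewrite [LHS]integralE.
    rewrite /fubini_F /=; congr (_ - _)%E.
      by apply: eq_integral => y _; rewrite funepos_comp.
    by apply: eq_integral => y _; rewrite funeneg_comp.
  exact: emeasurable_funB.
have := measurable_funTS (D := D1) (measurableT_comp (fine_measurable measurableT) m).
by apply: eq_measurable_fun => x xD; rewrite /= (KE (g := idfun)).
Qed.

End MeasurableSections.

Section WeightedFubini.
Variables (R : realType) (D1 D2 : set (measurableTypeR R)) (H : R -> R -> R) (w : R -> R) (M : R).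
Hypotheses (mD1 : measurable D1) (mD2 : measurable D2).
Hypothesis mH : measurable_fun (D1 `*` D2)
  (fun p : plane R => H p.1 p.2).
Hypothesis Hfin : (\int[mu]_(x in D1) \int[mu]_(y in D2) `|(H x y)%:E| < +oo)%E.
Hypothesis mw : measurable_fun D2 (w : measurableTypeR R -> R).
Hypothesis wM : forall y, D2 y -> `|w y| <= M.

Let K (x y : R) := ((fun p => H p.1 p.2) \_ (D1 `*` D2)) (x, y).
Let w' := w \_ D2.

Let KE x y : K x y = if (x \in D1) && (y \in D2) then H x y else 0.
Proof. by rewrite /K patchE in_setX. Qed.

Let mK : measurable_fun setT (fun p : plane R => K p.1 p.2).
Proof.
have -> : (fun p => K p.1 p.2) = ((fun p => H p.1 p.2) \_ (D1 `*` D2)).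
  by apply/funext => -[].
by apply/(measurable_restrictT _ _).1 => //; exact: measurableX.
Qed.

Let Kfin : (\int[mu]_x \int[mu]_y `|(K x y)%:E| < +oo)%E.
Proof.
move: Hfin; rewrite integral_mkcond; congr (_ < _)%E; apply: eq_integral => x _.
rewrite patchE; case: ifPn => xD; last first.
  rewrite (eq_integral (cst 0%E)) ?integral0// => y _.
  by rewrite KE (negbTE xD) abse0.
rewrite integral_mkcond; apply: eq_integral => y _.
by rewrite patchE KE xD; case: ifPn => //; rewrite abse0.
Qed.

Let mw' : measurable_fun setT (w' : measurableTypeR R -> R).
Proof. exact/(measurable_restrictT _ _).1. Qed.

Let w'M y : `|w' y| <= Num.max M 0.
Proof.
rewrite /w' patchE; case: ifPn => [/set_mem yD|_]; first by rewrite le_max wM.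
by rewrite normr0 le_max lexx orbT.
Qed.

Let intK y : y \in D2 -> \int[mu]_x K x y = \int[mu]_(x in D1) H x y.
Proof.
move=> yD; rewrite [RHS]Rintegral_mkcond; apply: eq_Rintegral => x _.
by rewrite KE yD andbT patchE.
Qed.

Let intKw x : x \in D1 -> \int[mu]_y (K x y * w' y) = \int[mu]_(y in D2) (H x y * w y).
Proof.
move=> xD; rewrite [RHS]Rintegral_mkcond; apply: eq_Rintegral => y _.
by rewrite KE xD /w' !patchE /=; case: (y \in D2) => //; rewrite mul0r.
Qed.

Lemma fubini_integrable :
  mu.-integrable D2 (EFin \o (fun y => \int[mu]_(x in D1) H x y)).
Proof.
have := integrableS measurableT mD2 (@subsetT _ D2) (fubini_integrableT mK Kfin).
by apply: eq_integrable => // y yD /=; rewrite intK.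
Qed.

Lemma fubini_weight_integrable :
  mu.-integrable D1 (EFin \o (fun x => \int[mu]_(y in D2) (H x y * w y))).
Proof.
have := integrableS measurableT mD1 (@subsetT _ D1) (fubini_weight_integrableT mK Kfin mw' w'M).
by apply: eq_integrable => // x xD /=; rewrite intKw.
Qed.

Lemma fubini_weight :
  \int[mu]_(x in D1) (\int[mu]_(y in D2) (H x y * w y)) =
  \int[mu]_(y in D2) ((\int[mu]_(x in D1) H x y) * w y).
Proof.
transitivity (\int[mu]_x (\int[mu]_y (K x y * w' y))).
  rewrite Rintegral_mkcond; apply: eq_Rintegral => x _; rewrite patchE.
  case: ifPn => [xD|xD]; first by rewrite intKw.
  apply/esym; transitivity (\int[mu]_y (0 : R)); last by rewrite (Rintegral_cst mu measurableT) mul0r.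
  by apply: eq_Rintegral => y _; rewrite KE (negbTE xD) mul0r.
rewrite (fubini_weightT mK Kfin mw' w'M).
rewrite [RHS]Rintegral_mkcond; apply: eq_Rintegral => y _; rewrite patchE /w' patchE.
by case: ifPn => [yD|yD]; rewrite ?mulr0// intK.
Qed.
End WeightedFubini.

(** * Square integrable functions and the Laplacian *)

Lemma sqrte_lty (R : realType) (x : \bar R) : (0 <= x)%E -> (sqrte x < +oo)%E -> (x < +oo)%E.
Proof. by case: x => //= r _ _; exact: ltry. Qed.

Lemma inL2_sqr_lty (R : realType) (v : R -> R) : inL2 v ->
  (\int[mu]_(x in Omega) ((v x) ^+ 2)%:E < +oo)%E.
Proof.
by move=> [_]; apply: sqrte_lty; apply: integral_ge0 => x _; rewrite lee_fin sqr_ge0.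
Qed.

Lemma inL2_sqr_integrable (R : realType) (v : R -> R) : inL2 v ->
  mu.-integrable Omega (EFin \o (fun x => v x ^+ 2)).
Proof.
move=> v2; have [mv _] := v2; apply/integrableP; split.
  by apply/measurable_EFinP; exact: measurable_funX.
under eq_integral do rewrite /= ger0_norm ?sqr_ge0//.
exact: inL2_sqr_lty.
Qed.

Lemma inL2_integrable (R : realType) (v : R -> R) : inL2 v ->
  mu.-integrable Omega (EFin \o v).
Proof.
move=> v2; have [mv _] := v2; have mO := @measurable_Omega R.
have i1 : mu.-integrable Omega (EFin \o (fun _ : R => 1 : R)).
  by apply: continuous_Omega_integrable => x; exact: cvg_cst.
have := integrable_add mO i1 (inL2_sqr_integrable v2).
apply: le_integrable => //; first exact/measurable_EFinP.
move=> x _ /=; rewrite lee_fin; apply: le_trans (ler_norm _).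
have h : v x ^+ 2 = `|v x| ^+ 2 by rewrite real_normK ?num_real.
by rewrite h; have := sqr_ge0 (`|v x| - 1); move: `|v x| => a ha; nra.
Qed.

Lemma integrable_oo_cc (R : realType) (a b : R) (f : R -> R) :
  mu.-integrable `]a, b[ (EFin \o f) -> mu.-integrable `[a, b] (EFin \o f).
Proof.
move=> /integrableP[mf fi]; have mf' : measurable_fun `]a, b[ f by exact/measurable_EFinP.
apply/integrableP; split.
  by apply/measurable_EFinP; exact: measurable_fun_itv_cc mf'.
rewrite (integral_itv_bndoo true false)//.
exact: measurableT_comp.
Qed.

Section NegLaplacian.
Variables (R : realType) (w : R -> R) (k : nat).
Hypothesis w2 : inL2 w.
Let c : R := k%:R * pi.
Let dphi (x : R) : R := Num.sqrt 2 * c * cos (c * x).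

Let mO := @measurable_Omega R.
Let wi : mu.-integrable Omega (EFin \o w) := inL2_integrable w2.
Let wi' : mu.-integrable `[0, 1] (EFin \o w).
Proof. exact: integrable_oo_cc wi. Qed.

Let is_derive_phi (x : R) : is_derive x 1 (phi k) (dphi x).
Proof.
have D2 := is_derive1_comp (is_derive_sin (c * x)) (is_derive_lin c x).
rewrite /phi /dphi; apply: is_derive_eq; rewrite /GRing.scale/=; ring.
Qed.

Let cdphi : continuous dphi.
Proof.
apply: continuous_mul_fun; first exact: continuous_cst_fun.
by apply: continuous_cos_arg; exact: continuous_lin.
Qed.

Let is_derive_dphi (x : R) : is_derive x 1 dphi (- (c ^+ 2 * phi k x)).
Proof.
have D2 := is_derive1_comp (is_derive_cos (c * x)) (is_derive_lin c x).
rewrite /phi /dphi; apply: is_derive_eq; rewrite /GRing.scale/= -/c; ring.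
Qed.

Let P (x : R) := - \int[mu]_(y in `[0, x]) w y.

Let cP : {within `[0, 1], continuous P}.
Proof.
have h := parameterized_integral_continuous ler01 wi'.
by move=> x; apply: cvgN; exact: h.
Qed.

Let H (y z : R) : R := if z < y then w y else 0.

Let mH : measurable_fun (@Omega R `*` @Omega R : set (plane R))
   (fun p : plane R => H p.1 p.2).
Proof.
have [mw _] := w2.
apply: measurable_fun_if => //.
- exact: measurableX.
- by apply: measurable_fun_ltr; apply: measurable_funTS; [exact: measurable_snd|exact: measurable_fst].
- apply: (@measurable_funS _ _ _ _ (Omega `*` Omega)); [exact: measurableX|by move=> x []|].
  apply: (measurable_comp mO) => //; first by move=> _ [p [Op _] <-].
  by apply: measurable_funTS; exact: measurable_fst.
Qed.

Let Hfin : (\int[mu]_(y in Omega) \int[mu]_(z in Omega) `|(H y z)%:E| < +oo)%E.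
Proof.
case/integrableP: wi => mw; apply: le_lt_trans; apply: ge0_le_integral => //.
- by move=> y _; exact: integral_ge0.
- exact: measurable_integral_norm mO mO mH.
- exact: measurableT_comp.
move=> y Oy.
apply: (@le_trans _ _ (\int[mu]_(z in Omega) (cst `|(EFin \o w) y|%E) z)%E).
  apply: ge0_le_integral => //.
  - apply/measurable_EFinP; apply: (measurableT_comp (@normr_measurable R setT)).
    by apply: measurable_funTS; apply: measurable_fun_ifT => //; apply: measurable_fun_ltr.
  - move=> z _; by rewrite /H /= lee_fin; case: ifP => // _; rewrite normr0.
rewrite integral_cst//.
by rewrite [X in (_ * X)%E](_ : _ = 1%:E) ?mule1//; exact: lebesgue_Omega.
Qed.

(** Since [w] is only integrable, the first integration by parts is an exchange of
    integrals over the triangle [z < y]. *)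
Lemma inner_eq_parts : inner w (phi k) = \int[mu]_(z in Omega) ((P z - P 1) * dphi z).
Proof.
have [M dM] : exists M, forall x : R, 0 <= x <= 1 -> `|dphi x| <= M.
  by apply: segment_bounded; exact: continuous_subspaceT.
have md : measurable_fun Omega (dphi : measurableTypeR R -> R).
  by apply: measurable_funTS; exact: continuous_measurable_fun.
have dM' y : Omega y -> `|dphi y| <= M.
  by rewrite /Omega/= in_itv/= => /andP[y0 y1]; apply: dM; rewrite !ltW.
have := fubini_weight mO mO mH Hfin md dM'.
have -> : \int[mu]_(y in Omega) (\int[mu]_(z in Omega) (H y z * dphi z)) = inner w (phi k).
  apply: eq_Rintegral => y; rewrite inE /Omega/= in_itv/= => /andP[y0 y1].
  transitivity (\int[mu]_(z in `]0, y[) (w y * dphi z)).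
    rewrite [LHS]Rintegral_mkcond [RHS]Rintegral_mkcond; apply: eq_Rintegral => z _.
    rewrite !patchE !mem_setE !in_itv/= /H.
    case: (ltP z y) => zy; first by rewrite (lt_trans zy y1).
    by rewrite mul0r if_same andbF.
  have di : mu.-integrable `[0, y] (EFin \o dphi).
    by apply: within_integrable; exact: continuous_subspaceT.
  rewrite RintegralZl//; last first.
    by apply: integrableS di => //; exact: subset_itv_oo_cc.
  rewrite Rintegral_oo_cc//; congr (_ * _).
  have -> : \int[mu]_(z in `[0, y]) dphi z = phi k y - phi k 0.
    apply: Rintegral_FTC2; [exact: ltW|exact: continuous_subspaceT| |].
      by apply: continuous_subspaceT; exact: continuous_phi.
    by move=> z _; exact: is_derive_phi.
  by rewrite /phi mulr0 sin0 mulr0 subr0.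
move=> ->; apply: eq_Rintegral => z; rewrite inE /Omega/= in_itv/= => /andP[z0 z1].
congr (_ * _).
transitivity (\int[mu]_(y in `]z, 1]) w y).
  rewrite -Rintegral_itv_bndo_bndc; last first.
    by apply: integrableS wi => //; apply: subset_itvr; rewrite bnd_simp ltW.
  rewrite [LHS]Rintegral_mkcond [RHS]Rintegral_mkcond; apply: eq_Rintegral => y _.
  rewrite !patchE !mem_setE !in_itv/= /H.
  case: (ltP z y) => zy /=; last by rewrite if_same.
  by rewrite (lt_trans z0 zy).
by rewrite /P opprK addrC Rintegral_itvB ?bnd_simp// ltW.
Qed.

Lemma inner_of_antiderivative (v p : R -> R) :
  (forall x, 0 <= x <= 1 -> v x = v 0 + \int[mu]_(y in `[0, x]) p y /\
    p x = p 0 - \int[mu]_(y in `[0, x]) w y) ->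
  v 0 = 0 -> v 1 = 0 -> inner w (phi k) = c ^+ 2 * inner v (phi k).
Proof.
move=> vp v0 v1; rewrite inner_eq_parts.
pose Q x := p 0 + P x.
have cQ : {within `[0, 1], continuous Q}.
  by move=> x; apply: cvgD; [exact: cvg_cst|exact: cP].
have pQ x : 0 <= x <= 1 -> p x = Q x by move=> /vp[].
have Qi := within_integrable cQ.
pose V x := \int[mu]_(y in `[0, x]) Q y.
have vV x : 0 <= x <= 1 -> v x = V x.
  move=> x01; rewrite (vp x x01).1 v0 add0r; apply: eq_Rintegral => y.
  by rewrite inE /= in_itv/= => y0x; apply: pQ; lra.
have VD (x : R) : 0 < x < 1 -> is_derive x 1 V (Q x).
  move=> /andP[x0 x1].
  have cx : {for x, continuous Q}.
    by apply: (within_continuous_continuous ltr01 cQ); rewrite in_itv/= x0.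
  have [d e] := continuous_FTC1_closed x1 Qi x0 cx.
  by split; [exact: d|rewrite -derive1E; exact: e].
have cV : {within `[0, 1], continuous V} := parameterized_integral_continuous ler01 Qi.
have cdphi' : {within `[0, 1], continuous dphi} by exact: continuous_subspaceT.
have cphi : {within `[0, 1], continuous (phi k : R -> R)}.
  by apply: continuous_subspaceT; exact: continuous_phi.
have Z : 0 <= (0 : R) <= 1 by rewrite lexx ler01.
have O : 0 <= (1 : R) <= 1 by rewrite lexx ler01.
have phi01 : phi k (1 : R) - phi k 0 = 0.
  by rewrite /phi mulr1 mulr0 sin_natpi sin0 !mulr0 subrr.
have di : mu.-integrable `[0, 1] (EFin \o dphi) by exact: within_integrable.
have Qd : mu.-integrable `[0, 1] (EFin \o (fun z => Q z * dphi z)).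
  by apply: within_integrable => x; apply: cvgM; [exact: cQ|exact: cdphi'].
have m01 : measurable (`[0, 1]%classic : set (measurableTypeR R)) by exact: measurable_itv.
transitivity (\int[mu]_(z in `[0, 1]) (Q z * dphi z - Q 1 * dphi z)).
  rewrite -Rintegral_oo_cc; last first.
    by apply: integrable_sub => //; exact: integrable_scale.
  by apply: eq_Rintegral => z _; rewrite /Q; ring.
rewrite RintegralB//; last exact: integrable_scale.
rewrite RintegralZl//.
have -> : \int[mu]_(z in `[0, 1]) dphi z = phi k 1 - phi k 0.
  by apply: Rintegral_FTC2 => // z _; exact: is_derive_phi.
rewrite phi01 mulr0 subr0.
have cf : {within `[0, 1], continuous (fun x => - (c ^+ 2 * phi k x))}.
  by move=> x; apply: cvgN; apply: cvgM; [exact: cvg_cst|exact: cphi].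
transitivity (\int[mu]_(z in `[0, 1]) (dphi z * Q z)).
  by apply: eq_Rintegral => z _; rewrite mulrC.
rewrite (Rintegral_parts ler01 cf cdphi' cQ cV (fun x _ => is_derive_dphi x) VD).
rewrite -!vV// v0 v1 !mulr0 subrr sub0r.
have iVphi : mu.-integrable `[0, 1] (EFin \o (fun x => V x * phi k x)).
  by apply: within_integrable => x; apply: cvgM; [exact: cV|exact: cphi].
transitivity (- \int[mu]_(x in `[0, 1]) ((- c ^+ 2) * (V x * phi k x))).
  by congr (- _); apply: eq_Rintegral => x _; ring.
rewrite RintegralZl// mulNr opprK -Rintegral_oo_cc//; congr (_ * _).
apply: eq_Rintegral => x; rewrite inE /= in_itv/= => /andP[x0 x1].
by rewrite vV// !ltW.
Qed.

End NegLaplacian.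

Lemma neg_laplacian_inner (R : realType) (v w : R -> R) (k : nat) :
  neg_laplacian v w -> v 0 = 0 -> v 1 = 0 ->
  inner w (phi k) = lambda_ R k * inner v (phi k).
Proof.
move=> [w2 [p vp]] v0 v1; rewrite (inner_of_antiderivative k w2 vp v0 v1).
by rewrite /lambda_ exprMn.
Qed.

(** * Sine coefficients of the solution *)

(** An open set of the plane is the union of the countably many rational boxes that
    it contains. *)
Lemma open_prod_measurable (R : realType) (O : set (R * R)) : open O ->
  measurable (O : set (plane R)).
Proof.
move=> oO.
pose B (q : rat * rat) : set (measurableTypeR R) := ball (ratr q.1 : R) (ratr q.2).
have mB q : measurable (B q) by exact: measurable_ball.
pose F (q : (rat * rat) * (rat * rat)) : set (plane R) :=
  if `[< B q.1 `*` B q.2 `<=` O >] then B q.1 `*` B q.2 else set0.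
have -> : O = \bigcup_q F q.
  apply/seteqP; split => [[x y] Oxy|[x y] [q _]]; last first.
    by rewrite /F; case: asboolP => // h; exact: h.
  have [[U V] /= [Ux Vy] UVO] := open_nbhs_nbhs (conj oO Oxy).
  move: Ux Vy; rewrite !nbhsE => -[U' [oU' U'x] U'U] [V' [oV' V'y] V'V].
  have [c1 [r1 [/set_mem xB BU]]] := open_subball_rat oU' (mem_set U'x).
  have [c2 [r2 [/set_mem yB BV]]] := open_subball_rat oV' (mem_set V'y).
  exists ((c1, r1), (c2, r2)) => //; rewrite /F; case: asboolP => //=.
  move=> []; move=> [x' y'] [/= x'B y'B]; apply: UVO.
  by split; [apply: U'U; exact: BU|apply: V'V; exact: BV].
apply: countable_bigcupT_measurable; first exact: countableP.
move=> q; rewrite /F; case: asboolP => // _.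
exact: measurableX.
Qed.

Lemma continuous_measurable_fun2 (R : realType) (D : set (R * R)) (f : R * R -> R) : open D ->
  (forall p, D p -> {for p, continuous f}) ->
  measurable_fun (D : set (plane R)) (f : _ -> R).
Proof.
move=> oD cf; apply: (measurability _ (RGenOpens.measurableE R)).
move=> _ [_ [a [b ->] <-]].
have -> : D `&` f @^-1` `]a, b[ = D `&` f @^-1` `]a, b[ by [].
apply: open_prod_measurable.
rewrite openE => p [Dp fp].
have nD : nbhs p D by exact: open_nbhs_nbhs.
have : nbhs p (f @^-1` `]a, b[).
  by apply: cf => //; apply: open_nbhs_nbhs; split => //; exact: interval_open.
by move: nD; exact: filterI.
Qed.

Lemma L1_le_normL2 (R : realType) (v : R -> R) (e : R) :
  measurable_fun Omega v -> (normL2 v <= e%:E)%E ->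
  \int[mu]_(x in Omega) `|v x| <= e.
Proof.
move=> mv ve; have v2 : inL2 v by split=> //; exact: le_lt_trans ve (ltry _).
have mO := @measurable_Omega R.
have vi := inL2_integrable v2; have v2i := inL2_sqr_integrable v2.
have ai := integrable_normr mO vi.
set m := \int[mu]_(x in Omega) `|v x|.
have m0 : 0 <= m by apply: Rintegral_ge0.
have oneI (c : R) : mu.-integrable Omega (EFin \o (fun _ : R => c)).
  by apply: continuous_Omega_integrable => x; exact: cvg_cst.
have key : m ^+ 2 <= \int[mu]_(x in Omega) v x ^+ 2.
  have : 0 <= \int[mu]_(x in Omega) (v x ^+ 2 - 2 * m * `|v x| + m ^+ 2).
    apply: Rintegral_ge0 => x _.
    have -> : v x ^+ 2 - 2 * m * `|v x| + m ^+ 2 = (`|v x| - m) ^+ 2.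
      by rewrite sqrrB real_normK ?num_real//; ring.
    exact: sqr_ge0.
  have i2 := integrable_scale (2 * m) mO ai.
  rewrite RintegralD//; last exact: integrable_sub.
  rewrite RintegralB// RintegralZl// Rintegral_Omega_cst -/m.
  move: (Rintegral _ _ _) => I h.
  have -> : m ^+ 2 = I - (I - 2 * m * m + m ^+ 2) by ring.
  by rewrite lerBlDr lerDl.
have e0 : 0 <= e by rewrite -lee_fin (le_trans _ ve)// sqrte_ge0.
rewrite -(ler_pXn2r (ltn0Sn 1)) ?nnegrE//; apply: le_trans key _.
rewrite -lee_fin /Rintegral fineK; last exact: integrable_fin_num v2i.
rewrite -lee_sqrt; last by rewrite lee_fin sqr_ge0.
by rewrite [X in (_ <= X)%E]/= sqrtr_sqr ger0_norm.
Qed.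

Lemma inner_norm_le (R : realType) (v : R -> R) (k : nat) :
  mu.-integrable Omega (EFin \o v) ->
  `|inner v (phi k)| <= Num.sqrt 2 * \int[mu]_(x in Omega) `|v x|.
Proof.
move=> vi; have mO := @measurable_Omega R.
have i1 := continuous_mul_integrable vi (@continuous_phi R k).
have ai := integrable_normr mO vi.
apply: le_trans (le_normr_Rintegral mO i1) _.
rewrite -RintegralZl//; apply: le_Rintegral => //.
- exact: integrable_normr mO i1.
- exact: integrable_scale.
- by move=> x _; rewrite normrM mulrC ler_wpM2r// normr_phi_le.
Qed.

Lemma inner_sub (R : realType) (v w : R -> R) (k : nat) :
  mu.-integrable Omega (EFin \o v) -> mu.-integrable Omega (EFin \o w) ->
  inner (fun x => v x - w x) (phi k) = inner v (phi k) - inner w (phi k).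
Proof.
move=> vi wi; have mO := @measurable_Omega R.
have i1 := continuous_mul_integrable vi (@continuous_phi R k).
have i2 := continuous_mul_integrable wi (@continuous_phi R k).
rewrite /inner -RintegralB//; apply: eq_Rintegral => x _; ring.
Qed.

Lemma inner_scale (R : realType) (c : R) (v : R -> R) (k : nat) :
  mu.-integrable Omega (EFin \o v) ->
  inner (fun x => c * v x) (phi k) = c * inner v (phi k).
Proof.
move=> vi; have mO := @measurable_Omega R.
have i1 := continuous_mul_integrable vi (@continuous_phi R k).
rewrite /inner -RintegralZl//; apply: eq_Rintegral => x _; ring.
Qed.

Lemma continuous_within_eps (R : realType) (T : R) (f : R -> R) :
  (forall t0 e, 0 <= t0 <= T -> 0 < e -> exists2 d, 0 < d &
     forall t, 0 <= t <= T -> `|t - t0| < d -> `|f t - f t0| <= e) ->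
  {within `[0, T], continuous f}.
Proof.
move=> h; apply/subspace_continuousP => t0; rewrite /= in_itv/= => t0T.
apply/cvgrPdist_le => e e0; have [d d0 hd] := h t0 e t0T e0.
apply/nbhs_ballP; exists d => // t; rewrite /ball/= => tt0; rewrite in_itv/= => tT.
by rewrite distrC; apply: hd; rewrite 1?distrC.
Qed.

Section Slices.
Variables (R : realType) (T : R) (u : R -> R -> R).
Hypothesis cu : {within `]0, T] `*` `[0, 1], continuous (fun p : R * R => u p.1 p.2)}.

Lemma slice_local (t0 x0 e : R) : 0 < t0 <= T -> 0 <= x0 <= 1 -> 0 < e ->
  exists2 r, 0 < r & forall t x, 0 < t <= T -> 0 <= x <= 1 ->
    `|t - t0| < r -> `|x - x0| < r -> `|u t x - u t0 x0| < e.
Proof.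
move=> tT x01 e0; move/subspace_continuousP : cu => /(_ (t0, x0)).
move=> /(_ _)/cvgrPdist_lt => /(_ _ e e0).
have Dp : (`]0, T] `*` `[0, 1]) (t0, x0) by split; rewrite /= in_itv.
move=> /(_ Dp) /nbhs_ballP[r r0 rP]; exists r => // t x tT' x01' tr xr.
rewrite distrC; apply: (rP (t, x)); last by split; rewrite /= in_itv.
by split; rewrite /ball/= distrC.
Qed.

Lemma slice_uniform (t0 e : R) : 0 < t0 <= T -> 0 < e ->
  exists2 d, 0 < d & forall t, 0 < t <= T -> `|t - t0| < d ->
    forall x, 0 <= x <= 1 -> `|u t x - u t0 x| < e.
Proof.
move=> tT e0; have cA := (compact_near_coveringP (`[0, 1]%classic : set R)).1 (@segment_compact R 0 1).
pose P (d x : R) := forall t, 0 < t <= T -> 0 <= x <= 1 -> `|t - t0| < d -> `|u t x - u t0 x| < e.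
have H : \forall d \near (0:R)^'+, (`[0, 1]%classic : set R) `<=` P d.
  apply: cA => x0; rewrite /= in_itv/= => x01.
  have e2 : 0 < e / 2 by rewrite divr_gt0.
  have [r r0 rP] := slice_local tT x01 e2.
  exists (ball x0 r, [set d | d < r]); first by split=> /=; [exact: nbhsx_ballx|exact: nbhs_right_lt].
  move=> [x d] /= [xr dr] t tT' x01' td.
  rewrite (splitr e) -(subrKA (u t0 x0)) (le_lt_trans (ler_normD _ _))// ltrD//.
    by apply: rP => //; [exact: lt_trans dr|rewrite distrC].
  by rewrite distrC; apply: rP => //; [rewrite subrr normr0|rewrite distrC].
have [d [d0 dP]] : exists d : R, 0 < d /\ (`[0, 1]%classic : set R) `<=` P d.
  near (0:R)^'+ => d; exists d; split; first by near: d; exact: nbhs_right_gt.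
  by near: d; exact: H.
exists d => // t tT' td x x01; apply: dP => //.
Unshelve. all: by end_near. Qed.

Lemma slice_continuous (t : R) : 0 < t <= T -> {within `[0, 1], continuous (u t)}.
Proof.
move=> tT; apply: continuous_within_eps => x0 e x01 e0.
have [r r0 rP] := slice_local tT x01 e0; exists r => // x x01' xr.
by apply/ltW/rP => //; rewrite subrr normr0.
Qed.

Lemma slice_measurable (t : R) : 0 < t <= T ->
  measurable_fun (`]0, t[ `*` Omega : set (plane R))
    (fun p : plane R => u p.1 p.2).
Proof.
move=> /andP[t0 tT].
have oD : open (`]0, t[ `*` (@Omega R) : set (R * R)).
  rewrite openE => -[s x] [/= s0t x01].
  exists (`]0, t[%classic, @Omega R) => //; split; apply: open_nbhs_nbhs; split => //; exact: interval_open.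
apply: (continuous_measurable_fun2 oD (f := fun p : R * R => u p.1 p.2)).
move=> p Dp; move/subspace_continuousP : cu => /(_ p).
case: p Dp => s x [/=]; rewrite /Omega /= !in_itv/= => /andP[s0 st] /andP[x0 x1].
have Dp : (`]0, T] `*` `[0, 1]) (s, x).
  by split; rewrite /= in_itv/= ?s0 ?(ltW x0) ?(ltW x1)//=; exact: le_trans (ltW st) tT.
move=> /(_ Dp) c A /c; rewrite /within/= => h.
have n : nbhs ((s, x) : R * R) (`]0, t[ `*` (@Omega R)).
  by apply: open_nbhs_nbhs; split => //; split; rewrite /Omega/= in_itv/= ?s0 ?x0.
move: n h; apply: filterS2 => -[s' x'] [/=]; rewrite /Omega/= !in_itv/= => /andP[s0' st'] /andP[x0' x1'] h.
apply: h; split; rewrite /= ?in_itv/= ?s0' ?(ltW x0') ?(ltW x1')//=.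
exact: le_trans (ltW st') tT.
Qed.

End Slices.

Section SolutionCoefficients.
Variables (R : realType) (T alpha : R) (u : R -> R -> R).
Hypothesis T0 : 0 < T.
Hypothesis a01 : 0 < alpha < 1.
Hypothesis cu : {within `]0, T] `*` `[0, 1], continuous (fun p : R * R => u p.1 p.2)}.
Hypothesis u_init : forall x, Omega x -> u 0 x = 0.
Hypothesis u_lim : normL2 (u t) @[t --> 0^'+] --> 0%E.

Let mO := @measurable_Omega R.

Lemma slice_integrable (t : R) : 0 <= t <= T -> mu.-integrable Omega (EFin \o u t).
Proof.
move=> /andP[]; rewrite le_eqVlt => /predU1P[<- _|t0 tT].
  apply: (eq_integrable mO) (integrable0 mu Omega) => x; rewrite inE => /u_init /= ->.
  by [].
by apply: Omega_integrable; apply: (slice_continuous cu); rewrite t0.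
Qed.

Lemma slice_measurable1 (t : R) : 0 < t <= T -> measurable_fun Omega (u t).
Proof.
move=> /andP[t0 tT]; have := @slice_integrable t; rewrite (ltW t0) tT => /(_ isT).
by case/integrableP => /measurable_EFinP.
Qed.

(** At positive times by continuity up to the boundary, at time 0 by the initial
    condition in L^2. *)
Lemma slice_L1_continuous (t0 e : R) : 0 <= t0 <= T -> 0 < e ->
  exists2 d, 0 < d & forall t, 0 <= t <= T -> `|t - t0| < d ->
    \int[mu]_(x in Omega) `|u t x - u t0 x| <= e.
Proof.
move=> /andP[]; rewrite le_eqVlt => /predU1P[<- _|t00 t0T] e0.
  have z0 t : \int[mu]_(x in Omega) `|u t x - u 0 x| = \int[mu]_(x in Omega) `|u t x|.
    by apply: eq_Rintegral => x; rewrite inE => /u_init ->; rewrite subr0.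
  have : \forall t \near (0:R)^'+, (normL2 (u t) < e%:E)%E.
    suff : nbhs (0%E : \bar R) [set x | (x < e%:E)%E] by move=> /u_lim.
    apply: open_nbhs_nbhs; split; first exact: open_ereal_lt_ereal.
    by rewrite /= lte_fin.
  rewrite /at_right near_withinE => /nbhs_ballP[d /= d0 dP]; exists d => // t tT td.
  rewrite z0; have /andP[] := tT; rewrite le_eqVlt => /predU1P[<- _|tp tT'].
    have -> : \int[mu]_(x in Omega) `|u 0 x| = \int[mu]_(x in Omega) (fun=> 0) x.
      by apply: eq_Rintegral => x; rewrite inE => /u_init ->; rewrite normr0.
    by rewrite (Rintegral_cst mu mO) mul0r ltW.
  apply: L1_le_normL2; first by apply: slice_measurable1; rewrite tp.
  by apply/ltW/dP => //; rewrite /ball/= distrC.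
have [d d0 hd] := slice_uniform cu (introT andP (conj t00 t0T)) e0.
exists (Num.min d t0); first by rewrite lt_min d0.
move=> t /andP[_ tT]; rewrite lt_min => /andP[td tt0].
have tp : 0 < t by move: tt0; rewrite ltr_norml => /andP[+ _]; rewrite ltrBrDl subrr.
have i1 : mu.-integrable Omega (EFin \o (fun x => u t x - u t0 x)).
  by apply: integrable_sub => //; apply: slice_integrable; rewrite ?(ltW tp) ?(ltW t00).
have ic : mu.-integrable Omega (EFin \o (fun _ : R => e)).
  by apply: continuous_Omega_integrable => x; exact: cvg_cst.
apply: (@le_trans _ _ (\int[mu]_(x in Omega) (fun=> e) x)).
  apply: le_Rintegral => //; first exact: integrable_normr.
  move=> x; rewrite /Omega/= in_itv/= => /andP[x0 x1].
  by apply: ltW; apply: hd => //; rewrite ?tp// !ltW.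
by rewrite (Rintegral_cst mu mO) [X in fine X]lebesgue_Omega mulr1.
Qed.

Lemma coef_continuous k : {within `[0, T], continuous (fun t => inner (u t) (phi k))}.
Proof.
apply: continuous_within_eps => t0 e t0T e0.
have s2 : 0 < Num.sqrt 2 :> R by rewrite sqrtr_gt0.
have [d d0 hd] := slice_L1_continuous t0T (divr_gt0 e0 s2).
exists d => // t tT td; rewrite -inner_sub; [|exact: slice_integrable..].
apply: le_trans (inner_norm_le _ _) _.
  by apply: integrable_sub => //; exact: slice_integrable.
by rewrite mulrC -ler_pdivlMr//; exact: hd.
Qed.

Lemma coef_init k : inner (u 0) (phi k) = 0.
Proof.
have -> : inner (u 0) (phi k) = \int[mu]_(x in Omega) (fun=> 0) x.
  by apply: eq_Rintegral => x; rewrite inE => /u_init ->; rewrite mul0r.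
by rewrite (Rintegral_cst mu mO) mul0r.
Qed.

Lemma slice_L1_bounded : exists2 B, 0 <= B & forall t, 0 <= t <= T ->
  \int[mu]_(x in Omega) `|u t x| <= B.
Proof.
have c : {within `[0, T], continuous (fun t => \int[mu]_(x in Omega) `|u t x|)}.
  apply: continuous_within_eps => t0 e t0T e0.
  have [d d0 hd] := slice_L1_continuous t0T e0.
  exists d => // t tT td; apply: le_trans (hd t tT td).
  have i1 := slice_integrable tT; have i2 := slice_integrable t0T.
  have n1 := integrable_normr mO i1; have n2 := integrable_normr mO i2.
  rewrite -RintegralB//.
  have i3 := integrable_sub mO n1 n2.
  apply: le_trans (le_normr_Rintegral mO i3) _; apply: le_Rintegral => //.
  - exact: integrable_normr.
  - by apply: integrable_normr => //; exact: integrable_sub.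
  - by move=> x _; exact: ler_dist_dist.
have [t tT tmax] := EVT_max (ltW T0) c.
exists (\int[mu]_(x in Omega) `|u t x|); first exact: Rintegral_ge0.
by move=> s sT; apply: tmax; rewrite in_itv.
Qed.

Section Kernel.
Variable t : R.
Hypothesis tT : 0 < t <= T.

Let H (s x : R) := (t - s) `^ (- alpha) * u s x.

Let mt : measurable (`]0, t[%classic : set (measurableTypeR R)) := measurable_itv `]0, t[.

Let mH : measurable_fun (`]0, t[ `*` Omega : set (plane R))
    (fun p : plane R => H p.1 p.2).
Proof.
apply: measurable_funM; last exact: slice_measurable cu _ tT.
have h : measurable_fun setT (fun p : plane R =>
    (t - p.1) `^ (- alpha)).
  have m1 : measurable_fun setT (fun p : plane R => t - p.1).
    by apply: measurable_funB => //; exact: measurable_fst.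
  exact: (measurableT_comp (measurable_powR (- alpha)) m1).
exact: measurable_funTS.
Qed.

Let Hfin : (\int[mu]_(s in `]0%R, t[) \int[mu]_(x in Omega) `|(H s x)%:E| < +oo)%E.
Proof.
have [B B0 hB] := slice_L1_bounded.
have [t0 tT'] := andP tT.
apply: (@le_lt_trans _ _ (\int[mu]_(s in `]0%R, t[) (B%:E * ((t - s) `^ (- alpha))%:E))%E).
  apply: ge0_le_integral => //.
  - by move=> s _; exact: integral_ge0.
  - exact: measurable_integral_norm mt mO mH.
  - exact: measurable_int (integrableZl mt B (weak_kernel_integrable t a01)).
  move=> s; rewrite /= in_itv/= => /andP[s0 st].
  have sT : 0 <= s <= T by rewrite (ltW s0)/=; exact: le_trans (ltW st) tT'.
  have si := slice_integrable sT; have ni := integrable_normr mO si.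
  have Hi := integrable_scale ((t - s) `^ (- alpha)) mO ni.
  have -> : (\int[mu]_(x in Omega) `|(H s x)|%:E = (\int[mu]_(x in Omega) ((t - s) `^ (- alpha) * `|u s x|))%:E)%E.
    rewrite /Rintegral fineK; last exact: integrable_fin_num Hi.
    by apply: eq_integral => x _; rewrite /H /= normrM ger0_norm ?powR_ge0.
  rewrite lee_fin RintegralZl// mulrC ler_wpM2r ?powR_ge0//; exact: hB.
rewrite integralZl//; last exact: weak_kernel_integrable.
apply: lte_mul_pinfty => //.
exact: le_lt_trans (weak_kernel_integral_le t0 a01) (ltry _).
Qed.

Lemma RL_slice_integrable :
  mu.-integrable Omega (EFin \o (fun x => RL_integral alpha (u ^~ x) t)).
Proof.
apply: integrable_scale => //; exact: fubini_integrable mt mO mH Hfin.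
Qed.

(** Fubini's theorem for the kernel in time and [phi k] in space. *)
Lemma RL_coef k : RL_integral alpha (fun s => inner (u s) (phi k)) t =
  inner (fun x => RL_integral alpha (u ^~ x) t) (phi k).
Proof.
have [t0 tT'] := andP tT.
rewrite inner_scale; last exact: fubini_integrable mt mO mH Hfin.
rewrite /RL_integral; congr (_ * _).
have mphi := @measurable_phi R k.
rewrite /inner -(fubini_weight mt mO mH Hfin mphi (fun y _ => normr_phi_le k y)).
apply: eq_Rintegral => s; rewrite inE /= in_itv/= => /andP[s0 st].
have sT : 0 <= s <= T by rewrite (ltW s0)/=; exact: le_trans (ltW st) tT'.
rewrite -RintegralZl//.
  by apply: eq_Rintegral => x _; rewrite /H mulrA.
by apply: continuous_mul_integrable; [exact: slice_integrable|exact: continuous_phi].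
Qed.

End Kernel.

End SolutionCoefficients.

Section CoefficientEquation.
Variables (R : realType) (T alpha : R) (f u : R -> R -> R).
Hypothesis T0 : 0 < T.
Hypothesis a01 : 0 < alpha < 1.
Hypothesis usol : subdiffusion_solution T alpha (fun=> 0) f u.
Hypothesis mf : forall t, 0 < t <= T -> measurable_fun Omega (f t).

Let mO := @measurable_Omega R.
Let cu := sol_continuous usol.

Let u_init x : Omega x -> u 0 x = 0.
Proof. by move=> Ox; rewrite (sol_initial usol Ox). Qed.

Let u_lim : normL2 (u t) @[t --> 0^'+] --> 0%E.
Proof.
have := sol_initial_L2 usol.
have -> : (fun t => normL2 (fun x => u t x - (fun=> 0) x)) = (fun t => normL2 (u t)) => //.
by apply/funext => t; congr normL2; apply/funext => x; rewrite subr0.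
Qed.

Lemma solution_coef_continuous k : {within `[0, T], continuous (fun t => inner (u t) (phi k))}.
Proof. exact: (coef_continuous cu u_init u_lim). Qed.

Lemma solution_coef_init k : inner (u 0) (phi k) = 0.
Proof. exact: coef_init. Qed.

Let Rx (s x : R) := RL_integral alpha (u ^~ x) s.

Let Rx_integrable s : 0 <= s <= T -> mu.-integrable Omega (EFin \o Rx s).
Proof.
move=> /andP[]; rewrite le_eqVlt => /predU1P[<- _|s0 sT].
  apply: (eq_integrable mO) (integrable0 mu Omega) => x _ /=.
  by rewrite /Rx RL_integral_le0.
by apply: (RL_slice_integrable T0 a01 cu u_init u_lim); rewrite s0.
Qed.

Let RL_coef' k s : 0 <= s <= T ->
  RL_integral alpha (fun s => inner (u s) (phi k)) s = inner (Rx s) (phi k).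
Proof.
move=> /andP[]; rewrite le_eqVlt => /predU1P[<- _|s0 sT].
  rewrite RL_integral_le0//; apply/esym.
  have -> : inner (Rx 0) (phi k) = \int[mu]_(x in Omega) (fun=> 0) x.
    by apply: eq_Rintegral => x _; rewrite /Rx RL_integral_le0// mul0r.
  by rewrite (Rintegral_cst mu mO) mul0r.
by apply: (RL_coef T0 a01 cu u_init u_lim); rewrite s0.
Qed.

(** Convergence in L^2 of the difference quotients implies convergence of their sine
    coefficients. *)
Lemma RL_deriv_coef k t d : 0 < t <= T -> inL2 d ->
  RL_deriv_L2_at T alpha (fun s x => u s x - (fun=> 0) x) t d ->
  RL_deriv_at T alpha (fun s => inner (u s) (phi k)) t (inner d (phi k)).
Proof.
move=> /andP[t0 tT] d2 h; have di := inL2_integrable d2.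
have md : measurable_fun Omega d by case: d2.
have tT' : 0 <= t <= T by rewrite (ltW t0).
have s2 : 0 < Num.sqrt 2 :> R by rewrite sqrtr_gt0.
apply/cvgrPdist_le => e e0; have e2 : 0 < e / Num.sqrt 2 by rewrite divr_gt0.
have hn : \forall s \near within `[0, T] t^',
    (normL2 (fun x => ((Rx s x - Rx t x) / (s - t) - d x)%R) < (e / Num.sqrt 2)%:E)%E.
  have h' : normL2 (fun x => (Rx s x - Rx t x) / (s - t) - d x)
      @[s --> within `[0, T] t^'] --> 0%E.
    have uE : (fun s x => u s x - (fun=> 0) x) = u.
      by apply/funext => s; apply/funext => x; rewrite subr0.
    by move: h; rewrite uE.
  suff : nbhs (0%E : \bar R) [set x | (x < (e / Num.sqrt 2)%:E)%E] by move=> /h'.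
  apply: open_nbhs_nbhs; split; first exact: open_ereal_lt_ereal.
  by rewrite /= lte_fin.
have hT : \forall s \near within `[0, T] t^', `[0, T]%classic s.
  exact: (@withinT _ t^' `[0, T]%classic).
move: hn hT; apply: filterS2 => s hs; rewrite /= in_itv/= => sT.
have rs := Rx_integrable sT; have rt := Rx_integrable tT'.
have qi : mu.-integrable Omega (EFin \o (fun x => (s - t)^-1 * (Rx s x - Rx t x))).
  by apply: integrable_scale => //; exact: integrable_sub.
have qE : (fun x => (Rx s x - Rx t x) / (s - t)) = (fun x => (s - t)^-1 * (Rx s x - Rx t x)).
  by apply/funext => x; rewrite mulrC.
rewrite (RL_coef' _ sT) (RL_coef' _ tT') -inner_sub//.
rewrite [X in `|_ - X|](_ : _ = inner (fun x => (Rx s x - Rx t x) / (s - t)) (phi k)); last first.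
  by rewrite qE inner_scale ?(mulrC (s - t)^-1)//; exact: integrable_sub.
rewrite distrC -inner_sub//; last by rewrite qE.
have gi : mu.-integrable Omega (EFin \o (fun x => (Rx s x - Rx t x) / (s - t) - d x)).
  by apply: integrable_sub => //; rewrite qE.
apply: le_trans (inner_norm_le k gi) _.
rewrite mulrC -ler_pdivlMr//; apply: L1_le_normL2; last exact: ltW.
by apply/measurable_EFinP; case/integrableP: gi.
Qed.

Lemma solution_coef_equation k t : 0 < t <= T ->
  RL_deriv_at T alpha (fun s => inner (u s) (phi k)) t
    (inner (f t) (phi k) - lambda_ R k * inner (u t) (phi k)).
Proof.
move=> tT; have [d [Au [d2 hd lap eqn]]] := sol_equation usol tT.
have [ut0 ut1] := sol_boundary usol tT.
have [A2 _] := lap.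
have Ai := inL2_integrable A2; have di := inL2_integrable d2.
have cphi := @continuous_phi R k.
have i1 := continuous_mul_integrable di cphi; have i2 := continuous_mul_integrable Ai cphi.
have <- : inner d (phi k) = inner (f t) (phi k) - lambda_ R k * inner (u t) (phi k).
  rewrite -(neg_laplacian_inner k lap ut0 ut1).
  apply/eqP; rewrite eq_sym subr_eq; apply/eqP.
  rewrite /inner -RintegralD// /Rintegral; congr fine.
  have i3 := integrable_add mO i1 i2.
  apply: ae_eq_integral => //.
  - apply/measurable_EFinP; apply: measurable_funM; first exact: mf.
    by apply: measurable_funTS; exact: continuous_measurable_fun.
  - exact: measurable_int i3.
  - have [N [mN N0 sub]] := eqn; exists N; split => //.
    move=> x /= nx; apply: sub => /= h; apply: nx => Ox.
    by rewrite -h// mulrDl.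
exact: RL_deriv_coef.
Qed.

End CoefficientEquation.

(** * Sine coefficients of the source *)

Lemma lambda_ge_sqr (R : realType) (k : nat) : k%:R ^+ 2 <= lambda_ R k.
Proof.
rewrite /lambda_ ler_peMr ?sqr_ge0// exprn_ege1//.
by apply: le_trans (pi_ge2 R); rewrite ler1n.
Qed.

Lemma lambda_ge1 (R : realType) (k : nat) : (0 < k)%N -> 1 <= lambda_ R k.
Proof.
by move=> k0; apply: le_trans (lambda_ge_sqr R k); rewrite exprn_ege1// ler1n.
Qed.

Lemma lambda_ge0 (R : realType) (k : nat) : 0 <= lambda_ R k.
Proof. by rewrite /lambda_ mulr_ge0 ?sqr_ge0. Qed.

Lemma powR_half_sqr (R : realType) (x s : R) : (x `^ (s / 2)) ^+ 2 = x `^ s.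
Proof. by rewrite -powR_mulrn ?powR_ge0// -powRrM divfK ?pnatr_eq0. Qed.

Lemma normH_partial_sum (R : realType) (s : R) (v : R -> R) (n : nat) :
  ((Num.sqrt (\sum_(1 <= k < n) lambda_ R k `^ s * inner v (phi k) ^+ 2))%:E
    <= normH s v)%E.
Proof.
have p k : 0 <= lambda_ R k `^ s * inner v (phi k) ^+ 2.
  by rewrite mulr_ge0 ?powR_ge0 ?sqr_ge0.
have -> : (Num.sqrt (\sum_(1 <= k < n) lambda_ R k `^ s * inner v (phi k) ^+ 2))%:E
  = sqrte (\sum_(1 <= k < n) (lambda_ R k `^ s * inner v (phi k) ^+ 2)%:E)%E.
  by rewrite sumEFin.
rewrite /normH lee_sqrt; last by apply: nneseries_ge0 => k _ _; rewrite lee_fin.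
by apply: nneseries_lim_ge => k _ _; rewrite lee_fin.
Qed.

(** The Cauchy-Schwarz inequality in a form that survives integration in time: the
    right-hand side depends on [v] through its norm, and linearly so. *)
Lemma normH_pairing (R : realType) (s : R) (v : R -> R) (n : nat) (a : nat -> R) :
  (((\sum_(1 <= k < n) a k * (lambda_ R k `^ (s / 2) * `|inner v (phi k)|)))%:E
    <= (Num.sqrt (\sum_(1 <= k < n) a k ^+ 2))%:E * normH s v)%E.
Proof.
apply: le_trans (lee_wpmul2l _ (normH_partial_sum s v n)); last first.
  by rewrite lee_fin sqrtr_ge0.
rewrite -EFinM lee_fin; apply: le_trans (sum_cauchy_schwarz_sqrt _ _ _ _) _.
rewrite [X in _ * Num.sqrt X <= _](eq_bigr (fun k => lambda_ R k `^ s * inner v (phi k) ^+ 2)) // => k _.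
by rewrite exprMn powR_half_sqr real_normK ?num_real.
Qed.

(** The weights [lambda_ R k `^ s] are at least 1, so the H^s norm dominates the l^2
    norm of the sine coefficients. *)
Lemma L1_norm_le_normH (R : realType) (s : R) (v : R -> R) : 0 <= s -> inH s v ->
  ((\int[mu]_(x in Omega) `|(v x)%:E|) <= normH s v)%E.
Proof.
move=> s0 [v2 vH]; have vi := inL2_integrable v2; have mO := @measurable_Omega R.
have N0 : (0 <= normH s v)%E by exact: sqrte_ge0.
have Nf : normH s v \is a fin_num by rewrite ge0_fin_numE.
have ai := integrable_normr mO vi.
have -> : (\int[mu]_(x in Omega) `|(v x)%:E| = (\int[mu]_(x in Omega) `|v x|)%:E)%E.
  by rewrite /Rintegral fineK//; exact: (integrable_fin_num mO ai).
rewrite -(fineK Nf) lee_fin.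
have n0 : 0 <= fine (normH s v) by exact: fine_ge0.
rewrite -[leRHS](ger0_norm n0) -sqrtr_sqr.
apply: L1_norm_le_sine_coef => // n.
have := normH_partial_sum s v n; rewrite -(fineK Nf) lee_fin => h.
have S0 : 0 <= \sum_(1 <= k < n) lambda_ R k `^ s * inner v (phi k) ^+ 2.
  by apply: sumr_ge0 => k _; rewrite mulr_ge0 ?powR_ge0 ?sqr_ge0.
apply: (@le_trans _ _ (\sum_(1 <= k < n) lambda_ R k `^ s * inner v (phi k) ^+ 2)).
  rewrite big_seq_cond [leRHS]big_seq_cond; apply: ler_sum => k; rewrite andbT mem_index_iota => /andP[k1 _].
  rewrite ler_peMl ?sqr_ge0//; apply: (@le_trans _ _ (lambda_ R k `^ 0)); first by rewrite powRr0.
  by rewrite ler_powR// lambda_ge1.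
by rewrite -[leLHS]sqr_sqrtr// lerXn2r// nnegrE ?sqrtr_ge0.
Qed.

Section Source.
Variables (R : realType) (T sigma : R) (f ft : R -> R -> R).
Hypotheses (sigma0 : 0 <= sigma) (src : admissible_source T sigma f ft).
Hypothesis T0 : 0 < T.
Let mO := @measurable_Omega R.
Let mI (t : R) : measurable (`]0, t[%classic : set (measurableTypeR R)) := measurable_itv `]0, t[.

Let mphi := @measurable_phi R.

Let mft t : t <= T ->
  measurable_fun (`]0, t[ `*` Omega : set (plane R))
    (fun p : plane R => ft p.1 p.2).
Proof.
move=> tT; apply: measurable_funS (src_deriv_measurable src).
  exact: measurableX.
move=> [s x] [/= s0t x01]; split => //=; move: s0t; rewrite !in_itv/= => /andP[-> st].
exact: lt_le_trans st tT.
Qed.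

Lemma measurable_deriv_coef k t : t <= T ->
  measurable_fun `]0, t[ (fun s => inner (ft s) (phi k) : R).
Proof.
move=> tT; apply: (measurable_Rintegral_section (H := fun s x => ft s x * phi k x)) => //.
apply: measurable_funM; first exact: mft.
have h : measurable_fun setT (fun p : plane R => phi k p.2).
  apply: (measurableT_comp (f := phi k : measurableTypeR R -> R)); last exact: measurable_snd.
  by apply: continuous_measurable_fun; exact: continuous_phi.
exact: measurable_funTS.
Qed.

Lemma measurable_normH_deriv t : t <= T ->
  measurable_fun `]0, t[ (fun s => normH sigma (ft s)).
Proof.
move=> tT; rewrite /normH.
have p s k : (0 <= (lambda_ R k `^ sigma * inner (ft s) (phi k) ^+ 2)%:E)%E.
  by rewrite lee_fin mulr_ge0 ?powR_ge0 ?sqr_ge0.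
have -> : (fun s => sqrte (\sum_(1 <= k <oo) (lambda_ R k `^ sigma * inner (ft s) (phi k) ^+ 2)%:E)%E)
  = (fun s => (\sum_(k <oo | k \in (fun k => (1 <= k)%N))
       (lambda_ R k `^ sigma * inner (ft s) (phi k) ^+ 2)%:E) `^ 2^-1)%E.
  apply/funext => s; rewrite -poweR12_sqrt; last first.
    by apply: nneseries_ge0 => k _ _; exact: p.
  by rewrite eseries_cond.
apply: (measurableT_comp (@measurable_poweR R 2^-1)).
apply: ge0_emeasurable_sum => [k s _ _|k _]; first exact: p.
apply/measurable_EFinP; apply: measurable_funM; first exact: measurable_cst.
by apply: measurable_funX; exact: measurable_deriv_coef.
Qed.

Lemma deriv_L1_fin t : 0 < t <= T ->
  (\int[mu]_(s in `]0%R, t[) \int[mu]_(x in Omega) `|(ft s x)%:E| < +oo)%E.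
Proof.
move=> /andP[t0 tT]; have t0T : 0 < t <= T by rewrite t0.
apply: le_lt_trans (src_deriv_integrable src t0T).
apply: ae_ge0_le_integral => //.
- by move=> s _; apply: integral_ge0 => x _; exact: abse_ge0.
- by apply: (measurable_integral_norm (H := ft)) => //; exact: mft.
- by move=> s _; exact: sqrte_ge0.
- exact: measurable_normH_deriv.
have [N [mN N0 sub]] := src_deriv_inH src; exists N; split => // s /= h.
apply: sub => /= h'; apply: h => st; apply: L1_norm_le_normH => //; apply: h'.
by move: st; rewrite !in_itv/= => /andP[-> st]; exact: lt_le_trans st tT.
Qed.

Lemma deriv_coef_integrable k t : 0 < t <= T ->
  mu.-integrable `]0, t[ (EFin \o (fun s => inner (ft s) (phi k))).
Proof.
move=> t0T; have [_ tT] := andP t0T.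
exact: (fubini_weight_integrable (mI t) mO (mft tT) (deriv_L1_fin t0T) (mphi k)
  (fun y _ => normr_phi_le k y)).
Qed.

Lemma source_coef_eq k t : 0 < t <= T ->
  inner (f t) (phi k) = inner (f 0) (phi k) + \int[mu]_(s in `]0, t[) inner (ft s) (phi k).
Proof.
move=> t0T; have [t0 tT] := andP t0T.
have fin := deriv_L1_fin t0T.
have i0 := inL2_integrable (src_initial src).1.
have i1 : mu.-integrable Omega (EFin \o (fun x => \int[mu]_(s in `]0, t[) ft s x)).
  exact: (fubini_integrable (mI t) mO (mft tT) fin).
have j0 := continuous_mul_integrable i0 (@continuous_phi R k).
have j1 := continuous_mul_integrable i1 (@continuous_phi R k).
have -> : \int[mu]_(s in `]0, t[) inner (ft s) (phi k) =
    inner (fun x => \int[mu]_(s in `]0, t[) ft s x) (phi k).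
  exact: (fubini_weight (mI t) mO (mft tT) fin (mphi k) (fun y _ => normr_phi_le k y)).
rewrite /inner -RintegralD//; rewrite /Rintegral; congr fine.
apply: ae_eq_integral => //.
- apply/measurable_EFinP; apply: measurable_funM => //.
    exact: src_measurable src _ _.
  exact: mphi.
- by case/integrableP: (integrable_add mO j0 j1).
have [N [mN N0 sub]] := src_deriv src t0T; exists N; split => // x /= h.
apply: sub => /= h'; apply: h => Ox; rewrite /= h'// mulrDl.
by [].
Qed.

(** A bound of the coefficient [inner (f s) (phi k)] that is uniform in [0 < s <= t]
    and has the form of the size of the source. *)
Definition source_coef (k : nat) (t : R) : R :=
  `|inner (f 0) (phi k)| + \int[mu]_(s in `]0, t[) `|inner (ft s) (phi k)|.

Lemma source_coef_ge0 k t : 0 <= source_coef k t.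
Proof. by rewrite addr_ge0 ?Rintegral_ge0. Qed.

Lemma source_coef_le k s t : 0 < s <= t -> t <= T ->
  `|inner (f s) (phi k)| <= source_coef k t.
Proof.
move=> /andP[s0 st] tT; have sT : 0 < s <= T by rewrite s0 (le_trans st).
have tT' : 0 < t <= T by rewrite (lt_le_trans s0).
rewrite source_coef_eq// (le_trans (ler_normD _ _))// lerD2l.
have is_ := deriv_coef_integrable k sT; have it := deriv_coef_integrable k tT'.
apply: le_trans (le_normr_Rintegral (mI s) is_) _.
have ns := integrable_normr (mI s) is_; have nt := integrable_normr (mI t) it.
rewrite /Rintegral fine_le//.
- exact: (integrable_fin_num (mI s) ns).
- exact: (integrable_fin_num (mI t) nt).
apply: ge0_subset_integral => //.
- by case/integrableP: nt.
- by move=> x /=; rewrite !in_itv/= => /andP[-> xs]; exact: lt_le_trans xs st.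
Qed.

Lemma source_size_fin t : 0 < t <= T ->
  source_size sigma f ft t = (fine (source_size sigma f ft t))%:E.
Proof.
move=> tT; rewrite fineK// ge0_fin_numE.
  apply: lte_add_pinfty; last exact: src_deriv_integrable src _ tT.
  exact: (src_initial src).2.
by apply: adde_ge0; [exact: sqrte_ge0|apply: integral_ge0 => s _; exact: sqrte_ge0].
Qed.

Lemma source_size_ge0 t : 0 <= fine (source_size sigma f ft t).
Proof.
apply: fine_ge0; apply: adde_ge0; first exact: sqrte_ge0.
by apply: integral_ge0 => s _; exact: sqrte_ge0.
Qed.

(** The weights [a] are the same at all times, so the sum over the modes can be taken
    under the time integral, where [normH_pairing] applies. *)
Lemma source_coef_pairing (n : nat) (a : nat -> R) t : 0 < t <= T ->
  (forall k, 0 <= a k) ->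
  \sum_(1 <= k < n) a k * (lambda_ R k `^ (sigma / 2) * source_coef k t)
    <= Num.sqrt (\sum_(1 <= k < n) a k ^+ 2) * fine (source_size sigma f ft t).
Proof.
move=> t0T a0; have [_ tT] := andP t0T.
rewrite -lee_fin EFinM -source_size_fin// /source_size.
set A := Num.sqrt _; have A0 : 0 <= A by exact: sqrtr_ge0.
have ic k : mu.-integrable `]0, t[ (EFin \o (fun s =>
    a k * (lambda_ R k `^ (sigma / 2) * `|inner (ft s) (phi k)|))).
  apply: integrable_scale => //; apply: integrable_scale => //.
  by apply: integrable_normr => //; exact: deriv_coef_integrable.
have [isum esum] := Rintegral_sum (index_iota 1 n) (P := xpredT) (mI t) (fun k _ => ic k).
have -> : \sum_(1 <= k < n) a k * (lambda_ R k `^ (sigma / 2) * source_coef k t)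
  = \sum_(1 <= k < n) a k * (lambda_ R k `^ (sigma / 2) * `|inner (f 0) (phi k)|)
  + \int[mu]_(s in `]0, t[) (\sum_(1 <= k < n)
       a k * (lambda_ R k `^ (sigma / 2) * `|inner (ft s) (phi k)|)).
  rewrite esum -big_split/=; apply: eq_bigr => k _.
  have in_ := integrable_normr (mI t) (deriv_coef_integrable k t0T).
  rewrite RintegralZl//; last exact: integrable_scale.
  by rewrite RintegralZl// /source_coef !mulrDr.
rewrite EFinD ge0_muleDr; [|exact: sqrte_ge0|by apply: integral_ge0 => s _; exact: sqrte_ge0].
apply: leeD; first exact: normH_pairing.
rewrite -ge0_integralZl//; last 2 first.
- exact: measurable_normH_deriv.
- by move=> s _; exact: sqrte_ge0.
rewrite /Rintegral fineK; last exact: (integrable_fin_num (mI t) isum).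
apply: ge0_le_integral => //.
- move=> s _; rewrite lee_fin; apply: sumr_ge0 => k _.
  by rewrite !mulr_ge0// powR_ge0.
- by case/integrableP: isum.
- by apply: measurable_funeM; exact: measurable_normH_deriv.
- by move=> s _; exact: normH_pairing.
Qed.

End Source.

(** * The discrete sine transform and the scheme *)

Section DiscreteSine.
Variables (R : realType) (N : nat).
Hypothesis N0 : (0 < N)%N.

Let Nn : N%:R != 0 :> R. Proof. by rewrite pnatr_eq0 -lt0n. Qed.

Lemma cos_sum_twice_sin (y : R) n :
  2 * sin y * \sum_(1 <= j < n.+1) cos (j%:R * (2 * y)) = sin ((2 * n + 1)%:R * y) - sin y.
Proof.
elim: n => [|n IH]; first by rewrite big_geq// mulr0 muln0 mul1r subrr.
rewrite big_nat_recr//= mulrDr IH.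
have -> : (2 * n.+1 + 1)%:R * y = n.+1%:R * (2 * y) + y.
  by rewrite natrD natrM; ring.
have -> : (2 * n + 1)%:R * y = n.+1%:R * (2 * y) - y.
  by rewrite natrD natrM -(natr1 n); ring.
by rewrite [sin (_ + y)]sinD [sin (_ - y)]sinB; ring.
Qed.

Lemma cos_grid_sum m : (0 < m < 2 * N)%N ->
  \sum_(1 <= j < N) cos (j%:R * (m%:R * pi / N%:R)) = - (1 + (-1) ^+ m) / 2 :> R.
Proof.
move=> /andP[m0 mN]; set y : R := m%:R * pi / (2 * N%:R).
have ->  : m%:R * pi / N%:R = 2 * y by rewrite /y; field; rewrite Nn.
have N2 : 0 < 2 * N%:R :> R by rewrite mulr_gt0 ?ltr0n.
have y0 : 0 < y by rewrite divr_gt0// mulr_gt0 ?pi_gt0 ?ltr0n.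
have ypi : y < pi.
  rewrite /y ltr_pdivrMr// mulrC ltr_pM2l ?pi_gt0//.
  by rewrite -natrM ltr_nat.
have s0 : sin y != 0 by rewrite gt_eqF// sin_gt0_pi ?y0.
have := cos_sum_twice_sin y N.-1; rewrite prednK//.
have -> : (2 * N.-1 + 1)%:R * y = m%:R * pi - y.
  have -> : (2 * N.-1 + 1)%:R = 2 * N%:R - 1 :> R.
    by rewrite -[X in _ = 2 * X%:R - 1](prednK N0) natrD natrM -(natr1 N.-1); ring.
  by rewrite /y; field; rewrite Nn.
rewrite sinB sin_natpi cos_natpi mul0r sub0r => h.
have s2 : 2 * sin y != 0 by rewrite mulf_neq0.
by apply: (mulfI s2); rewrite h; field.
Qed.

Lemma phi_grid_orth k l : (0 < k < N)%N -> (0 < l < N)%N ->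
  \sum_(1 <= j < N) phi k (j%:R / N%:R) * phi l (j%:R / N%:R) = (k == l)%:R * N%:R :> R.
Proof.
wlog lk : k l / (l <= k)%N => [h hk hl|].
  case: (leqP l k) => [|/ltnW] kl; first exact: h.
  by rewrite eq_sym -h//; apply: eq_bigr => j _; rewrite mulrC.
move=> /andP[k0 kN] /andP[l0 lN].
have e j : phi k (j%:R / N%:R) * phi l (j%:R / N%:R) =
    cos (j%:R * ((k - l)%:R * pi / N%:R)) - cos (j%:R * ((k + l)%:R * pi / N%:R)) :> R.
  rewrite mul_phi; congr (cos _ - cos _).
  - by rewrite natrB//; field; rewrite Nn.
  - by rewrite natrD; field; rewrite Nn.
under eq_bigr do rewrite e.
rewrite sumrB (cos_grid_sum (m := k + l)); last by lia.
have [->|kl] := eqVneq k l.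
  rewrite subnn; under eq_bigr do rewrite !mul0r mulr0 cos0.
  rewrite sumr_const_nat mul1r -signr_odd addnn odd_double expr0.
  by rewrite subn1 -[X in _ = X%:R](prednK N0) -(natr1 N.-1); field.
rewrite cos_grid_sum; last by move: lk kl; rewrite leq_eqVlt eq_sym => /predU1P[->|]; [rewrite eqxx|lia].
have -> : (-1) ^+ (k + l) = (-1) ^+ (k - l) :> R.
  by rewrite -[in LHS]signr_odd -[in RHS]signr_odd oddD oddB.
by rewrite subrr mul0r.
Qed.

End DiscreteSine.
Section Grid.
Variables (R : realType) (N : nat).
Hypothesis N0 : (0 < N)%N.

Let Nn : N%:R != 0 :> R. Proof. by rewrite pnatr_eq0 -lt0n. Qed.

Definition grid (i : 'I_N.-1) : R := i.+1%:R / N%:R.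

Lemma sum_grid (g : nat -> R) : \sum_(i < N.-1) g i.+1 = \sum_(1 <= j < N) g j.
Proof. by rewrite big_add1 big_mkord. Qed.

(** The discrete sine transform, normalised so that sampled sine polynomials return
    their coefficients. *)
Definition grid_coef (v : 'cV[R]_N.-1) (k : nat) : R :=
  \sum_(i < N.-1) (phi k (grid i) / N%:R) * v i 0.

(** Modes and nodes play symmetric roles, so that the orthogonality of the modes is
    also that of the nodes; the inversion formula [grid_coefK] follows. *)
Lemma phi_sym k l : phi k (l%:R / N%:R) = phi l (k%:R / N%:R) :> R.
Proof. by rewrite /phi; congr (_ * sin _); field; rewrite Nn. Qed.

Lemma grid_coef_phi k (c : nat -> R) : (0 < k < N)%N ->
  grid_coef (\col_i \sum_(1 <= l < N) c l * phi l (grid i)) k = c k.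
Proof.
move=> kN; rewrite /grid_coef.
transitivity (\sum_(1 <= l < N) c l * (l == k)%:R).
  transitivity (\sum_(1 <= l < N) \sum_(i < N.-1)
     c l / N%:R * (phi l (grid i) * phi k (grid i))).
    rewrite exchange_big/=; apply: eq_bigr => i _.
    rewrite mxE mulr_sumr; apply: eq_bigr => l _; by field.
  rewrite big_nat_cond [RHS]big_nat_cond; apply: eq_bigr => l; rewrite andbT => lN.
  rewrite -mulr_sumr (sum_grid (fun j => phi l (j%:R / N%:R) * phi k (j%:R / N%:R))).
  by rewrite phi_grid_orth//; field.
rewrite (bigD1_seq k) ?mem_index_iota ?iota_uniq//= eqxx mulr1.
by rewrite big1 ?addr0// => l /negbTE ->; rewrite mulr0.
Qed.

Lemma grid_coefK (v : 'cV[R]_N.-1) i :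
  v i 0 = \sum_(1 <= k < N) grid_coef v k * phi k (grid i).
Proof.
transitivity (\sum_(j < N.-1) v j 0 * (j == i)%:R).
  rewrite (bigD1 i)//= eqxx mulr1 big1 ?addr0// => j /negbTE ->; by rewrite mulr0.
rewrite /grid_coef; under [RHS]eq_bigr do rewrite mulr_suml.
rewrite exchange_big/=; apply: eq_bigr => j _.
transitivity (v j 0 / N%:R * \sum_(1 <= k < N) phi k (grid j) * phi k (grid i)); last first.
  by rewrite mulr_sumr; apply: eq_bigr => k _; field.
have -> : \sum_(1 <= k < N) phi k (grid j) * phi k (grid i) = (j == i)%:R * N%:R.
  under eq_bigr do rewrite /grid phi_sym [X in _ * X]phi_sym.
  have ltN (m : 'I_N.-1) : (0 < m.+1 < N)%N by rewrite /= -[X in (_ < X)%N](prednK N0) ltnS.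
  by rewrite phi_grid_orth.
by field.
Qed.

(** The boundary values [g 0] and [g N] supply the neighbours that are missing in the
    first and the last row. *)
Lemma sum_second_difference (g : nat -> R) (j : 'I_N.-1) : g 0%N = 0 -> g N = 0 ->
  \sum_(i < N.-1) (if i == j :> nat then 2 else
      if (i.+1 == j) || (j.+1 == i) then -1 else 0) * g i.+1 =
  2 * g j.+1 - g j - g j.+2.
Proof.
move=> g0 gN; have jN := ltn_ord j.
transitivity (2 * \sum_(i < N.-1 | i == j :> nat) g i.+1 - \sum_(i < N.-1 | i.+1 == j) g i.+1
  - \sum_(i < N.-1 | i == j.+1 :> nat) g i.+1).
  rewrite [in RHS]big_mkcond [X in _ - X - _]big_mkcond [X in _ - _ - X]big_mkcond.
  rewrite mulr_sumr -!sumrB; apply: eq_bigr => i _.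
  rewrite (eq_sym j.+1); have [ij|_] := eqVneq (i : nat) j.
    have -> : (i.+1 == j) = false by rewrite ij gtn_eqF.
    have -> : (i == j.+1 :> nat) = false by rewrite ij ltn_eqF.
    by rewrite !subr0.
  have [ij|_] := eqVneq i.+1 (j : nat).
    have -> : (i == j.+1 :> nat) = false by rewrite -ij ltn_eqF.
    by rewrite /= mulr0 sub0r subr0 mulN1r.
  by case: eqP => _ /=; rewrite mulr0 !sub0r oppr0 ?add0r ?mulN1r ?mul0r ?oppr0.
rewrite (@big_ord1_eq _ _ _ (fun i => g i.+1)) jN (@big_ord1_eq _ _ _ (fun i => g i.+1)).
congr (_ - _ - _).
  case: (nat_of_ord j) jN => [|m] mN; first by rewrite big1 ?g0// => i; rewrite ?eqSS.
  by under eq_bigl do rewrite eqSS; rewrite (@big_ord1_eq _ _ _ (fun i => g i.+1)) (ltnW mN).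
case: ltnP => // h; have -> : j.+2 = N by lia.
by [].
Qed.

(** The eigenvalue of the difference matrix for the sampled [phi k]. *)
Definition lambda_h (k : nat) : R := (2 * N%:R * sin (k%:R * pi / (2 * N%:R))) ^+ 2.

Lemma phi_second_difference k j :
  2 * phi k (j.+1%:R / N%:R) - phi k (j%:R / N%:R) - phi k (j.+2%:R / N%:R) =
  (2 * sin (k%:R * pi / (2 * N%:R))) ^+ 2 * phi k (j.+1%:R / N%:R) :> R.
Proof.
set y : R := k%:R * pi / (2 * N%:R); rewrite /phi.
have -> : k%:R * pi * (j%:R / N%:R) = k%:R * pi * (j.+1%:R / N%:R) - 2 * y :> R.
  by rewrite /y -(natr1 j); field.
have -> : k%:R * pi * (j.+2%:R / N%:R) = k%:R * pi * (j.+1%:R / N%:R) + 2 * y :> R.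
  by rewrite /y -(natr1 j.+1); field.
move: (k%:R * pi * _) => a; rewrite [sin (a - _)]sinB sinD.
have -> : cos (2 * y) = 1 - 2 * sin y ^+ 2 by rewrite mulr_natl mulr2n cosD -!expr2 sin2cos2; ring.
by ring.
Qed.

Lemma grid_coef_fdmx (v : 'cV[R]_N.-1) k :
  grid_coef (fdmx R N *m v) k = lambda_h k * grid_coef v k.
Proof.
rewrite /grid_coef; under eq_bigr do rewrite mxE mulr_sumr.
rewrite exchange_big/= mulr_sumr; apply: eq_bigr => j _.
transitivity (N%:R * v j 0 * \sum_(i < N.-1) (if i == j :> nat then 2 else
      if (i.+1 == j) || (j.+1 == i) then -1 else 0) * phi k (i.+1%:R / N%:R)).
  by rewrite mulr_sumr; apply: eq_bigr => i _; rewrite mxE /grid; move: (if _ then _ else _) => w; field.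
rewrite (sum_second_difference (g := fun i => phi k (i%:R / N%:R))); last 2 first.
- by rewrite /phi mul0r mulr0 sin0 mulr0.
- by rewrite /phi divff// mulr1 sin_natpi mulr0.
by rewrite phi_second_difference /lambda_h /grid; field.
Qed.

Lemma grid_coefD (v w : 'cV[R]_N.-1) k :
  grid_coef (v + w) k = grid_coef v k + grid_coef w k.
Proof. by rewrite -big_split; apply: eq_bigr => i _; rewrite mxE mulrDr. Qed.

End Grid.

Section SchemeCoef.
Variables (R : realType) (T alpha : R) (N : nat) (f : R -> R -> R) (uh : R -> 'cV[R]_N.-1).
Hypotheses (N0 : (0 < N)%N) (a01 : 0 < alpha < 1).
Hypothesis sch : scheme_solution T alpha (fun=> 0) f uh.

Lemma gridvec_projN0 : gridvec N (projN N (fun=> 0)) = 0 :> 'cV[R]_N.-1.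
Proof.
apply/matrixP => i j; rewrite !mxE /projN big1// => k _.
have -> : inner (fun=> 0) (phi k) = \int[mu]_(x in Omega) (fun=> 0) x :> R.
  by apply: eq_Rintegral => x _; rewrite mul0r.
by rewrite (Rintegral_cst mu (@measurable_Omega R)) !mul0r.
Qed.

Lemma scheme_coef_init k : grid_coef (uh 0) k = 0.
Proof.
by rewrite (sch_initial sch) gridvec_projN0 /grid_coef big1// => i _; rewrite mxE mulr0.
Qed.

Lemma scheme_coef_continuous k : {within `[0, T], continuous (fun t => grid_coef (uh t) k)}.
Proof.
exact: (@continuous_within_sum R T _ (index_enum 'I_N.-1)
  (fun i => phi k (grid R i) / N%:R) (fun i s => uh s i 0) (sch_continuous sch)).
Qed.

(** The projected source has no mode beyond [N - 1], hence its discrete coefficients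
    are the exact ones. *)
Lemma scheme_coef_equation k t : (0 < k < N)%N -> 0 < t <= T ->
  RL_deriv_at T alpha (fun s => grid_coef (uh s) k) t
    (inner (f t) (phi k) - lambda_h R N k * grid_coef (uh t) k).
Proof.
move=> kN tT; have [d hd eqn] := sch_equation sch tT.
have -> : inner (f t) (phi k) - lambda_h R N k * grid_coef (uh t) k = grid_coef d k.
  rewrite -(grid_coef_fdmx N0) -[inner _ _](grid_coef_phi N0 (fun k => inner (f t) (phi k)) kN).
  have -> : (\col_i \sum_(1 <= l < N) inner (f t) (phi l) * phi l (grid R i)) = gridvec N (projN N (f t)).
    by [].
  by rewrite -eqn grid_coefD addrK.
rewrite /grid_coef.
apply: (@RL_deriv_sum R T alpha t _ (index_enum 'I_N.-1)
  (fun i => phi k (grid R i) / N%:R) (fun i s => uh s i 0) (fun i => d i 0) a01 tT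
  (sch_continuous sch)).
move=> i; have := hd i; congr (RL_deriv_at _ _ _ _ _).
by apply/funext => s; rewrite gridvec_projN0 subr0.
Qed.

End SchemeCoef.

(** * Eigenvalue gap and weighted power sums *)

(** With [x = k pi / (2 N)] the eigenvalues are [(2 N x)^2] and [(2 N sin x)^2].  The
    claim follows from [x^2 - (sin x)^2 <= x^4 / 3] and from [sin x >= x / 3]. *)
Lemma eigen_gap (R : realType) (N k : nat) : (0 < k < N)%N ->
  0 < lambda_h R N k /\
  `|lambda_h R N k - lambda_ R k| / (lambda_ R k * lambda_h R N k) <= (N%:R ^+ 2)^-1.
Proof.
move=> /andP[k0 kN]; have N0 : 0 < N%:R :> R by rewrite ltr0n (leq_trans k0)// ltnW.
set x : R := k%:R * pi / (2 * N%:R).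
have kR : 0 < k%:R :> R by rewrite ltr0n.
have x0 : 0 < x by rewrite divr_gt0// mulr_gt0// pi_gt0.
have x2 : x <= 2.
  rewrite /x ler_pdivrMr ?mulr_gt0//.
  have := ltW (pihalf_lt2 R); have kN' : k%:R <= N%:R :> R by rewrite ler_nat ltnW.
  have p0 := ltW (pi_gt0 R); move: (pi : R) p0 => p p0 p2.
  have : k%:R * p <= N%:R * p by rewrite ler_wpM2r.
  have : N%:R * (p / 2) <= N%:R * 2 by rewrite ler_wpM2l// ltW.
  lra.
have -> : lambda_ R k = (2 * N%:R * x) ^+ 2.
  by rewrite /lambda_ -exprMn /x; congr (_ ^+ 2); field; rewrite gt_eqF.
rewrite /lambda_h -/x.
have s3 : x / 3 <= sin x by apply: sin_ge_third; rewrite (ltW x0).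
have s1 := sin_le_id (ltW x0); have sc := sin_ge_cubic (ltW x0).
move: (sin x) s3 s1 sc => s s3 s1 sc; clearbody x; move: N%:R N0 => P P0.
have s0 : 0 < s by apply: lt_le_trans s3; rewrite divr_gt0.
have Ps : 0 < 2 * P * s by rewrite !mulr_gt0.
have Px : 0 < 2 * P * x by rewrite !mulr_gt0.
split; first by rewrite exprn_gt0.
have ge : (2 * P * s) ^+ 2 <= (2 * P * x) ^+ 2.
  by rewrite lerXn2r ?nnegrE ?(ltW Ps) ?(ltW Px)// ler_wpM2l// ltW// mulr_gt0.
rewrite distrC ger0_norm ?subr_ge0// ler_pdivrMr; last by rewrite mulr_gt0// exprn_gt0.
rewrite ler_pdivlMl ?exprn_gt0//.
have gap : x ^+ 2 - s ^+ 2 <= 4 * (x ^+ 2 * s ^+ 2).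
  have h1 : x ^+ 2 - s ^+ 2 <= x ^+ 4 / 3.
    have -> : x ^+ 2 - s ^+ 2 = (x - s) * (x + s) by ring.
    have -> : x ^+ 4 / 3 = x ^+ 3 / 6 * (2 * x) by field.
    by apply: ler_pM; rewrite ?subr_ge0//; [exact: addr_ge0 (ltW x0) (ltW s0)|lra|lra].
  have h2 : (x / 3) ^+ 2 <= s ^+ 2.
    by rewrite lerXn2r ?nnegrE ?divr_ge0 ?(ltW x0) ?(ltW s0).
  have h3 : x ^+ 2 * (x / 3) ^+ 2 <= x ^+ 2 * s ^+ 2 by rewrite ler_wpM2l ?sqr_ge0.
  apply: le_trans h1 _.
  have -> : x ^+ 4 / 3 = 3 * (x ^+ 2 * (x / 3) ^+ 2) by field.
  have h4 : 0 <= x ^+ 2 * s ^+ 2 by rewrite mulr_ge0 ?sqr_ge0.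
  move: (x ^+ 2 * s ^+ 2) (x ^+ 2 * (x / 3) ^+ 2) h3 h4 => a b; lra.
have -> : P ^+ 2 * ((2 * P * x) ^+ 2 - (2 * P * s) ^+ 2) = (2 * P ^+ 2) ^+ 2 * (x ^+ 2 - s ^+ 2) by ring.
have -> : (2 * P * x) ^+ 2 * (2 * P * s) ^+ 2 = (2 * P ^+ 2) ^+ 2 * (4 * (x ^+ 2 * s ^+ 2)) by ring.
by rewrite ler_wpM2l ?sqr_ge0.
Qed.

Lemma pos_powRD (R : realType) (x r s : R) : 0 < x -> x `^ (r + s) = x `^ r * x `^ s.
Proof. by move=> x0; rewrite powRD//; apply/implyP => _; rewrite gt_eqF. Qed.

Lemma ln_ge_half (R : realType) (x : R) : 2 <= x -> 1 / 2 <= ln x.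
Proof.
move=> x2; have : 1 - 1 / 2 <= expR (- (1 / 2)) :> R by exact: expR_ge1Dx.
rewrite expRN => h.
have e2 : expR (1 / 2) <= x.
  apply: le_trans x2; rewrite -lef_pV2 ?posrE ?expR_gt0//; move: h; lra.
rewrite -[1 / 2]expRK ler_ln ?posrE ?expR_gt0//.
by rewrite (lt_le_trans _ x2).
Qed.

Lemma sum_weight_split (R : realType) (N n : nat) (g : nat -> R) : (0 < N)%N ->
  (forall k, 0 <= g k) ->
  \sum_(1 <= k < n) g k <= \sum_(1 <= k < N) g k + \sum_(N <= k < n) g k.
Proof.
move=> N0 g0; have [Nn|nN] := leqP N n; first by rewrite (big_cat_nat N0 Nn).
rewrite [\sum_(N <= _ < _) _]big_geq ?(ltnW nN)// addr0.
have [n0|n1] := leqP n 1; first by rewrite big_geq// sumr_ge0.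
by rewrite [leRHS](big_cat_nat (ltnW n1) (ltnW nN))/= lerDl sumr_ge0.
Qed.

(** The factor by which the error in mode [m] is bounded: of order [h^2] for the
    resolved modes, and of the order of the inverse eigenvalue beyond. *)
Definition alias_weight (R : realType) (N m : nat) : R := ((maxn N m)%:R ^+ 2)^-1.

Section PowerSum.
Variables (R : realType) (sigma : R).
Hypothesis sigma0 : 0 <= sigma.
Let w N k : R := alias_weight R N k ^+ 2 * k%:R `^ (- (2 * sigma)).
Let m := Num.min (sigma + 3 / 2) 2.

Let tail_le N n : (0 < N)%N ->
  \sum_(N <= k < n) w N k <= 2 * N%:R `^ (- (3 + 2 * sigma)).
Proof.
move=> N0; have P0 : 0 < N%:R :> R by rewrite ltr0n.
have P2 : (N%:R ^+ 2)^-1 = N%:R `^ (- 2) :> R.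
  by rewrite powRN powR_mulrn// ltW.
apply: (@le_trans _ _ (N%:R `^ (- 2 - 2 * sigma) * \sum_(N <= k < n) (k%:R ^+ 2)^-1)); last first.
  apply: le_trans (ler_wpM2l (powR_ge0 _ _) (sum_inv_sqr R n N0)) _.
  rewrite -[in X in _ * (2 / X)](powRr1 (ltW P0)) -powRN mulrCA -pos_powRD//.
  by rewrite (_ : - 2 - 2 * sigma + - 1 = - (3 + 2 * sigma))//; ring.
rewrite mulr_sumr; apply: ler_sum_nat => k /andP[Nk _].
rewrite /w /alias_weight (maxn_idPr Nk) expr2 -mulrA mulrC.
have k0 : (0 < k)%N by exact: leq_trans Nk.
have kR : 0 < k%:R :> R by rewrite ltr0n.
have Nk' : N%:R <= k%:R :> R by rewrite ler_nat.
rewrite ler_wpM2r ?invr_ge0 ?sqr_ge0//.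
rewrite pos_powRD//.
rewrite -P2; apply: ler_pM; rewrite ?invr_ge0 ?sqr_ge0 ?powR_ge0//.
  by rewrite lef_pV2 ?posrE ?exprn_gt0// lerXn2r// nnegrE ltW.
rewrite !powRN lef_pV2 ?posrE ?powR_gt0//.
by apply: ge0_ler_powR; rewrite ?nnegrE ?mulr_ge0 ?(ltW kR) ?(ltW P0).
Qed.

Let head_eq N : \sum_(1 <= k < N) w N k =
  N%:R `^ (- 4) * \sum_(1 <= k < N) k%:R `^ (- (2 * sigma)).
Proof.
rewrite mulr_sumr; apply: eq_big_nat => k /andP[_ kN].
by rewrite /w /alias_weight (maxn_idPl (ltnW kN)) [N%:R `^ (- 4)]powRN powR_mulrn// exprVn -exprM.
Qed.

(** The modes below [N] contribute [N^-4] times a sum of powers [k^(-2 sigma)], which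
    is bounded for [sigma > 1/2], logarithmic for [sigma = 1/2] and of order
    [N^(1 - 2 sigma)] for [sigma < 1/2].  The other modes contribute at most
    [2 N^-(3 + 2 sigma)]. *)
Lemma power_sum_bound : exists2 K : R, 0 < K & forall N n, (1 < N)%N ->
  \sum_(1 <= k < n) alias_weight R N k ^+ 2 * k%:R `^ (- (2 * sigma)) <=
  K * (N%:R^-1 `^ Num.min (sigma + 3 / 2) 2 * ell N%:R^-1 `^ chi0 (1 / 4 - sigma / 2)) ^+ 2.
Proof.
suff [K K0 h] : exists2 K : R, 0 < K & forall N, (1 < N)%N ->
    N%:R `^ (- 4) * \sum_(1 <= k < N) k%:R `^ (- (2 * sigma)) + 2 * N%:R `^ (- (3 + 2 * sigma))
    <= K * (N%:R `^ (- (2 * m)) * (ell N%:R^-1 `^ chi0 (1 / 4 - sigma / 2)) ^+ 2).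
  exists K => // N n N1; have N0 : (0 < N)%N by exact: ltnW.
  have w0 k : 0 <= w N k by rewrite mulr_ge0 ?powR_ge0 ?sqr_ge0.
  apply: le_trans (sum_weight_split n N0 w0) _.
  rewrite head_eq; apply: le_trans (lerD (lexx _) (tail_le n N0)) _.
  apply: le_trans (h N N1) _.
  have -> : N%:R `^ (- (2 * m)) = (N%:R^-1 `^ m) ^+ 2 :> R.
    rewrite -(powR_inv1 (ler0n _ N)) -powRrM mulN1r -powR_mulrn ?powR_ge0// -powRrM.
    by rewrite mulNr mulrC.
  by rewrite exprMn.
have mle2 : m <= 2 by rewrite /m ge_min lexx orbT.
have mles : m <= sigma + 3 / 2 by rewrite /m ge_min lexx.
have up N (b : R) : (1 < N)%N -> b <= - (2 * m) -> N%:R `^ b <= N%:R `^ (- (2 * m)) :> R.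
  by move=> N1; apply: ler_powR; rewrite ler1n ltnW.
have tl N : (1 < N)%N -> 2 * N%:R `^ (- (3 + 2 * sigma)) <= 2 * N%:R `^ (- (2 * m)) :> R.
  by move=> N1; rewrite ler_wpM2l// up//; move: m mles => m'; lra.
have [s|s|s] := ltgtP sigma (1 / 2).
- have chi : chi0 (1 / 4 - sigma / 2) = 0 :> R.
    by rewrite /chi0 gt_eqF//; lra.
  pose a := 1 - 2 * sigma.
  have a0 : 0 < a by rewrite /a; lra.
  exists ((1 + a) / a + 2); first by rewrite addr_gt0// divr_gt0// addr_gt0.
  move=> N N1; rewrite chi powRr0 expr1n mulr1 [leRHS]mulrDl; apply: lerD; last exact: tl.
  have e k : k%:R `^ (- (2 * sigma)) = k%:R `^ (a - 1) :> R.
    by congr (_ `^ _); rewrite /a; ring.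
  under eq_bigr do rewrite e.
  apply: le_trans (ler_wpM2l (powR_ge0 _ _) (sum_powR_lt1 a0 (ltnW N1))) _.
  rewrite mulrCA ler_wpM2l//; first exact: divr_ge0 (addr_ge0 ler01 (ltW a0)) (ltW a0).
  rewrite -pos_powRD ?ltr0n ?(ltnW N1)//.
  by apply: up => //; rewrite /a; move: m mles => m'; lra.
- have chi : chi0 (1 / 4 - sigma / 2) = 0 :> R.
    by rewrite /chi0 lt_eqF//; lra.
  pose a := 2 * sigma - 1.
  have a0 : 0 < a by rewrite /a; lra.
  exists (1 + a^-1 + 2); first by rewrite !addr_gt0// invr_gt0.
  move=> N N1; rewrite chi powRr0 expr1n mulr1 [leRHS]mulrDl; apply: lerD; last exact: tl.
  have e k : k%:R `^ (- (2 * sigma)) = k%:R `^ (- a - 1) :> R.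
    by congr (_ `^ _); rewrite /a; ring.
  under eq_bigr do rewrite e.
  apply: le_trans (ler_wpM2l (powR_ge0 _ _) (sum_powR_gt1 N a0)) _.
  rewrite mulrC ler_wpM2l//; first by rewrite addr_ge0// invr_ge0 ltW.
  by apply: up => //; move: m mle2 => m'; lra.
- have chi : chi0 (1 / 4 - sigma / 2) = 1 :> R.
    by rewrite /chi0 s (_ : 1 / 4 - 1 / 2 / 2 = 0) ?eqxx//; field.
  exists 7 => // N N1.
  have P0 : 0 < N%:R :> R by rewrite ltr0n ltnW.
  have L : 1 / 2 <= ln (N%:R : R) by apply: ln_ge_half; rewrite ler_nat.
  have ->  : (ell N%:R^-1 `^ chi0 (1 / 4 - sigma / 2)) ^+ 2 = ln (N%:R : R).
    rewrite chi powRr1 /ell ?sqrtr_ge0// sqr_sqrtr// lnV ?posrE// normrN ger0_norm//.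
    by apply: le_trans L; rewrite divr_ge0.
  have e k : k%:R `^ (- (2 * sigma)) = k%:R^-1 :> R.
    have -> : 2 * sigma = 1 by rewrite s mulrC divfK.
    by rewrite powR_inv1.
  under eq_bigr do rewrite e.
  apply: le_trans (lerD (ler_wpM2l (powR_ge0 _ _) (sum_inv R (ltnW N1))) (tl _ N1)) _.
  have m2 : m = 2 by apply/eqP; rewrite eq_le mle2 /m le_min lexx andbT s; lra.
  have -> : - (2 * m) = - 4 by rewrite m2; ring.
  move: (N%:R `^ _) (powR_ge0 (N%:R : R) (- 4)) (ln _) L => q q0 l l2.
  have : 0 <= q * (l - 1 / 2) by rewrite mulr_ge0// subr_ge0.
  by lra.
Qed.
End PowerSum.

(** * Aliasing and the discrete l^2 norm *)

Section GridNorm.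
Variables (R : realType) (N : nat).
Hypothesis N0 : (0 < N)%N.

Let Nn : N%:R != 0 :> R. Proof. by rewrite pnatr_eq0 -lt0n. Qed.
Let NR : 0 < N%:R :> R. Proof. by rewrite ltr0n. Qed.

Definition grid_sqnorm (v : 'cV[R]_N.-1) : R := N%:R^-1 * \sum_(i < N.-1) v i 0 ^+ 2.

Lemma grid_sqnorm_ge0 v : 0 <= grid_sqnorm v.
Proof. by rewrite mulr_ge0 ?invr_ge0 ?ler0n// sumr_ge0// => i _; rewrite sqr_ge0. Qed.

Lemma grid_sqnorm_expand (v : 'cV[R]_N.-1) (n : nat) (c : nat -> R) :
  (forall i, v i 0 = \sum_(1 <= k < n) c k * phi k (grid R i)) ->
  grid_sqnorm v = \sum_(1 <= k < n) c k * grid_coef v k.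
Proof.
move=> vE; rewrite /grid_sqnorm /grid_coef mulr_sumr.
under [RHS]eq_bigr do rewrite mulr_sumr.
rewrite exchange_big/=; apply: eq_bigr => i _.
rewrite expr2 {1}vE mulr_suml mulr_sumr; apply: eq_bigr => k _; by field.
Qed.

Lemma grid_parseval (v : 'cV[R]_N.-1) :
  \sum_(1 <= k < N) grid_coef v k ^+ 2 = grid_sqnorm v.
Proof.
rewrite (grid_sqnorm_expand (c := grid_coef v) (n := N)); last exact: grid_coefK.
by apply: eq_bigr => k _; rewrite expr2.
Qed.

Lemma phi_alias l r (i : 'I_N.-1) :
  phi (l * N + r) (grid R i) = (-1) ^+ (l * i.+1) * phi r (grid R i).
Proof.
rewrite /phi /grid.
have -> : (l * N + r)%:R * pi * (i.+1%:R / N%:R) =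
    (l * i.+1)%:R * pi + r%:R * pi * (i.+1%:R / N%:R) :> R.
  by rewrite natrD !natrM; field.
by rewrite sinD sin_natpi cos_natpi mul0r add0r mulrCA.
Qed.

(** On the grid, [phi (l N + r)] is [phi r] up to a sign that depends only on the
    node.  The signs are moved to the vector, whose norm they preserve, and
    Parseval's identity applies. *)
Lemma grid_coef_alias (v : 'cV[R]_N.-1) l :
  \sum_(0 <= r < N) grid_coef v (l * N + r) ^+ 2 = grid_sqnorm v.
Proof.
pose w : 'cV[R]_N.-1 := \col_i ((-1) ^+ (l * i.+1) * v i 0).
have e r : grid_coef v (l * N + r) = grid_coef w r.
  by apply: eq_bigr => i _; rewrite mxE phi_alias; ring.
under eq_bigr do rewrite e.
rewrite big_ltn// grid_parseval /grid_coef big1 => [|i _]; last first.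
  by rewrite /phi !mul0r sin0 mulr0 !mul0r.
rewrite expr0n add0r; congr (_ * _); apply: eq_bigr => i _.
by rewrite mxE exprMn sqrr_sign mul1r.
Qed.

Lemma alias_weight_ge0 m : 0 <= alias_weight R N m.
Proof. by rewrite /alias_weight invr_ge0 sqr_ge0. Qed.

(** The modes are grouped into blocks [l N <= m < (l + 1) N], on which the weight is
    at most [(N max(1, l))^-2].  The constant 3 is a bound for 1 plus the sum of the
    inverse squares. *)
Lemma sum_alias_weight (v : 'cV[R]_N.-1) n :
  \sum_(1 <= m < n) (alias_weight R N m * grid_coef v m) ^+ 2 <=
  3 * (N%:R ^+ 2)^-1 ^+ 2 * grid_sqnorm v.
Proof.
pose t m := (alias_weight R N m * grid_coef v m) ^+ 2.
have t0 m : 0 <= t m by exact: sqr_ge0.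
apply: (@le_trans _ _ (\sum_(0 <= m < n * N) t m)).
  have h : (n <= n * N)%N by rewrite leq_pmulr.
  rewrite (big_cat_nat (leq0n n) h)/=.
  apply: (@le_trans _ _ (\sum_(0 <= m < n) t m)); last by rewrite lerDl sumr_ge0.
  case: n {h} => [|n]; first by rewrite !big_geq.
  by rewrite [leRHS]big_ltn// lerDr.
have blocks : \sum_(0 <= m < n * N) t m = \sum_(0 <= l < n) \sum_(0 <= r < N) t (l * N + r)%N.
  elim: n => [|k IH]; first by rewrite mul0n !big_geq.
  rewrite big_nat_recr//= -IH mulSn addnC (big_cat_nat (leq0n (k * N)) (leq_addr _ _))/=.
  by congr (_ + _); rewrite -{1}[(k * N)%N]add0n big_addn addKn; apply: eq_bigr => r _; rewrite addnC.
rewrite blocks.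
pose q (l : nat) : R := ((maxn 1 l)%:R ^+ 2)^-1.
have q1 l : q l ^+ 2 <= q l.
  rewrite expr2 ler_piMl//; first by rewrite invr_ge0 sqr_ge0.
  by rewrite invf_le1 ?exprn_gt0 ?exprn_ege1 ?ltr0n ?ler1n ?leq_max.
apply: (@le_trans _ _ (\sum_(0 <= l < n) q l * ((N%:R ^+ 2)^-1 ^+ 2 * grid_sqnorm v))).
  apply: ler_sum => l _; rewrite -(grid_coef_alias v l) mulrA mulr_sumr; apply: ler_sum => r _.
  rewrite /t /alias_weight exprMn ler_wpM2r ?sqr_ge0//.
  apply: le_trans (ler_wpM2r (sqr_ge0 _) (q1 l)).
  rewrite -exprMn lerXn2r ?nnegrE ?mulr_ge0 ?invr_ge0 ?sqr_ge0//.
  rewrite /q -invfM lef_pV2 ?posrE ?mulr_gt0 ?exprn_gt0 ?ltr0n ?leq_max ?N0//.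
  rewrite -exprMn lerXn2r ?nnegrE ?mulr_ge0// -natrM ler_nat.
  case: l => [|l]; first by rewrite mul1n leq_maxl.
  by rewrite (maxn_idPr _)// leq_max leq_addr orbT.
rewrite -mulr_suml -mulrA ler_wpM2r ?(mulr_ge0 (sqr_ge0 _) (grid_sqnorm_ge0 v))//.
case: n {blocks} => [|n]; first by rewrite big_geq.
rewrite big_ltn// /q maxn0 expr1n invr1.
have := sum_inv_sqr R n.+1 (ltn0Sn 0); rewrite divr1.
rewrite (eq_big_nat _ _ (F2 := fun l => ((maxn 1 l)%:R ^+ 2)^-1)); last first.
  by move=> l /andP[l1 _]; rewrite (maxn_idPr l1).
by move: (\sum_(1 <= i < n.+1) _) => s; lra.
Qed.

(** The squared norm [s] equals the pairing of [E] with the transform of [v].  The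
    weights are moved from [E] to the transform, and the Cauchy-Schwarz inequality
    gives [s <= Q * sqrt (3 * N^-4 * s)]. *)
Lemma grid_sqnorm_le (v : 'cV[R]_N.-1) (n : nat) (E F : nat -> R) (Q : R) :
  (forall i, v i 0 = \sum_(1 <= k < n) E k * phi k (grid R i)) ->
  (forall k, 0 <= F k) ->
  (forall k, (0 < k)%N -> `|E k| <= alias_weight R N k * F k) ->
  0 <= Q -> Num.sqrt (\sum_(1 <= k < n) F k ^+ 2) <= Q ->
  grid_sqnorm v <= 3 * ((N%:R ^+ 2)^-1 * Q) ^+ 2.
Proof.
move=> vE F0 EF Q0 FQ; have s0 := grid_sqnorm_ge0 v.
have h : grid_sqnorm v <= Q * Num.sqrt (3 * (N%:R ^+ 2)^-1 ^+ 2 * grid_sqnorm v).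
  rewrite {1}(grid_sqnorm_expand vE).
  apply: (@le_trans _ _ (\sum_(1 <= k < n) F k * (alias_weight R N k * `|grid_coef v k|))).
    apply: ler_sum_nat => k /andP[k0 _]; apply: le_trans (ler_norm _) _.
    by rewrite normrM mulrA [F k * _]mulrC ler_wpM2r// EF.
  apply: le_trans (sum_cauchy_schwarz_sqrt _ _ _ _) _.
  apply: ler_pM; rewrite ?sqrtr_ge0//; apply: ler_wsqrtr.
  apply: le_trans (sum_alias_weight v n); apply: ler_sum => k _.
  by rewrite !exprMn real_normK ?num_real.
have b0 : 0 <= 3 * (N%:R ^+ 2)^-1 ^+ 2 :> R by rewrite mulr_ge0 ?sqr_ge0.
rewrite sqrtrM// in h.
have r2 := sqr_sqrtr s0; have r0 := sqrtr_ge0 (grid_sqnorm v).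
rewrite exprMn mulrA -(sqr_sqrtr b0) -exprMn -r2.
have := sqrtr_ge0 (3 * (N%:R ^+ 2)^-1 ^+ 2 : R).
move: (Num.sqrt (3 * _)) h => b; rewrite -{1}r2; move: (Num.sqrt (grid_sqnorm v)) r0 => r r0 h {}b0.
have bQ : 0 <= b * Q by exact: mulr_ge0.
rewrite lerXn2r ?nnegrE//.
have [->//|r1] := eqVneq r 0.
have rp : 0 < r by rewrite lt_neqAle eq_sym r1.
by rewrite -(ler_pM2r rp) -expr2 (le_trans h)// mulrA [Q * b]mulrC.
Qed.

End GridNorm.

(** * The error *)

Section Error.
Variables (R : realType) (T alpha sigma : R) (N : nat) (f ft u : R -> R -> R).
Variable uh : R -> 'cV[R]_N.-1.
Hypotheses (T0 : 0 < T) (a01 : 0 < alpha < 1) (sigma0 : 0 <= sigma) (N0 : (0 < N)%N).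
Hypotheses (src : admissible_source T sigma f ft)
  (sol : subdiffusion_solution T alpha (fun=> 0) f u)
  (sch : scheme_solution T alpha (fun=> 0) f uh).
Variable t : R.
Hypothesis tT : 0 < t <= T.

Let U k : R := inner (u t) (phi k).
Let F k : R := source_coef f ft k t.
Let S : R := fine (source_size sigma f ft t).
Let F0 k : 0 <= F k. Proof. exact: source_coef_ge0. Qed.
Let S0 : 0 <= S. Proof. exact: source_size_ge0. Qed.
Let tT2 : t <= T. Proof. by case/andP: tT. Qed.

Lemma solution_coef_bound k s : (0 < k)%N -> 0 < s <= t ->
  `|inner (u s) (phi k)| <= F k / lambda_ R k.
Proof.
move=> k0 /andP[s0 st]; have sT : 0 < s <= T by rewrite s0 (le_trans st).
have l0 : 0 < lambda_ R k by exact: lt_le_trans ltr01 (lambda_ge1 R k0).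
have cu := @solution_coef_continuous _ _ _ _ _ sol k.
have u0 := solution_coef_init sol k.
apply: (@RL_decay_bound R T alpha s (lambda_ R k) (F k) (fun r => inner (u r) (phi k))
  (fun r => inner (f r) (phi k)) a01 sT l0 cu u0).
- move=> r /andP[r0 rs]; apply: (solution_coef_equation T0 a01 sol) => //.
    exact: src_measurable src.
  by rewrite r0 (le_trans rs)//; case/andP: sT.
- move=> r /andP[r0 rs]; apply: (source_coef_le sigma0 src) => //.
  by rewrite r0 (le_trans rs).
Qed.

(** The difference of the coefficients solves the scalar equation of the scheme, with
    the source [(lambda_h R N k - lambda_ R k) * u_k]. *)
Lemma coef_error_bound k : (0 < k < N)%N ->
  `|U k - grid_coef (uh t) k| <= (N%:R ^+ 2)^-1 * F k.
Proof.
move=> kN; have [k0 _] := andP kN; have [lh0 gap] := eigen_gap R kN.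
have l0 : 0 < lambda_ R k by exact: lt_le_trans ltr01 (lambda_ge1 R k0).
set l := lambda_ R k in l0 gap *; set lh := lambda_h R N k in lh0 gap *.
have cu := @solution_coef_continuous _ _ _ _ _ sol k.
have cc := @scheme_coef_continuous _ _ _ _ _ _ sch k.
apply: (@le_trans _ _ (`|lh - l| * (F k / l) / lh)); last first.
  have -> : `|lh - l| * (F k / l) / lh = `|lh - l| / (l * lh) * F k.
    by move: `|_| => z; field; rewrite ?(gt_eqF l0) ?(gt_eqF lh0).
  by rewrite ler_wpM2r.
rewrite -[grid_coef _ _]mul1r -mulNr.
apply: (RL_decay_bound (v := fun s => inner (u s) (phi k) + -1 * grid_coef (uh s) k)
  (g := fun s => (lh - l) * inner (u s) (phi k)) a01 tT lh0).
- exact: continuous_within_lin.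
- by rewrite (solution_coef_init sol) (scheme_coef_init sch) mulr0 addr0.
- move=> s /andP[s0 st]; have sT : 0 < s <= T by rewrite s0 (le_trans st).
  have h1 := @solution_coef_equation _ _ _ _ _ T0 a01 sol (fun r h => src_measurable src h) k s sT.
  have h2 := @scheme_coef_equation _ _ _ _ _ _ N0 a01 sch k s kN sT.
  have := @RL_deriv_lin _ _ _ (-1) _ _ _ _ _ a01 sT cu cc h1 h2; congr (RL_deriv_at _ _ _ _ _).
  by rewrite -/l -/lh; ring.
- by move=> s st; rewrite normrM ler_wpM2l//; exact: solution_coef_bound.
Qed.

(** The scheme carries no modes from [N] on, so the error there is the whole
    coefficient of the solution. *)
Definition mode_error k : R := U k - (if (k < N)%N then grid_coef (uh t) k else 0).

Lemma mode_error_le k : (0 < k)%N -> `|mode_error k| <= alias_weight R N k * F k.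
Proof.
move=> k0; rewrite /mode_error /alias_weight; case: ltnP => kN.
  by apply: coef_error_bound; rewrite k0.
have tt : 0 < t <= t by rewrite lexx andbT; case/andP: tT.
rewrite subr0; apply: le_trans (solution_coef_bound k0 tt) _.
have kR : 0 < k%:R :> R by rewrite ltr0n.
rewrite mulrC ler_wpM2r// lef_pV2 ?posrE ?exprn_gt0//; last exact: lt_le_trans ltr01 (lambda_ge1 R k0).
exact: lambda_ge_sqr.
Qed.

Lemma source_coef_sqr_sum n : Num.sqrt (\sum_(1 <= k < n) F k ^+ 2) <= S.
Proof.
have h := source_coef_pairing sigma0 src n tT F0.
have h2 : \sum_(1 <= k < n) F k ^+ 2 <= Num.sqrt (\sum_(1 <= k < n) F k ^+ 2) * S.
  apply: le_trans h; apply: ler_sum_nat => k /andP[k0 _].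
  rewrite expr2 ler_wpM2l// ler_peMl//.
  have := lambda_ge1 R k0; rewrite -[X in X <= _](powRr0 (lambda_ R k)) => _.
  apply: (@le_trans _ _ (lambda_ R k `^ 0)); first by rewrite powRr0.
  by rewrite ler_powR ?lambda_ge1// divr_ge0.
have s0 : 0 <= \sum_(1 <= k < n) F k ^+ 2 by apply: sumr_ge0 => k _; exact: sqr_ge0.
have := sqr_sqrtr s0; move: h2; have := sqrtr_ge0 (\sum_(1 <= k < n) F k ^+ 2).
move: (Num.sqrt _) => q q0 h2 qe; have [->//|q1] := eqVneq q 0.
have qp : 0 < q by rewrite lt_neqAle eq_sym q1.
by rewrite -(ler_pM2l qp) -expr2 qe.
Qed.

Lemma source_coef_le_size k : (0 < k)%N -> F k <= S.
Proof.
move=> k0; apply: le_trans (source_coef_sqr_sum k.+1).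
rewrite -[X in X <= _](ger0_norm (F0 k)) -sqrtr_sqr ler_wsqrtr//.
by rewrite big_nat_recr//= lerDr sumr_ge0// => i _; exact: sqr_ge0.
Qed.

Let err := gridvec N (u t) - uh t.

Let partial_err n : 'cV[R]_N.-1 := \col_i \sum_(1 <= k < n) mode_error k * phi k (grid R i).

Lemma partial_error_cvg i : partial_err n i 0 @[n --> \oo] --> err i 0.
Proof.
have [ut0 ut1] := sol_boundary sol tT.
have cut := slice_continuous (sol_continuous sol) tT.
have xi : 0 <= grid R i <= 1.
  rewrite /grid divr_ge0 ?ler0n//= ler_pdivrMr ?ltr0n// mul1r ler_nat.
  by rewrite -[X in (_ <= X)%N](prednK N0) ltnW// ltnS.
have B k : (0 < k)%N -> `|inner (u t) (phi k)| <= S / k%:R ^+ 2.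
  move=> k0; have tt : 0 < t <= t by rewrite lexx andbT; case/andP: tT.
  apply: le_trans (solution_coef_bound k0 tt) _.
  have kR : 0 < k%:R :> R by rewrite ltr0n.
  apply: ler_pM; rewrite ?invr_ge0 ?lambda_ge0 ?source_coef_le_size//.
  rewrite lef_pV2 ?posrE ?exprn_gt0//; last exact: lt_le_trans ltr01 (lambda_ge1 R k0).
  exact: lambda_ge_sqr.
have h := sine_series_cvg cut ut0 ut1 B xi.
have -> : err i 0 = u t (grid R i) - uh t i 0 by rewrite !mxE.
have H : \sum_(1 <= k < n) inner (u t) (phi k) * phi k (grid R i) - uh t i 0
    @[n --> \oo] --> u t (grid R i) - uh t i 0.
  by apply: cvgB; [exact: h|exact: cvg_cst].
apply: cvg_trans H; apply: near_eq_cvg; exists N => // n /= Nn.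
rewrite mxE /mode_error (grid_coefK N0 (uh t)).
under [RHS]eq_bigr do rewrite mulrBl.
rewrite sumrB; congr (_ - _).
rewrite (big_cat_nat N0 Nn)/= [X in _ = _ + X]big1_seq ?addr0; last first.
  by move=> k /andP[_]; rewrite mem_index_iota => /andP[Nk _]; rewrite ltnNge Nk mul0r.
by apply: eq_big_nat => k /andP[_ ->].
Qed.

Lemma grid_error_sqnorm : grid_sqnorm err <= 3 * ((N%:R ^+ 2)^-1 * S) ^+ 2.
Proof.
have h : grid_sqnorm (partial_err n) @[n --> \oo] --> grid_sqnorm err.
  apply: cvgM; first exact: cvg_cst.
  apply: cvg_big => [|i _]; first exact: add_continuous.
  by rewrite expr2; under eq_fun do rewrite expr2; apply: cvgM; exact: partial_error_cvg.
apply: (cvgr_to_le h); near=> n.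
apply: (grid_sqnorm_le (n := n) (E := mode_error) (F := F) N0) => //.
- by move=> i; rewrite mxE.
- exact: mode_error_le.
- exact: source_coef_sqr_sum.
Unshelve. all: by end_near.
Qed.

(** The factor [lambda_ R k `^ (sigma / 2)] is borrowed by the coefficients of the
    source and returned by the weights. *)
Lemma grid_error_sup (B : R) i :
  (forall n, Num.sqrt (\sum_(1 <= k < n) (alias_weight R N k) ^+ 2 * k%:R `^ (- (2 * sigma))) <= B) ->
  `|err i 0| <= Num.sqrt 2 * (B * S).
Proof.
move=> hB.
have h : `|partial_err n i 0| @[n --> \oo] --> `|err i 0|.
  by apply: cvg_norm; exact: partial_error_cvg.
apply: (cvgr_to_le h); near=> n; rewrite mxE.
apply: (@le_trans _ _ (\sum_(1 <= k < n) Num.sqrt 2 * (alias_weight R N k * F k))).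
  apply: le_trans (ler_norm_sum _ _ _) _; apply: ler_sum_nat => k /andP[k0 _].
  by rewrite normrM mulrC ler_pM ?normr_phi_le// mode_error_le.
rewrite -mulr_sumr ler_wpM2l ?sqrtr_ge0//.
pose a k := if (0 < k)%N then alias_weight R N k * lambda_ R k `^ (- (sigma / 2)) else 0.
have a0 k : 0 <= a k.
  by rewrite /a; case: ifP => // _; rewrite mulr_ge0 ?powR_ge0 ?alias_weight_ge0.
have hp := source_coef_pairing sigma0 src n tT a0.
have e : \sum_(1 <= k < n) alias_weight R N k * F k =
    \sum_(1 <= k < n) a k * (lambda_ R k `^ (sigma / 2) * F k).
  apply: eq_big_nat => k /andP[k0 _]; rewrite /a k0 -mulrA; congr (_ * _).
  rewrite mulrA -pos_powRD ?addNr ?powRr0 ?mul1r//.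
  exact: lt_le_trans ltr01 (lambda_ge1 R k0).
rewrite e; apply: le_trans hp _; rewrite ler_wpM2r//.
apply: le_trans (hB n); apply: ler_wsqrtr; apply: ler_sum_nat => k /andP[k0 _].
rewrite /a k0 exprMn ler_wpM2l ?sqr_ge0//.
rewrite -powR_mulrn ?powR_ge0// -powRrM mulNr divfK ?pnatr_eq0//.
have kR : 0 < k%:R :> R by rewrite ltr0n.
have l1 := lambda_ge1 R k0; have l0 := lt_le_trans ltr01 l1.
rewrite !powRN lef_pV2 ?posrE ?powR_gt0// powRrM.
apply: ge0_ler_powR; rewrite ?nnegrE ?powR_ge0 ?lambda_ge0//.
by rewrite powR_mulrn// lambda_ge_sqr.
Unshelve. all: by end_near.
Qed.

End Error.

Theorem theorem4 (R : realType) (T alpha sigma : R) (hT : 0 < T)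
    (halpha : 0 < alpha < 1) (hsigma : 0 <= sigma) :
  exists2 C : R, 0 < C &
    forall (N : nat) (f ft u : R -> R -> R) (uh : R -> 'cV[R]_N.-1),
      (0 < N)%N ->
      admissible_source T sigma f ft ->
      subdiffusion_solution T alpha (fun=> 0) f u ->
      scheme_solution T alpha (fun=> 0) f uh ->
      forall t : R, 0 < t <= T ->
        let h : R := N%:R^-1 in
        ((normlinf (gridvec N (u t) - uh t))%:E <=
           (C * h `^ Num.min (sigma + 3 / 2) 2
              * ell h `^ chi0 (1 / 4 - sigma / 2))%:E
           * source_size sigma f ft t)%E
        /\ ((norml2 (gridvec N (u t) - uh t))%:E <=
           (C * h ^+ 2)%:E * source_size sigma f ft t)%E.
Proof.
have [K K0 hK] := power_sum_bound hsigma.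
have C0 : 0 < Num.sqrt 2 * Num.sqrt K + 3 :> R.
  by rewrite ltr_wpDl// mulr_ge0 ?sqrtr_ge0.
exists (Num.sqrt 2 * Num.sqrt K + 3) => // N f ft u uh N0 src sol sch t tT h.
set C := _ + 3 in C0 *.
have S0 := source_size_ge0 sigma f ft t.
rewrite (source_size_fin src tT) -!EFinM !lee_fin.
set S := fine _ in S0 *.
set X := h `^ _; set Y := ell h `^ _.
have X0 : 0 <= X by exact: powR_ge0.
have Y0 : 0 <= Y by exact: powR_ge0.
have [N1|N1] := leqP N 1.
  (* With a single cell there is no interior node. *)
  have M0 (i : 'I_N.-1) : False.
    by have := ltn_ord i; rewrite ltn_predRL ltnNge (leq_trans N1).
  have linf0 : normlinf (gridvec N (u t) - uh t) = 0.
    by rewrite /normlinf; elim/big_rec: _ => // i; case: (M0 i).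
  have l20 : norml2 (gridvec N (u t) - uh t) = 0.
    by rewrite /norml2 big1 ?mulr0 ?sqrtr0// => i _; case: (M0 i).
  rewrite linf0 l20; split; apply: mulr_ge0 => //.
    exact: mulr_ge0 (mulr_ge0 (ltW C0) X0) Y0.
  exact: mulr_ge0 (ltW C0) (sqr_ge0 _).
split.
  apply: bigmax_le => [|i _]; first by rewrite !mulr_ge0// ltW.
  apply: le_trans (grid_error_sup hT halpha hsigma N0 src sol sch tT
    (B := Num.sqrt K * (X * Y)) i _) _ => [n|].
    apply: le_trans (ler_wsqrtr (hK N n N1)) _.
    by rewrite sqrtrM ?(ltW K0)// sqrtr_sqr ger0_norm// mulr_ge0.
  rewrite -!mulrA [leRHS]mulrDl -!mulrA lerDl.
  by rewrite !mulr_ge0.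
have hE := grid_error_sqnorm hT halpha hsigma N0 src sol sch tT.
have NR : 0 < N%:R :> R by rewrite ltr0n.
have h0 : 0 <= h ^+ 2 * S by rewrite mulr_ge0 ?sqr_ge0.
apply: (@le_trans _ _ (3 * (h ^+ 2 * S))); last first.
  by rewrite -[leRHS]mulrA; apply: ler_wpM2r => //; rewrite lerDr mulr_ge0 ?sqrtr_ge0.
have z0 : 0 <= 3 * (h ^+ 2 * S) by rewrite mulr_ge0.
rewrite -[leRHS](ger0_norm z0) -sqrtr_sqr; apply: ler_wsqrtr.
apply: (@le_trans _ _ (2 * grid_sqnorm (gridvec N (u t) - uh t))).
  rewrite /grid_sqnorm mulrA; apply: ler_wpM2r; first by apply: sumr_ge0 => i _; exact: sqr_ge0.
  have N2 : (0 < N.-1)%N by rewrite -subn1 subn_gt0.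
  rewrite ler_pdivlMr// mulrC ler_pdivrMr ?ltr0n// -natrM ler_nat.
  by rewrite -[X in (X <= _)%N](prednK N0) mul2n -addnn -[X in (X <= _)%N]addn1 leq_add2l.
move: hE; rewrite -exprVn -/h -/S; move: (grid_sqnorm _) (h ^+ 2 * S) h0 => g z z0' gz.
by have := sqr_ge0 z; nra.
Qed.
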